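(* Let $D\subset\mathbb{R}^2$ be a domain with coordinates $(u^1,u^2)$ and suppose that the following smooth data are given on $D$: (i) a traceless symmetric 2-form $\Omega=(\Omega_{ij})$ (i.e. $\Omega_{11}+\Omega_{22}=0$); (ii) a positive function $m$, or equivalently a positive function $E$, related by $m=\frac{-\det\Omega}{E}$; (iii) a 1-form $\omega=\omega_1du^1+\omega_2du^2$; (iv) a symmetric 2-form $\Omega^*=(\Omega^*_{ij})$. Suppose that they satisfy the integrability conditions $$\Omega_{11,2}-\Omega_{12,1}=\omega_1\Omega_{12}-\omega_2\Omega_{11},\qquad \Omega_{12,2}-\Omega_{22,1}=\omega_1\Omega_{22}-\omega_2\Omega_{12},$$ $$\Omega^*_{11,2}-\Omega^*_{12,1}=-\omega_1\Omega^*_{12}+\omega_2\Omega^*_{11}+\frac12\,\frac{\Omega^*_{11}+\Omega^*_{22}}{|\Omega|^2}\,(|\Omega|^2)_{u^2},$$ $$\Omega^*_{12,2}-\Omega^*_{22,1}=-\omega_1\Omega^*_{22}+\omega_2\Omega^*_{12}-\frac12\,\frac{\Omega^*_{11}+\Omega^*_{22}}{|\Omega|^2}\,(|\Omega|^2)_{u^1},$$ $$\omega_{1,2}-\omega_{2,1}=\frac1m\Big((\Omega_{11}-\Omega_{22})\Omega^*_{12}-(\Omega^*_{11}-\Omega^*_{22})\Omega_{12}\Big),$$ $$\mathcal K-1=\frac1{m^2}\,\mathrm{Tr}(\Omega\Omega^* ),$$ where $\mathcal K$ is the Gaussian curvature of the metric $m|du|^2$. Then for every point $p_0\in D$ there exist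 an open neighborhood $D_0$ of $p_0$ in $D$, a parametrized surface $\hat x:D_0\to\mathbb{S}^3$ with no umbilical point, and a positive function $\hat\lambda:D_0\to\mathbb{R}^+$ with $\hat\lambda(p_0)=1$, such that (a) $\Omega=\hat\lambda\,\overset{\circ}{II}$, where $\overset{\circ}{II}$ is the traceless part of the second fundamental form of $\hat x$ in the standard round $\mathbb{S}^3$; (b) $m|du|^2=\langle d\xi,d\xi\rangle$ is the Möbius metric induced by the conformal Gauss map $\xi$ of $\hat x$; (c) $\omega=-I\big((\overset{\circ}{II})^{-1}(dH)\big)-d\log\hat\lambda$, where $I$ is the first fundamental form and $H$ is the mean curvature of $\hat x$ in the standard round $\mathbb{S}^3$; (d) $\Omega^*=-\hat\lambda^{-1}\langle d\xi,dy^*\rangle$, where $y^*=\frac1{1-\hat x\cdot\hat x^*}(1,\hat x^* )$ and $\hat x^*$ is the conformal transform of $\hat x$. The surface $\hat x$ is unique up to a conformal transformation of $\mathbb{S}^3$.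
   Context: $\mathbb{R}^{1,4}=\{(t,x):t\in\mathbb{R},x\in\mathbb{R}^4\}$ with $\langle(t,x),(s,y)\rangle=-st+x\cdot y$; $\mathbb{N}^4_+=\{(t,x):-t^2+|x|^2=0,\ t>0\}$; $\mathbb{S}^{1,3}=\{(t,x):-t^2+|x|^2=1\}$. $\mathbb{S}^3\subset\mathbb{R}^4$ is the unit sphere with round metric. Conventions for the integrability conditions: an index after a comma denotes covariant differentiation with respect to the Levi-Civita connection of $E|du|^2$, a subscript $u^i$ denotes a partial derivative, $|\Omega|^2=E^{-2}\sum_{i,j}\Omega_{ij}^2$ is the squared norm with respect to $E|du|^2$, and $\mathrm{Tr}(\Omega\Omega^* )=\sum_{i,j}\Omega_{ij}\Omega^*_{ij}$ is the trace of the matrix product, $|du|^2=(du^1)^2+(du^2)^2$. For an immersed surface $\hat x$ in $\mathbb{S}^3\subset\mathbb{R}^4$ with unit normal ${\bf n}$ (tangent to $\mathbb{S}^3$): $I=\langle d\hat x,d\hat x\rangle$, $II=-\langle d\hat x,d{\bf n}\rangle$, $H=\frac12\mathrm{tr}_I II$, $\overset{\circ}{II}=II-HI$ (a point is umbilical if $\overset{\circ}{II}=0$ there). In coordinates, $I((\overset{\circ}{II})^{-1}(dH))$ is the 1-form with components $\sum_{j,k}I_{ij}\,(\overset{\circ}{II}{}^{-1})^{jk}H_{u^k}$, where $\overset{\circ}{II}{}^{-1}$ is the inverse matrix of $(\overset{\circ}{II}_{ij})$. The conformal Gauss map is $\xi=H(1,\hat x)+(0,{\bf n}):D_0\to\mathbb{S}^{1,3}$.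 When $\hat x$ has no umbilical point, $\xi$ is a spacelike immersion, and there is a unique $y^*:D_0\to\mathbb{N}^4_+$ with $$\langle y^*,y\rangle=-1,\quad\langle y^*,y^*\rangle=0,\quad\langle y^*,\xi\rangle=0,\quad\langle y^*,\xi_{u^1}\rangle=\langle y^*,\xi_{u^2}\rangle=0,\qquad y=(1,\hat x).$$ Writing $y^*$ as a positive function times $(1,\hat x^* )$ defines the conformal transform $\hat x^*:D_0\to\mathbb{S}^3$; then $y^*=\frac1{1-\hat x\cdot\hat x^*}(1,\hat x^* )$. In (d), $\langle d\xi,dy^*\rangle$ is the 2-form with components $\langle\xi_{u^i},y^*_{u^j}\rangle$. *)

(* Defs.v *)
From HB Require Import structures.
From mathcomp Require Import all_boot all_order all_algebra.
From mathcomp Require Import all_classical all_reals all_analysis.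
Set Implicit Arguments.
Unset Strict Implicit.
Unset Printing Implicit Defensive.
Import Order.TTheory GRing.Theory Num.Theory.
Import numFieldNormedType.Exports.
Local Open Scope classical_set_scope.
Local Open Scope ring_scope.

Section Smoothness.
Context {R : realType} {V W : normedModType R}.

(* Coincides with the usual C^k class when [U] is open and [V] is
   finite-dimensional. *)
Fixpoint Ck (k : nat) (U : set V) (f : V -> W) : Prop :=
  match k with
  | 0 => forall x, U x -> {for x, continuous f}
  | k'.+1 => (forall x, U x -> differentiable f x) /\
             forall v, Ck k' U (fun x => 'D_v f x)
  end.

Definition smooth (U : set V) (f : V -> W) : Prop := forall k, Ck k U f.

End Smoothness.

Section Riemannian.
Context {R : realType}.
Local Notation pt := 'rV[R]_2.
Implicit Types (g T : pt -> 'M[R]_2) (w : pt -> 'rV[R]_2) (u : pt).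

Definition pd {W : normedModType R} (i : 'I_2) (f : pt -> W) u : W :=
  'D_(delta_mx 0 i) f u.

Definition conformal_metric (f : pt -> R) : pt -> 'M[R]_2 := fun u => (f u)%:M.

(* Gamma^k_{ij} *)
Definition christoffel g (k i j : 'I_2) u : R :=
  2^-1 * \sum_(l < 2) invmx (g u) k l *
    (pd i (fun v => g v j l) u + pd j (fun v => g v i l) u
     - pd l (fun v => g v i j) u).

(* w_{i,k} *)
Definition cov1 g w (i k : 'I_2) u : R :=
  pd k (fun v => w v 0 i) u - \sum_(l < 2) christoffel g l k i u * w u 0 l.

(* T_{ij,k} *)
Definition cov2 g T (i j k : 'I_2) u : R :=
  pd k (fun v => T v i j) u
  - \sum_(l < 2) christoffel g l k i u * T u l j
  - \sum_(l < 2) christoffel g l k j u * T u i l.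

(* The l-th component of R(d_i, d_j) d_k, where
   R(X, Y) = [nabla_X, nabla_Y] - nabla_[X, Y]. *)
Definition riemann g (l k i j : 'I_2) u : R :=
  pd i (christoffel g l j k) u - pd j (christoffel g l i k) u
  + \sum_(s < 2) (christoffel g l i s u * christoffel g s j k u
                  - christoffel g l j s u * christoffel g s i k u).

(* <R(d_1, d_2) d_2, d_1> / det g *)
Definition gauss_curvature g u : R :=
  (\sum_(l < 2) g u 0 l * riemann g l 1 0 1 u) / \det (g u).

(* Squared norm of T with respect to E |du|^2. *)
Definition sqnorm (E : pt -> R) T u : R :=
  E u ^- 2 * \sum_(i < 2) \sum_(j < 2) T u i j ^+ 2.

End Riemannian.

Section Surfaces.
Context {R : realType}.
Local Notation pt := 'rV[R]_2.
Local Notation R4 := 'rV[R]_4.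
Local Notation R14 := (R * 'rV[R]_4)%type.

Definition dot (x y : R4) : R := \sum_(i < 4) x 0 i * y 0 i.

Definition minkowski (p q : R14) : R := - (p.1 * q.1) + dot p.2 q.2.

Definition S3 : set R4 := [set x | dot x x = 1].

Definition N4plus : set R14 := [set p | minkowski p p = 0 /\ 0 < p.1].

Record immersed_surface (D0 : set pt) (x n : pt -> R4) : Prop := {
  is_smooth : smooth D0 x;
  is_sphere : forall u, D0 u -> S3 (x u);
  is_immersion : forall u, D0 u -> row_free (jacobian x u);
  is_normal_smooth : smooth D0 n;
  is_normal_unit : forall u, D0 u -> dot (n u) (n u) = 1;
  is_normal_tangent : forall u, D0 u -> dot (n u) (x u) = 0;
  is_normal_orth : forall u, D0 u -> forall i, dot (n u) (pd i x u) = 0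
}.

Section Geometry.
Variables x n : pt -> R4.
Implicit Type u : pt.

Definition fstFF u : 'M[R]_2 := \matrix_(i, j) dot (pd i x u) (pd j x u).
Definition sndFF u : 'M[R]_2 := \matrix_(i, j) - dot (pd i x u) (pd j n u).
Definition meanH u : R := 2^-1 * \tr (invmx (fstFF u) *m sndFF u).
Definition sndFF0 u : 'M[R]_2 := sndFF u - meanH u *: fstFF u.
Definition umbilical u : Prop := sndFF0 u = 0.

Definition dH u : 'cV[R]_2 := \col_k pd k meanH u.

Definition y_lift u : R14 := (1, x u).
Definition conformal_gauss u : R14 := meanH u *: (1, x u) + (0, n u).

(* The null vector y^*; the conditions determine it at a non-umbilical point. *)
Definition dual_lift u : R14 :=
  get [set z : R14 | [/\ N4plus z, minkowski z (y_lift u) = -1,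
    minkowski z (conformal_gauss u) = 0 &
    forall i : 'I_2, minkowski z (pd i conformal_gauss u) = 0]].

Definition conformal_transform u : R4 := (dual_lift u).1^-1 *: (dual_lift u).2.

Definition y_star u : R14 :=
  (1 - dot (x u) (conformal_transform u))^-1 *: (1, conformal_transform u).

End Geometry.

(* Replacing [n] by [- n] changes the sign of [sndFF0]; since [lam] is positive,
   [rz_Om] fixes the orientation of the normal. *)
Record realizes (p0 : pt) (Om : pt -> 'M[R]_2) (m : pt -> R)
    (w : pt -> 'rV[R]_2) (Oms : pt -> 'M[R]_2)
    (D0 : set pt) (x n : pt -> R4) (lam : pt -> R) : Prop := {
  rz_surface : immersed_surface D0 x n;
  rz_non_umbilical : forall u, D0 u -> ~ umbilical x n u;
  rz_lam_smooth : smooth D0 lam;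
  rz_lam_gt0 : forall u, D0 u -> 0 < lam u;
  rz_lam_p0 : lam p0 = 1;
  rz_Om : forall u, D0 u -> Om u = lam u *: sndFF0 x n u;
  rz_m : forall u, D0 u -> forall i j : 'I_2,
    minkowski (pd i (conformal_gauss x n) u) (pd j (conformal_gauss x n) u)
    = conformal_metric m u i j;
  rz_w : forall u, D0 u -> forall i : 'I_2,
    w u 0 i = - (fstFF x u *m invmx (sndFF0 x n u) *m dH x n u) i 0
              - pd i (fun v => ln (lam v)) u;
  rz_Oms : forall u, D0 u -> forall i j : 'I_2,
    Oms u i j = - ((lam u)^-1 *
      minkowski (pd i (conformal_gauss x n) u) (pd j (y_star x n) u))
}.

(* A smooth self-map of S^3 is given by a map of R^4 preserving S^3 and smooth
   near it; its values away from S^3 are irrelevant. *)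
Definition smooth_S3_map (F : R4 -> R4) : Prop :=
  (forall p, S3 p -> S3 (F p)) /\
  exists U : set R4, [/\ open U, S3 `<=` U & smooth U F].

(* Conformal diffeomorphisms of the round S^3, of either orientation. *)
Definition conformal_transformation (F : R4 -> R4) : Prop :=
  [/\ smooth_S3_map F,
      exists G : R4 -> R4, smooth_S3_map G /\
        forall p, S3 p -> G (F p) = p /\ F (G p) = p &
      forall p, S3 p -> exists2 c : R, 0 < c &
        forall v v' : R4, dot p v = 0 -> dot p v' = 0 ->
          dot ('D_v F p) ('D_v' F p) = c * dot v v'].

End Surfaces.

(* Main.v *)
(* The moving frame F = (Y, Y*, xi, xi_1, xi_2) in R^{1,4}, with Y = lam (1, x)
   and the dual vector rescaled by 1/lam, has a Gram matrix depending on m alone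
   and satisfies dF = (A_1 du^1 + A_2 du^2) F, where A_1 and A_2 are built from
   (Omega, Omega*, m, omega).  The integrability conditions say exactly that this
   connection is flat.  Existence: solve the radial linear ODE from p0; flatness
   and a Gronwall estimate show that the resulting F solves the whole system, the
   Gram relations propagate from p0, and x and lam are read off the first row.
   Uniqueness: the frames of two solutions satisfy the same linear system and have
   the same Gram matrix at p0, so they differ by a constant Lorentz
   transformation, which acts on the sphere of null lines conformally. *)
Require Import Defs.
From HB Require Import structures.
From mathcomp Require Import all_boot all_order all_algebra.
From mathcomp Require Import all_classical all_reals all_analysis.
From mathcomp Require Import ring lra.
Set Implicit Arguments.
Unset Strict Implicit.
Unset Printing Implicit Defensive.
Import Order.TTheory GRing.Theory Num.Theory.
Import numFieldNormedType.Exports.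
Local Open Scope classical_set_scope.
Local Open Scope ring_scope.

(** * Differential calculus *)

Section Differentiability.
Context {R : realType}.

(** The weights close the system: scaling (1, x) by lam and the dual vector by 1/lam absorbs the
    mean curvature and lam, leaving only the data and the logarithmic derivatives of m in the
    connection. The Codazzi conditions are stated with E |du|^2, while the frame sees m |du|^2;
    since |Omega|^2 = 2m/E, the terms with d|Omega|^2 in the dual conditions are exactly the price
    of this change of metric, and E drops out. The analytic obstacle is the dependence of the radial
    solutions on the direction v. No theorem on parameters is invoked; the derivative is guessed.
    Along h it must be s A_h, taken at p0 + s v, applied to the solution. Flatness makes the error
    of this guess solve the same linear equation up to O(|h|^2), so one Gronwall estimate yields
    differentiability and dF = A F together, and smoothness follows by bootstrapping. Existence is
    local, so the ball may be shrunk until the coefficients are small; uniqueness has to hold on any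
    connected neighbourhood, hence an open-and-closed argument there. *)

Lemma near_eq_differentiable (V W : normedModType R) (f g : V -> W) (x : V) :
  (\near x, f x = g x) -> differentiable f x -> differentiable g x.
Proof.
move=> fg df; have fgx : f x = g x := nbhs_singleton fg.
have cd : continuous ('d f x) by exact: diff_continuous.
have H : g \o shift x = cst (g x) + 'd f x +o_ 0 id.
  apply/eqaddoP => e e0; have [_ /eqaddoP/(_ e e0)] := (diff_locallyP _ _).1 df.
  apply: filter_app; move: fg; rewrite (near_shift 0)/= subr0 => fg.
  near=> h; rewrite -fgx.
  have fgh : f (h + x) = g (h + x) by near: h.
  suff -> : (f \o shift x - (cst (f x) + 'd f x)) h =
         (g \o shift x - (cst (f x) + 'd f x)) h by [].
  by congr (_ - _); rewrite /= fgh.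
have E := diff_unique cd H.
by apply/diff_locallyP; rewrite E.
Unshelve. all: by end_near. Qed.

Lemma differentiable_mxP (V : normedModType R) m n (M : V -> 'M[R]_(m, n)) x :
  differentiable M x <-> forall i j, differentiable (fun u => M u i j) x.
Proof.
split=> [dM i j|dM].
  exact: (differentiable_comp dM (differentiable_coord (M x) i j)).
have -> : M = \sum_(i < m) (\sum_(j < n) (fun u => M u i j *: delta_mx i j : 'M[R]_(m,n))).
  apply/funext => u; rewrite [LHS]matrix_sum_delta fct_sumE.
  by apply: eq_bigr => i _; rewrite fct_sumE.
apply: differentiable_sum => i; apply: differentiable_sum => j.
exact: (@differentiableZl _ _ _ (fun u => M u i j) _ _ (dM i j)).
Qed.

Lemma derive_mxE (V : normedModType R) m n (M : V -> 'M[R]_(m, n)) x v i j :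
  derivable M x v -> 'D_v M x i j = 'D_v (fun u => M u i j) x.
Proof. by move=> dM; rewrite derive_mx // mxE. Qed.

Lemma derive_linear (V W : normedModType R) (f : V -> W) x (a b : R) v w :
  differentiable f x -> 'D_(a *: v + b *: w) f x = a *: 'D_v f x + b *: 'D_w f x.
Proof. by move=> df; rewrite !deriveE // linearD !linearZ. Qed.

End Differentiability.

(** * Closure properties of C^k maps *)

Section CkCalculus.
Context {R : realType} {V : normedModType R}.
Implicit Types (U : set V) (k : nat).

Lemma Ck_sub (W : normedModType R) k U U' (f : V -> W) :
  U' `<=` U -> Ck k U f -> Ck k U' f.
Proof.
elim: k f => [|k IH] f sU /=; first by move=> cf x /sU; exact: cf.
by move=> [df Df]; split=> [x /sU|v]; [exact: df | exact: IH].
Qed.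

Lemma CkW (W : normedModType R) k U (f : V -> W) : Ck k.+1 U f -> Ck k U f.
Proof.
elim: k f => [|k IH] f /= [df Df]; last by split=> // v; exact: IH.
by move=> x Ux; exact: differentiable_continuous (df _ Ux).
Qed.

(** Openness of [U] turns equality on [U] into equality near each of its points, so that derivatives
    agree as well. The rules below compute a derivative only on [U]; this lemma lets their
    inductions continue from the computed formula. *)
Lemma Ck_ext (W : normedModType R) k U (f g : V -> W) : open U ->
  (forall x, U x -> f x = g x) -> Ck k U f -> Ck k U g.
Proof.
move=> oU; elim: k f g => [|k IH] f g fg /=.
  move=> cf x Ux; have cfx : f y @[y --> x] --> f x := cf x Ux.
  suff : g y @[y --> x] --> g x by []; rewrite -(fg _ Ux).
  apply: cvg_trans cfx; apply: near_eq_cvg.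
  near=> y; rewrite fg //; near: y; exact: open_nbhs_nbhs.
have nfg x : U x -> \near x, f x = g x.
  by move=> Ux; near=> y; apply: fg; near: y; exact: open_nbhs_nbhs.
move=> [df Df]; split=> [x Ux|v].
  exact: near_eq_differentiable (nfg _ Ux) (df _ Ux).
by apply: IH (Df v) => x Ux; exact: near_eq_derive (nfg _ Ux).
Unshelve. all: by end_near. Qed.

Lemma Ck_cst (W : normedModType R) k U (a : W) : Ck k U (fun=> a).
Proof.
elim: k a => [|k IH] a /=; first by move=> x _; exact: cst_continuous.
split=> [x _|v]; first exact: differentiable_cst.
have -> : (fun x : V => 'D_v (fun=> a) x) = (fun=> 0) :> (V -> W).
  by apply/funext => x; exact: (derive_cst a x v).
exact: IH.
Qed.

Lemma CkD (W : normedModType R) k U (f g : V -> W) : open U ->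
  Ck k U f -> Ck k U g -> Ck k U (fun x => f x + g x).
Proof.
move=> oU; elim: k f g => [|k IH] f g /=.
  by move=> cf cg x Ux; apply: continuousD; [exact: cf|exact: cg].
move=> [df Df] [dg Dg]; split=> [x Ux|v].
  by apply: differentiableD; [exact: df|exact: dg].
apply: (Ck_ext oU _ (IH _ _ (Df v) (Dg v))) => x Ux.
by rewrite (@deriveD _ _ _ f g) //; apply: diff_derivable; [exact: df|exact: dg].
Qed.

Lemma CkM k U (f g : V -> R) : open U ->
  Ck k U f -> Ck k U g -> Ck k U (fun x => f x * g x).
Proof.
move=> oU; elim: k f g => [|k IH] f g.
  by move=> cf cg x Ux; apply: continuousM; [exact: cf|exact: cg].
move=> fk gk; have [df Df] := fk; have [dg Dg] := gk; split=> [x Ux|v].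
  by apply: differentiableM; [exact: df|exact: dg].
apply: (Ck_ext oU _ (CkD oU (IH _ _ (CkW fk) (Dg v)) (IH _ _ (CkW gk) (Df v)))).
by move=> x Ux; rewrite (@deriveM _ _ f g) //; apply: diff_derivable;
   [exact: df|exact: dg].
Qed.

Lemma CkN k U (f : V -> R) : open U -> Ck k U f -> Ck k U (fun x => - f x).
Proof.
move=> oU fk; apply: (Ck_ext oU _ (CkM oU (Ck_cst k U (-1 : R)) fk)) => x _.
by rewrite mulN1r.
Qed.

Lemma CkB k U (f g : V -> R) : open U ->
  Ck k U f -> Ck k U g -> Ck k U (fun x => f x - g x).
Proof. by move=> oU fk gk; apply: CkD => //; exact: CkN. Qed.

Lemma CkV k U (f : V -> R) : open U -> (forall x, U x -> f x != 0) ->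
  Ck k U f -> Ck k U (fun x => (f x)^-1).
Proof.
move=> oU f0; elim: k => [|k IH].
  by move=> cf x Ux; apply: continuousV; [exact: f0|exact: cf].
move=> fk; have [df Df] := fk; split=> [x Ux|v].
  by apply: differentiableV; [exact: df|exact: f0].
have fkV := IH (CkW fk).
apply: (Ck_ext oU _ (CkN oU (CkM oU (CkM oU fkV fkV) (Df v)))) => x Ux.
rewrite (@deriveV _ _ f) ?f0//; last by apply: diff_derivable; exact: df.
by rewrite scaleNr -exprVn expr2.
Qed.

Lemma Ck_sum k U n (f : 'I_n -> V -> R) : open U -> (forall i, Ck k U (f i)) ->
  Ck k U (fun x => \sum_(i < n) f i x).
Proof.
move=> oU; elim: n f => [|n IH] f fk.
  by apply: (Ck_ext oU _ (Ck_cst k U (0 : R))) => x _; rewrite big_ord0.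
apply: (Ck_ext oU _ (CkD oU (IH (fun i => f (widen_ord (leqnSn n) i)) _) (fk ord_max))).
  by move=> x _; rewrite big_ord_recr.
by move=> i; exact: fk.
Qed.

Lemma Ck_mxP k U m n (M : V -> 'M[R]_(m, n)) : open U ->
  Ck k U M <-> forall i j, Ck k U (fun x => M x i j).
Proof.
move=> oU; elim: k M => [|k IH] M /=.
  split=> [cM i j x Ux|cM x Ux].
    by have := @continuous_comp _ _ _ M (fun A : 'M[R]_(m,n) => A i j) x (cM x Ux)
      (@coord_continuous _ _ _ _ _ _).
  apply/cvgrPdist_lt => e e0; near=> y.
  rewrite [ltLHS]/Num.Def.normr/= mx_normrE.
  apply: bigmax_lt => // ij _; rewrite !mxE/=.
  move: ij; near: y; apply: filter_forall => ij.
  by have /cvgrPdist_lt/(_ e e0) := cM ij.1 ij.2 x Ux.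
split=> [[dM DM] i j|dM].
  split=> [x Ux|v]; first by move/differentiable_mxP: (dM x Ux).
  apply: (Ck_ext oU _ ((IH _).1 (DM v) i j)) => x Ux.
  by rewrite derive_mxE //; apply: diff_derivable; exact: dM.
split=> [x Ux|v]; first by apply/differentiable_mxP => i j; exact: (dM i j).1.
apply/IH => i j; apply: (Ck_ext oU _ ((dM i j).2 v)) => x Ux.
rewrite derive_mxE //; apply/derivable_mxP => a b.
by apply: diff_derivable; exact: (dM a b).1.
Unshelve. all: by end_near. Qed.

End CkCalculus.

(** * Mean value theorem on lines and symmetry of second derivatives *)

Section Lines.
Context {R : realType}.

Lemma is_derive_line (V W : normedModType R) (f : V -> W) (a v : V) (t : R) :
  differentiable f (a + t *: v) ->
  is_derive t 1 (fun s => f (a + s *: v)) ('D_v f (a + t *: v)).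
Proof.
move=> df.
have dl : is_diff t (fun s : R => a + s *: v) (fun s : R => s *: v).
  have := is_diffD (is_diff_cst a t) (is_diff_scalel t v).
  by rewrite add0r.
have dc := is_diff_comp dl (differentiableP df).
apply: DeriveDef; first by apply: diff_derivable; exact: (@ex_diff _ _ _ _ _ _ _ dc).
rewrite deriveE; last exact: (@ex_diff _ _ _ _ _ _ _ dc).
by rewrite (@diff_val _ _ _ _ _ _ _ dc) /= scale1r deriveE.
Qed.

Lemma MVT_line (V : normedModType R) (f : V -> R) (a v : V) (h : R) : 0 < h ->
  (forall t, 0 <= t <= h -> differentiable f (a + t *: v)) ->
  exists2 c, 0 < c < h & f (a + h *: v) - f a = h * 'D_v f (a + c *: v).
Proof.
move=> h0 df.
have [||c] := @MVT R (fun t => f (a + t *: v)) (fun t => 'D_v f (a + t *: v)) 0 h h0.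
- move=> t; rewrite in_itv/= => /andP[t0 th]; apply: is_derive_line; apply: df.
  by rewrite !ltW.
- apply: derivable_within_continuous => t; rewrite in_itv/= => th.
  by have [] := is_derive_line (df _ th).
rewrite in_itv/= scale0r addr0 subr0 mulrC => ch ->; by exists c.
Qed.

(** The second difference of [f] over the parallelogram spanned by [h *: v] and [h *: w] is
    symmetric in [v] and [w], and it equals h^2 times either mixed derivative up to h^2 times an
    arbitrarily small constant. *)
Lemma derive_comm (V : normedModType R) (U : set V) (f : V -> R) (v w x : V) :
  open U -> Ck 2 U f -> U x -> 'D_v (fun y => 'D_w f y) x = 'D_w (fun y => 'D_v f y) x.
Proof.
move=> oU fC2 Ux.
(* Two mean value theorems: along [p] for the increment of [f] in direction [q], then along [q] for
   the derivative of [f] along [p]. The intermediate point stays in the parallelogram, where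
   continuity of the mixed derivative applies. *)
have key (p q : V) (e : R) : 0 < e -> \forall h \near 0^'+,
  `|f (x + h *: p + h *: q) - f (x + h *: p) - f (x + h *: q) + f x
    - h ^+ 2 * 'D_q (fun y => 'D_p f y) x| <= h ^+ 2 * e.
  move=> e0; have [df Df] := fC2; have [dDp cDp] := Df p.
  have /cvgrPdist_le/(_ e e0) cx := cDp q x Ux.
  have : \forall y \near x, U y /\ `|'D_q (fun y => 'D_p f y) x - 'D_q (fun y => 'D_p f y) y| <= e.
    by near=> y; split; near: y; [exact: open_nbhs_nbhs|exact: cx].
  case/nbhs_normP => r /= r0 xr.
  (* The summand 1 keeps the factor positive when [p] and [q] vanish; [h] times this factor bounds
     the distance from [x] to any point of the parallelogram. *)
  have pq0 : 0 < `|p| + `|q| + 1 by rewrite ltr_wpDl // addr_ge0.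
  near=> h; have h0 : 0 < h by near: h; exact: nbhs_right_gt.
  have inr s t : 0 <= s <= h -> 0 <= t <= h -> `|x - (x + s *: p + t *: q)| < r.
    move=> /andP[s0 sh] /andP[t0 th]; rewrite -addrA opprD addNKr normrN.
    apply: (le_lt_trans (ler_normD _ _)); rewrite !normrZ !ger0_norm //.
    apply: (@le_lt_trans _ _ (h * (`|p| + `|q| + 1))).
      by rewrite !mulrDr -[leLHS]addr0 !lerD // ?ler_wpM2r // mulr1 ltW.
    rewrite -ltr_pdivlMr //; near: h; apply: nbhs_right_lt; exact: divr_gt0.
  have hh : 0 <= h <= h by rewrite lexx ltW.
  have z0 : 0 <= (0 : R) <= h by rewrite lexx ltW.
  pose g y := f (y + h *: q) - f y.
  have Dg y : U y -> U (y + h *: q) -> differentiable g y.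
    move=> Uy Uyh; apply: (@differentiableB _ _ _ (fun y => f (y + h *: q)) f); last exact: df.
    apply: (@differentiable_comp _ _ _ _ (fun y => y + h *: q) f); last exact: df.
    exact: differentiableD.
  have Ust s t : 0 <= s <= h -> 0 <= t <= h -> U (x + s *: p + t *: q).
    by move=> s1 t1; have [] := xr _ (inr _ _ s1 t1).
  have Us s : 0 <= s <= h -> U (x + s *: p).
    by move=> s1; have := Ust s 0 s1 z0; rewrite scale0r addr0.
  have [|c c1] := @MVT_line _ g x p h h0.
    by move=> t t1; apply: Dg; [exact: Us|exact: Ust].
  have {c1} c1 : 0 <= c <= h by case/andP: c1 => *; rewrite !ltW.
  rewrite /g => E.
  have {E} -> : f (x + h *: p + h *: q) - f (x + h *: p) - f (x + h *: q) + f x =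
     h * 'D_p (fun y => f (y + h *: q) - f y) (x + c *: p).
    by rewrite -E; ring.
  have -> : 'D_p (fun y => f (y + h *: q) - f y) (x + c *: p) =
     'D_p f (x + c *: p + h *: q) - 'D_p f (x + c *: p).
    rewrite (@deriveB _ _ _ (fun y => f (y + h *: q)) f); first last.
    - by apply: diff_derivable; apply: df; exact: Us.
    - apply: diff_derivable; apply: (@differentiable_comp _ _ _ _ (fun y => y + h *: q) f).
        exact: differentiableD.
      by apply: df; exact: Ust.
    congr (_ - _); rewrite /derive; congr (lim _).
    have -> : (fun k : R => k^-1 *: ((f \o shift (x + c *: p + h *: q)) (k *: p) - f (x + c *: p + h *: q))) =
        (fun k : R => k^-1 *: (((fun y => f (y + h *: q)) \o shift (x + c *: p)) (k *: p) -
          f (x + c *: p + h *: q))); last by [].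
    by apply/funext => k /=; rewrite addrA.
  have [|d d1 ->] := @MVT_line _ (fun y => 'D_p f y) (x + c *: p) q h h0.
    by move=> t t1; apply: dDp; exact: Ust.
  have {d1} d1 : 0 <= d <= h by case/andP: d1 => *; rewrite !ltW.
  rewrite mulrA -expr2 -mulrBr normrM ger0_norm ?sqr_ge0// ler_wpM2l ?sqr_ge0//.
  by rewrite distrC; have [] := xr _ (inr _ _ c1 d1).
apply/eqP; rewrite -subr_eq0 -normr_le0; apply/ler_addgt0Pl => e e0.
rewrite addr0.
have e2 : 0 < e / 2 by rewrite divr_gt0.
have [h [h0 [A B]]] : exists h : R, 0 < h /\ _ :=
  filter_ex (filterI (nbhs_right_gt (0 : R)) (filterI (key v w _ e2) (key w v _ e2))).
have h2 : (0 : R) < h ^+ 2 by exact: exprn_gt0.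
rewrite -(ler_pM2l h2) -[X in X * `|_|]ger0_norm ?sqr_ge0// -normrM.
apply: le_trans (_ : h ^+ 2 * (e/2) + h ^+ 2 * (e/2) <= _); last first.
  by rewrite -mulrDr -splitr.
apply: le_trans (lerD A B); apply: le_trans (ler_normB _ _).
rewrite [x + h *: w + h *: v]addrAC le_eqVlt; apply/orP; left; apply/eqP; congr (`|_|).
move: ('D_v _ x) ('D_w _ x) (f _) (f _) (f _) (f _) => a b c d c' d'.
ring.
Unshelve. all: by end_near. Qed.

End Lines.

(** * Linear differential equations *)

Section MatrixNorm.
Context {R : realType}.

Lemma mx_norm_le m n (A : 'M[R]_(m, n)) e : 0 <= e ->
  (forall i j, `|A i j| <= e) -> `|A| <= e.
Proof.
move=> e0 Ae; rewrite [leLHS]/Num.Def.normr/= mx_normrE.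
by apply: bigmax_le => // i _; exact: Ae.
Qed.

Lemma le_mx_norm m n (A : 'M[R]_(m, n)) i j : `|A i j| <= `|A|.
Proof.
by rewrite [leRHS]/Num.Def.normr/= mx_normrE; exact: (le_bigmax _ _ (i, j)).
Qed.

Lemma mulmx_norm_le m n p (A : 'M[R]_(m, n)) (B : 'M[R]_(n, p)) :
  `|A *m B| <= n%:R * (`|A| * `|B|).
Proof.
apply: mx_norm_le => [|i j]; first by rewrite !mulr_ge0.
rewrite mxE; apply: le_trans (ler_norm_sum _ _ _) _.
apply: le_trans (_ : \sum_(k < n) `|A| * `|B| <= _); last first.
  by rewrite sumr_const card_ord mulr_natl.
by apply: ler_sum => k _; rewrite normrM ler_pM // le_mx_norm.
Qed.

End MatrixNorm.

Section MatrixODE.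
Context {R : realType} {p q : nat}.
Local Notation mat := 'M[R]_(p, q).
Implicit Types (f : R -> mat) (e s t K : R).

Lemma is_derive_mxP (f : R -> mat) (t : R) (df : mat) :
  is_derive t 1 f df <-> forall i j, is_derive t 1 (fun s => f s i j) (df i j).
Proof.
split=> [[fd <-] i j|H].
  by rewrite derive_mxE //; apply/derivableP; move/derivable_mxP : fd.
have fd : derivable f t 1 by apply/derivable_mxP => i j; have [] := H i j.
apply: DeriveDef => //; apply/matrixP => i j; rewrite derive_mxE //.
by have [_ ->] := H i j.
Qed.

(** The norm is the maximum of the entries, so the scalar mean value theorem, applied to each entry
    with its own intermediate point, gives the bound without any loss of constant. *)
Lemma mean_value_le f (df : R -> mat) K : 0 <= K ->
  (forall t, 0 <= t <= 1 -> is_derive t 1 f (df t)) ->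
  (forall t, 0 <= t <= 1 -> `|df t| <= K) ->
  forall s, 0 <= s <= 1 -> `|f s - f 0| <= K.
Proof.
move=> K0 fdf dfK s /andP[s0 s1]; apply: mx_norm_le => // i j; rewrite !mxE.
have fij t : 0 <= t <= 1 -> is_derive t 1 (fun s => f s i j) (df t i j).
  by move=> /fdf/is_derive_mxP.
have [||c] := @MVT_segment R (fun t => f t i j) (fun t => df t i j) 0 s s0.
- move=> t; rewrite in_itv/= => /andP[t0 ts]; apply: fij.
  by rewrite !ltW//= (lt_le_trans ts).
- apply: derivable_within_continuous => t; rewrite in_itv/= => /andP[t0 ts].
  by have [] : is_derive t 1 (fun s => f s i j) (df t i j)
    by apply: fij; rewrite t0 (le_trans ts).
rewrite in_itv/= subr0 => /andP[c0 cs] ->; rewrite normrM (ger0_norm s0).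
rewrite -[leRHS]mulr1 ler_pM //; apply: le_trans (le_mx_norm _ _ _) _.
by apply: dfK; rewrite c0 (le_trans cs).
Qed.

(* On the unit interval a Lipschitz constant 1/2 makes the exponential of
   Gronwall's inequality superfluous: compare f with its own maximum. *)
Lemma small_gronwall f (df : R -> mat) e : 0 <= e -> f 0 = 0 ->
  (forall t, 0 <= t <= 1 -> is_derive t 1 f (df t)) ->
  (forall t, 0 <= t <= 1 -> `|df t| <= 2^-1 * `|f t| + e) ->
  forall s, 0 <= s <= 1 -> `|f s| <= 2 * e.
Proof.
move=> e0 f0 fdf dfe.
have fc : {within `[0, 1], continuous (fun t => `|f t|)}.
  apply: continuous_in_subspaceT => t; rewrite inE/= in_itv/= => t01.
  apply: continuous_comp; last exact: norm_continuous.
  by apply/differentiable_continuous/derivable1_diffP; have [] := fdf _ t01.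
have [c c01 cmax] := EVT_max (@ler01 R) fc.
have cM s : 0 <= s <= 1 -> `|f s| <= 2^-1 * `|f c| + e.
  move=> s01; rewrite -[f s]subr0 -f0; apply: (@mean_value_le _ df) => //.
    by rewrite addr_ge0 // mulr_ge0.
  move=> t t01; apply: le_trans (dfe _ t01) _; rewrite lerD2r ler_wpM2l //.
  by apply: cmax; rewrite in_itv.
have /cM c2 : 0 <= c <= 1 by move: c01; rewrite in_itv.
have fc2 : `|f c| <= 2 * e by move: c2; move: `|f c| => x; lra.
by move=> s s01; apply: le_trans fc2; apply: cmax; rewrite in_itv.
Qed.

Lemma antiderivative (g : R -> R) : (forall t, {for t, continuous g}) ->
  exists G : R -> R, G 0 = 0 /\ forall t, 0 <= t <= 1 -> is_derive t 1 G (g t).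
Proof.
move=> gc.
(* Integrating from -1, on an interval reaching to 2, puts 0 and 1 in the interior, so that the
   derivative is two-sided at both ends of the unit interval. *)
pose G t : R := (\int[lebesgue_measure]_(s in `[(-1)%R, t]) g s)%R.
have dG t : 0 <= t <= 1 -> is_derive t 1 G (g t).
  move=> /andP[t0 t1].
  have m12 : (-1 : R) < 2 by lra.
  have gI : lebesgue_measure.-integrable `[-1, 2] (EFin \o g).
    apply: continuous_compact_integrable; first exact: segment_compact.
    exact: continuous_subspaceT.
  have t2 : t < 2 by lra.
  have mt : -1 < t by lra.
  have [Gd GE] := continuous_FTC1_closed t2 gI mt (gc t).
  exact: (DeriveDef Gd (etrans (esym (derive1E G t)) GE)).
exists (fun t => G t - G 0); split=> [|t t01]; first by rewrite subrr.
have := is_deriveB (dG _ t01) (is_derive_cst (G 0) t 1).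
by rewrite subr0.
Qed.

Lemma antiderivative_mx (g : R -> mat) : (forall t, {for t, continuous g}) ->
  exists G : R -> mat, G 0 = 0 /\ forall t, 0 <= t <= 1 -> is_derive t 1 G (g t).
Proof.
move=> gc.
have gij (ij : 'I_p * 'I_q) : exists G : R -> R, G 0 = 0 /\
    forall t, 0 <= t <= 1 -> is_derive t 1 G (g t ij.1 ij.2).
  apply: antiderivative => t.
  exact: (@continuous_comp _ _ _ g (fun A : mat => A ij.1 ij.2) t (gc t)
           (@coord_continuous _ _ _ _ _ _)).
have [G GP] := choice gij.
exists (fun t => \matrix_(i, j) G (i, j) t); split.
  by apply/matrixP => i j; rewrite !mxE (GP (i, j)).1.
move=> t t01; apply/is_derive_mxP => i j.
have := (GP (i, j)).2 t t01; congr (is_derive _ _ _ _).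
by apply/funext => s; rewrite mxE.
Qed.

End MatrixODE.

(** The intervals of radius 2 C / 2^n around [u n] are nested, so the supremum of their left
    endpoints lies in all of them. The radius is the tail of the geometric series. *)
Lemma geometric_limit (R : realType) (u : nat -> R) (C : R) :
  (forall n, `|u n.+1 - u n| <= C / 2 ^+ n) ->
  exists l, forall n, `|l - u n| <= 2 * C / 2 ^+ n.
Proof.
move=> uC.
have E2 n : (2 : R) ^+ n != 0 by rewrite expf_neq0 ?pnatr_eq0.
pose lo n := u n - 2 * C / 2 ^+ n; pose hi n := u n + 2 * C / 2 ^+ n.
have step n : lo n <= lo n.+1 /\ hi n.+1 <= hi n.
  have := uC n; rewrite ler_norml /lo /hi exprS invfM.
  move: (u n.+1) (u n) (2 ^+ n)^-1 => a b c /andP[]; split; lra.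
have C0 n : 0 <= C / 2 ^+ n := le_trans (normr_ge0 _) (uC n).
have lohi n : lo n <= hi n by have := C0 n; rewrite /lo /hi -mulrA; lra.
have lo_mono n d : lo n <= lo (n + d)%N.
  elim: d => [|d IH]; first by rewrite addn0.
  by rewrite addnS; apply: le_trans IH (step _).1.
have hi_mono n d : hi (n + d)%N <= hi n.
  elim: d => [|d IH]; first by rewrite addn0.
  by rewrite addnS; apply: le_trans (step _).2 IH.
have lohi2 i j : lo i <= hi j.
  apply: le_trans (lo_mono i j) _; apply: le_trans (lohi _) _.
  by rewrite addnC.
exists (sup (range lo)) => n; rewrite ler_distl -/(lo n) -/(hi n).
have ub : has_ubound (range lo) by exists (hi 0%N) => _ [k _ <-].
apply/andP; split; first by apply: ub_le_sup => //; exists n.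
by apply: ge_sup; [exists (lo 0%N); exists 0%N|move=> _ [k _ <-]].
Qed.

Lemma Ck_mulmx (R : realType) (V : normedModType R) k (U : set V) m n p
    (A : V -> 'M[R]_(m, n)) (B : V -> 'M[R]_(n, p)) : open U ->
  Ck k U A -> Ck k U B -> Ck k U (fun x => A x *m B x).
Proof.
move=> oU /(Ck_mxP _ _ oU) Ak /(Ck_mxP _ _ oU) Bk; apply/(Ck_mxP _ _ oU) => i j.
apply: (Ck_ext oU _ (Ck_sum oU (fun l => CkM oU (Ak i l) (Bk l j)))) => x _.
by rewrite mxE.
Qed.

Section LinearODE.
Context {R : realType} {p q : nat}.
Local Notation mat := 'M[R]_(p, q).

(* Picard iteration; clamping the time to [0, 1] lets all iterates be continuous
   on the whole line. *)
Lemma linear_ode (B : R -> 'M[R]_p) (X0 : mat) :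
  (forall t : R, 0 <= t <= 1 -> {for t, continuous B}) ->
  (forall t : R, 0 <= t <= 1 -> p%:R * `|B t| <= 2^-1) ->
  exists f : R -> mat, f 0 = X0 /\
    forall t : R, 0 <= t <= 1 -> is_derive t 1 f (B t *m f t).
Proof.
move=> Bc Bs.
pose clamp (t : R) := Num.max 0 (Num.min t 1).
have clampc (t : R) : {for t, continuous clamp}.
  by apply: continuous_max; [exact: cst_continuous|
     apply: continuous_min; [exact: cvg_id | exact: cst_continuous]].
have clamp01 (t : R) : 0 <= clamp t <= 1.
  by rewrite /clamp le_max lexx ge_max ler01 ge_min lexx orbT.
have clampE (t : R) : 0 <= t <= 1 -> clamp t = t.
  by move=> /andP[t0 t1]; rewrite /clamp min_l // max_r.
pose cont (g : R -> mat) := forall t, {for t, continuous g}.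
have contB g : cont g -> cont (fun s => B (clamp s) *m g s).
  move=> gc t; have Bcl (x : R) : setT x -> {for x, continuous (B \o clamp)}.
    by move=> _; apply: continuous_comp; [exact: clampc|exact: Bc].
  exact: (@Ck_mulmx _ R^o 0 setT _ _ _ (B \o clamp) g openT Bcl (fun x _ => gc x) t I).
have primP (g : R -> mat) : exists G : R -> mat, cont g -> G 0 = 0 /\
    forall t : R, 0 <= t <= 1 -> is_derive t 1 G (B (clamp t) *m g t).
  have [gc|gnc] := pselect (cont g); last by exists (fun=> 0).
  by have [G GP] := antiderivative_mx (contB g gc); exists G.
have [prim {}primP] := choice primP.
pose T g t := X0 + prim g (clamp t).
have contT g : cont g -> cont (T g).
  move=> gc t; apply: cvgD; first exact: cvg_cst.
  apply: continuous_comp; first exact: clampc.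
  apply/differentiable_continuous/derivable1_diffP.
  by have [] := (primP g gc).2 _ (clamp01 t).
(* The factor [p%:R] is the cost of a matrix product in the maximum norm. The hypothesis on [B]
   includes it, so the plain supremum distance contracts by 1/2 and no exponential weight in time is
   called for. *)
have contr g g' (e : R) : 0 <= e -> cont g -> cont g' -> (forall t, `|g t - g' t| <= e) ->
    forall t, `|T g t - T g' t| <= e / 2.
  move=> e0 gc gc' gg' t; rewrite /T opprD addrACA subrr add0r.
  have [z d] := primP g gc; have [z' d'] := primP g' gc'.
  have := @mean_value_le _ _ _ (fun s => prim g s - prim g' s)
    (fun s => B (clamp s) *m g s - B (clamp s) *m g' s) (e / 2) _ _ _ _ (clamp01 t).
  rewrite z z' !subr0; apply; first by rewrite divr_ge0.
    by move=> s s01; exact: is_deriveB (d _ s01) (d' _ s01).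
  move=> s s01; rewrite -mulmxBr; apply: le_trans (mulmx_norm_le _ _) _.
  by rewrite mulrA mulrC ler_pM // ?mulr_ge0 // Bs.
pose u n := iter n T (fun=> X0).
have uc n : cont (u n).
  by elim: n => [|n IH]; [move=> t; exact: cvg_cst | exact: contT].
pose C := `|X0|; have C0 : 0 <= C by exact: normr_ge0.
have ustep n t : `|u n.+1 t - u n t| <= C / 2 ^+ n.
  elim: n t => [|n IH] t; last first.
    rewrite exprSr invfM mulrA; apply: contr => //; last exact: (uc n.+1).
    by rewrite divr_ge0 ?exprn_ge0 //.
  rewrite expr0 divr1 /= /T addrC addrA addNr add0r.
  have [z d] := primP (u 0%N) (uc 0%N).
  have := @mean_value_le _ _ _ (prim (u 0%N)) _ C C0 d _ _ (clamp01 t).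
  rewrite z subr0; apply => // s s01.
  apply: le_trans (mulmx_norm_le _ _) _; rewrite mulrA -[leRHS]mul1r.
  by apply: ler_pM; rewrite ?mulr_ge0 //; apply: le_trans (Bs _ (clamp01 _)) _; lra.
have lim t : exists l : mat, forall n, `|u n t - l| <= 2 * C / 2 ^+ n.
  have lij (ij : 'I_p * 'I_q) : exists l, forall n, `|l - u n t ij.1 ij.2| <= 2 * C / 2 ^+ n.
    apply: geometric_limit => n; apply: le_trans (ustep n t).
    by apply: le_trans (le_mx_norm _ ij.1 ij.2); rewrite !mxE.
  have [l lP] := choice lij; exists (\matrix_(i, j) l (i, j)) => n.
  apply: mx_norm_le => [|i j]; first by rewrite divr_ge0 ?mulr_ge0 ?exprn_ge0 //.
  by rewrite !mxE distrC; exact: (lP (i, j)).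
have [g gP] := choice lim.
have small (e : R) : 0 < e -> exists n, 2 * C / 2 ^+ n <= e.
  move=> e0; have [n] : exists n, 2 * C / e <= n%:R.
    exists (Num.trunc (2 * C / e)).+1; apply: ltW; apply: truncnS_gt.
  move=> Cn; exists n; rewrite ler_pdivrMr ?exprn_gt0 //.
  rewrite -ler_pdivrMl // mulrC; apply: le_trans Cn _.
  by rewrite -natrX ler_nat ltnW // ltn_expl.
have gc : cont g.
  move=> t; apply/cvgrPdist_le => e e0.
  have e3 : 0 < e / 3 by rewrite divr_gt0.
  have [n ne] := small _ e3.
  have /cvgrPdist_le/(_ _ e3) un := uc n t.
  near=> s.
  have A : `|u n t - u n s| <= e / 3 by near: s.
  have -> : g t - g s = (u n t - u n s) + ((u n s - g s) - (u n t - g t)).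
    move: (g t) (g s) (u n t) (u n s) => a b c d; apply/matrixP => i j; rewrite !mxE.
    by move: (a i j) (b i j) (c i j) (d i j) => *; ring.
  have -> : e = e / 3 + (e / 3 + e / 3) by lra.
  apply: le_trans (ler_normD _ _) (lerD A _); apply: le_trans (ler_normB _ _) _.
  by apply: lerD; apply: le_trans (gP _ _) ne.
have gT t : T g t = g t.
  apply/eqP; rewrite -subr_eq0 -normr_le0; apply/ler_addgt0Pl => e e0; rewrite addr0.
  have e2 : 0 < e / 2 by rewrite divr_gt0.
  have [n ne] := small _ e2.
  have -> : T g t - g t = (T g t - T (u n) t) + (u n.+1 t - g t).
    by rewrite addrA subrK.
  rewrite (splitr e); apply: le_trans (ler_normD _ _) (lerD _ _).
    rewrite distrC; apply: (@le_trans _ _ (e / 2 / 2)); last by lra.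
    apply: contr => // [|s]; first exact: ltW.
    by apply: le_trans (gP _ _) ne.
  apply: le_trans (gP _ _) _; apply: le_trans ne.
  rewrite ler_wpM2l ?mulr_ge0 // lef_pV2 ?posrE ?exprn_gt0 //.
  by rewrite ler_weXn2l // ler1n.
have [z d] := primP g gc.
(* The fixed point [g] is constant outside [0, 1], so it may have corners at the ends. The unclamped
   primitive agrees with it on [0, 1] and is differentiable from both sides there. *)
exists (fun t => X0 + prim g t); split=> [|t t01]; first by rewrite z addr0.
have := is_deriveD (is_derive_cst X0 t 1) (d _ t01).
rewrite add0r clampE //.
by have -> : X0 + prim g t = g t by rewrite -gT /T clampE.
Unshelve. all: by end_near. Qed.

End LinearODE.

(** * Uniform first- and second-order estimates near a point *)

Section LocalBounds.
Context {R : realType} {p q : nat}.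
Local Notation pt := 'rV[R]_2.

Lemma derive_rV2 (W : normedModType R) (G : pt -> W) u k : differentiable G u ->
  'D_k G u = k 0 0 *: pd 0 G u + k 0 1 *: pd 1 G u.
Proof.
move=> dG; rewrite /pd -derive_linear //; congr ('D_ _ _ _).
rewrite [LHS]row_sum_delta !big_ord_recl big_ord0 addr0.
by have -> : lift ord0 ord0 = 1 :> 'I_2 by exact/val_inj.
Qed.

Lemma norm_rV2_le (W : normedModType R) (x y : W) (k : pt) (a b : R) :
  `|x| <= a -> `|y| <= b -> `|k 0 0 *: x + k 0 1 *: y| <= (a + b) * `|k|.
Proof.
move=> xa yb; apply: le_trans (ler_normD _ _) _; rewrite !normrZ mulrDl.
by apply: lerD; rewrite mulrC ler_pM // le_mx_norm.
Qed.

Lemma segment_ball (p0 u k : pt) r (t : R) : 0 <= t <= 1 ->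
  `|u - p0| < r -> `|u + k - p0| < r -> `|u + t *: k - p0| < r.
Proof.
move=> /andP[t0 t1] ur ukr.
have -> : u + t *: k - p0 = (1 - t) *: (u - p0) + t *: (u + k - p0).
  by apply/rowP => i; rewrite !mxE; ring.
apply: le_lt_trans (ler_normD _ _) _; rewrite !normrZ !ger0_norm ?subr_ge0 //.
have [tz|tz] := eqVneq t 0; first by rewrite tz subr0 mul1r mul0r addr0.
have tp : 0 < t by rewrite lt_def tz.
have -> : r = (1 - t) * r + t * r by rewrite mulrBl mul1r subrK.
by apply: ler_ltD; [rewrite ler_wpM2l ?subr_ge0 // ltW|rewrite ltr_pM2l].
Qed.

Lemma mean_value_segment (G : pt -> 'M[R]_(p, q)) u k L : 0 <= L ->
  (forall t : R, 0 <= t <= 1 -> differentiable G (u + t *: k) /\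
     `|'D_k G (u + t *: k)| <= L) -> `|G (u + k) - G u| <= L.
Proof.
move=> L0 H.
have := @mean_value_le _ _ _ (fun t => G (u + t *: k)) (fun t => 'D_k G (u + t *: k)) L L0.
rewrite scale0r addr0 => /(_ _ _ 1); rewrite scale1r; apply.
- by move=> t /H[? _]; exact: is_derive_line.
- by move=> t /H[].
- by rewrite ler01 lexx.
Qed.

Lemma bounded_near (W : normedModType R) (G : pt -> W) u : {for u, continuous G} ->
  exists r M : R, [/\ 0 < r, 0 <= M & forall y, `|y - u| < r -> `|G y| <= M].
Proof.
move=> /cvgrPdist_le/(_ 1 ltr01)/nbhs_normP[r /= r0 rG].
exists r, (`|G u| + 1); split=> //.
move=> y yr; have := rG y; rewrite /= distrC => /(_ yr) Gy.
rewrite -(subrK (G u) (G y)) addrC; apply: le_trans (ler_normD _ _) _.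
by rewrite lerD2l distrC.
Qed.

Lemma C1_bounds (D : set pt) (G : pt -> 'M[R]_(p, q)) p0 : open D -> D p0 ->
  Ck 1 D G -> exists r L : R, [/\ 0 < r, 0 <= L & forall u, `|u - p0| < r ->
    [/\ D u, `|G u| <= L, forall k, `|'D_k G u| <= L * `|k| &
        forall k, `|u + k - p0| < r -> `|G (u + k) - G u| <= L * `|k|]].
Proof.
move=> oD Dp0 GC1; have [dG cG] := GC1; have cG0 := CkW GC1.
have [r0 r0p r0D] : exists2 r : R, 0 < r & forall u, `|u - p0| < r -> D u.
  have /nbhs_normP[r /= rp rD] : nbhs p0 D by exact: open_nbhs_nbhs.
  by exists r => // u ur; apply: rD; rewrite /= distrC.
have [r1 [M1 [r1p M1p b1]]] := bounded_near (cG0 _ Dp0).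
have [r2 [M2 [r2p M2p b2]]] := bounded_near (cG (delta_mx 0 0) _ Dp0).
have [r3 [M3 [r3p M3p b3]]] := bounded_near (cG (delta_mx 0 1) _ Dp0).
pose r := Num.min (Num.min r0 r1) (Num.min r2 r3).
have rp : 0 < r by rewrite !lt_min r0p r1p r2p r3p.
pose L := M1 + (M2 + M3).
exists r, L; split=> //; first by rewrite !addr_ge0.
have H u : `|u - p0| < r -> [/\ D u, `|G u| <= L & forall k, `|'D_k G u| <= L * `|k|].
  rewrite !lt_min => /andP[/andP[u0 u1] /andP[u2 u3]]; split; first exact: r0D.
    by apply: le_trans (b1 _ u1) _; rewrite /L; lra.
  move=> k; rewrite derive_rV2; last by apply: dG; exact: r0D.
  apply: le_trans (norm_rV2_le _ (b2 _ u2) (b3 _ u3)) _.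
  by rewrite ler_wpM2r // /L; lra.
move=> u ur; have [Du Gu Dk] := H u ur; split=> // k ukr.
apply: mean_value_segment; first by rewrite mulr_ge0 // !addr_ge0.
move=> t t01; have [Dt _ Dkt] := H _ (segment_ball t01 ur ukr).
by split; [exact: dG|exact: Dkt].
Qed.

Lemma scalerB2 (V : lmodType R) (a b : R) (x y x' y' : V) :
  a *: x + b *: y - (a *: x' + b *: y') = a *: (x - x') + b *: (y - y').
Proof. by rewrite opprD addrACA -!scalerBr. Qed.

(** The quadratic remainder is bounded uniformly in the base point [u], because it will be
    integrated along whole rays; separate Taylor expansions at each point would give no common
    constant. *)
Lemma C2_bounds (D : set pt) (G : pt -> 'M[R]_(p, q)) p0 : open D -> D p0 ->
  Ck 2 D G -> exists r L : R, [/\ 0 < r, 0 <= L & forall u, `|u - p0| < r ->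
    [/\ D u, `|G u| <= L, forall k, `|'D_k G u| <= L * `|k| &
        forall k, `|u + k - p0| < r -> `|G (u + k) - G u| <= L * `|k| /\
          `|G (u + k) - G u - 'D_k G u| <= L * `|k| ^+ 2]].
Proof.
move=> oD Dp0 GC2; have [dG cG] := GC2.
have [r1 [L1 [r1p L1p b1]]] := C1_bounds oD Dp0 (CkW GC2).
have [r2 [L2 [r2p L2p b2]]] := C1_bounds oD Dp0 (cG (delta_mx 0 0)).
have [r3 [L3 [r3p L3p b3]]] := C1_bounds oD Dp0 (cG (delta_mx 0 1)).
pose r := Num.min r1 (Num.min r2 r3).
have rp : 0 < r by rewrite !lt_min r1p r2p r3p.
pose L := L1 + (L2 + L3); have L0 : 0 <= L by rewrite !addr_ge0.
have LL1 : L1 <= L by rewrite /L; lra.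
exists r, L; split=> // u ur.
have ri v : `|v - p0| < r -> [/\ `|v - p0| < r1, `|v - p0| < r2 & `|v - p0| < r3].
  by rewrite !lt_min => /andP[? /andP[? ?]].
have [u1 u2 u3] := ri _ ur; have [Du Gu Dk Lk] := b1 _ u1; split=> //.
- exact: le_trans Gu _.
- by move=> k; apply: le_trans (Dk k) _; rewrite ler_wpM2r.
move=> k ukr; have [k1 k2 k3] := ri _ ukr.
split; first by apply: le_trans (Lk _ k1) _; rewrite ler_wpM2r.
pose K := 'D_k G u.
(* The derivative of this function of [t] is an increment of ['D_k G], hence of order |k|^2 by the
   Lipschitz bounds on the two partial derivatives. *)
have := @mean_value_le _ _ _ (fun t : R => G (u + t *: k) - t *: K)
  (fun t => 'D_k G (u + t *: k) - K) (L * `|k| ^+ 2) _ _ _ 1.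
rewrite scale0r addr0 scale0r subr0 !scale1r addrAC; apply.
- by rewrite mulr_ge0 // sqr_ge0.
- move=> t t01; have [t1 _ _] := ri _ (segment_ball t01 ur ukr).
  have [Dt _ _ _] := b1 _ t1.
  apply: is_deriveB; first by apply: is_derive_line; exact: dG.
  have := is_diff_scalel t K => dK; apply: DeriveDef.
    by apply: diff_derivable; exact: ex_diff.
  by rewrite deriveE ?diff_val ?scale1r //; exact: ex_diff.
- move=> t t01; have [t1 t2 t3] := ri _ (segment_ball t01 ur ukr).
  have [Dt _ _ _] := b1 _ t1.
  have tk : `|t *: k| <= `|k|.
    by case/andP: t01 => *; rewrite normrZ ger0_norm // ler_piMl.
  have [_ _ _ /(_ _ t2) e2] := b2 _ u2; have [_ _ _ /(_ _ t3) e3] := b3 _ u3.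
  rewrite /K !derive_rV2; [|exact: dG..].
  rewrite scalerB2.
  apply: le_trans (@norm_rV2_le _ _ _ _ (L2 * `|k|) (L3 * `|k|) _ _) _.
  + by apply: le_trans e2 _; rewrite ler_wpM2l.
  + by apply: le_trans e3 _; rewrite ler_wpM2l.
  have LL : L2 + L3 <= L by rewrite /L lerDr.
  rewrite -mulrDl -mulrA; apply: ler_pM => //; exact: addr_ge0.
- by rewrite ler01 lexx.
Qed.

End LocalBounds.

Section MoreMatrixCalculus.
Context {R : realType}.

Lemma is_derive_mulmx m n p (A : R -> 'M[R]_(m, n)) (B : R -> 'M[R]_(n, p))
    (t : R) dA dB : is_derive t 1 A dA -> is_derive t 1 B dB ->
  is_derive t 1 (fun s => A s *m B s) (dA *m B t + A t *m dB).
Proof.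
move=> /is_derive_mxP dAP /is_derive_mxP dBP; apply/is_derive_mxP => i j.
have H := @is_derive_sum _ _ _ _ (fun k s => A s i k * B s k j) t 1 _
  (fun k => is_deriveM (dAP i k) (dBP k j)).
have := H; rewrite !mxE -big_split /=.
have -> : (fun s => (A s *m B s) i j) = \sum_(k < n) (fun s => A s i k * B s k j).
  by apply/funext => s; rewrite mxE fct_sumE.
congr (is_derive _ _ _ _); apply: eq_bigr => k _.
by rewrite addrC [dA i k * _]mulrC.
Qed.

Lemma is_derive_scale_id m n (A : R -> 'M[R]_(m, n)) (t : R) dA :
  is_derive t 1 A dA -> is_derive t 1 (fun s => s *: A s) (A t + t *: dA).
Proof.
move=> /is_derive_mxP dAP; apply/is_derive_mxP => i j.
have := is_deriveM (is_derive_id t 1) (dAP i j); rewrite !mxE /=.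
have -> : (fun s => (s *: A s) i j) = id * (fun s => A s i j).
  by apply/funext => s; rewrite mxE.
by congr (is_derive _ _ _ _); rewrite addrC /GRing.scale /= mulr1.
Qed.

(** A quadratic remainder is o(|h|), so the guess [L] is the differential. [L] comes as a bare
    function with a proof of linearity; its continuity is drawn from the bound by [M]. *)
Lemma differentiable_quadratic (V : normedModType R) (W : normedModType R) (f L : V -> W) (x : V) (r C M : R) :
  linear L -> (forall h, `|L h| <= M * `|h|) -> 0 < r ->
  (forall h, `|h| < r -> `|f (x + h) - f x - L h| <= C * `|h| ^+ 2) ->
  differentiable f x /\ forall h, 'D_h f x = L h.
Proof.
move=> linL LM r0 fC.
pose LL := GRing.isLinear.Build _ _ _ _ _ linL.
pose L' : {linear V -> W} := HB.pack L LL.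
have cL : continuous L'.
  move=> y; apply/cvgrPdist_le => e e0; near=> z.
  rewrite -linearB; apply: le_trans (LM _) _.
  have M1 : 0 < `|M| + 1 by rewrite ltr_wpDl.
  apply: (@le_trans _ _ ((`|M| + 1) * `|y - z|)).
    by rewrite ler_wpM2r // (le_trans (ler_norm _)) // lerDl.
  rewrite -ler_pdivlMl //; near: z; apply: cvgr_dist_le; first exact: cvg_id.
  by rewrite mulr_gt0 // invr_gt0.
have H : f \o shift x = cst (f x) + L' +o_ 0 id.
  apply/eqaddoP => e e0; near=> h.
  have -> : (f \o shift x - (cst (f x) + L')) h = f (x + h) - f x - L h.
    by rewrite opprD addrA [x + h]addrC.
  have hr : `|h| < r by near: h; apply: nbhs0_lt.
  apply: le_trans (fC h hr) _; rewrite expr2 mulrA ler_wpM2r //.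
  have C1 : 0 < `|C| + 1 by rewrite ltr_wpDl.
  apply: (@le_trans _ _ ((`|C| + 1) * `|h|)).
    by rewrite ler_wpM2r // (le_trans (ler_norm _)) // lerDl.
  rewrite -ler_pdivlMl //; near: h; apply: nbhs0_le.
  by rewrite mulr_gt0 // invr_gt0.
have E := diff_unique cL H.
have df : differentiable f x by apply/diff_locallyP; rewrite E.
by split=> // h; rewrite deriveE // E.
Unshelve. all: by end_near. Qed.

End MoreMatrixCalculus.

(** * The Frobenius theorem *)

Section Frobenius.
Context {R : realType} {p q : nat}.
Local Notation pt := 'rV[R]_2.
Implicit Types (A : pt -> 'M[R]_p) (u h k v : pt).

Definition conn A0 A1 u h : 'M[R]_p := h 0 0 *: A0 u + h 0 1 *: A1 u.

Lemma connD A0 A1 u h k : conn A0 A1 u (h + k) = conn A0 A1 u h + conn A0 A1 u k.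
Proof. by apply/matrixP => i j; rewrite /conn !mxE; ring. Qed.

Lemma connZ A0 A1 u a h : conn A0 A1 u (a *: h) = a *: conn A0 A1 u h.
Proof. by apply/matrixP => i j; rewrite /conn !mxE; ring. Qed.

Lemma conn_differentiable A0 A1 u h : differentiable A0 u -> differentiable A1 u ->
  differentiable (fun v => conn A0 A1 v h) u.
Proof. by move=> d0 d1; apply: differentiableD; apply: differentiableZ. Qed.

Lemma derive_conn A0 A1 u h k : differentiable A0 u -> differentiable A1 u ->
  'D_k (fun v => conn A0 A1 v h) u = h 0 0 *: 'D_k A0 u + h 0 1 *: 'D_k A1 u.
Proof.
move=> d0 d1; rewrite (@deriveD _ _ _ (fun v => _ *: A0 v) (fun v => _ *: A1 v)).
- by rewrite !deriveZ //; exact: diff_derivable.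
- by apply: diff_derivable; apply: differentiableZ.
- by apply: diff_derivable; apply: differentiableZ.
Qed.

(** Equality of the mixed partial derivatives of a solution of dF = A F, with the factor F
    cancelled: the connection has zero curvature. *)
Definition flat A0 A1 u :=
  pd 0 A1 u + A1 u *m A0 u = pd 1 A0 u + A0 u *m A1 u.

(** The difference of the two sides is bilinear and alternating in [h] and [k], hence a multiple of
    its value on the coordinate directions. The flow uses it for a ray direction and an arbitrary
    increment. *)
Lemma flat_conn A0 A1 u h k : differentiable A0 u -> differentiable A1 u ->
  flat A0 A1 u ->
  'D_k (fun v => conn A0 A1 v h) u + conn A0 A1 u h *m conn A0 A1 u k =
  'D_h (fun v => conn A0 A1 v k) u + conn A0 A1 u k *m conn A0 A1 u h.
Proof.
move=> d0 d1; rewrite /flat => /(canRL (addrK _)) F.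
rewrite !derive_conn // !derive_rV2 // F /conn !mulmxDl !mulmxDr.
rewrite -!scalemxAl -!scalemxAr.
move: (A0 u *m A0 u) (A0 u *m A1 u) (A1 u *m A0 u) (A1 u *m A1 u) (pd 0 A0 u) (pd 1 A0 u)
  (pd 1 A1 u) => *.
by apply/matrixP => i j; rewrite !mxE; ring.
Qed.

Definition connection_bounds A0 A1 p0 r L := forall u, `|u - p0| < r ->
  [/\ differentiable A0 u, differentiable A1 u,
      forall h, `|conn A0 A1 u h| <= L * `|h|,
      forall h k, `|'D_k (fun v => conn A0 A1 v h) u| <= L * `|k| * `|h| &
      forall h k, `|u + k - p0| < r ->
       `|conn A0 A1 (u + k) h - conn A0 A1 u h| <= L * `|k| * `|h| /\
       `|conn A0 A1 (u + k) h - conn A0 A1 u h - 'D_k (fun v => conn A0 A1 v h) u|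
         <= L * `|k| ^+ 2 * `|h| ].

Lemma connection_boundsP (D : set pt) A0 A1 p0 : open D -> D p0 ->
  Ck 2 D A0 -> Ck 2 D A1 -> exists r L : R,
  [/\ 0 < r, 0 <= L, connection_bounds A0 A1 p0 r L & forall u, `|u - p0| < r -> D u].
Proof.
move=> oD Dp0 C0 C1.
have [r0 [L0 [r0p L0p b0]]] := C2_bounds oD Dp0 C0.
have [r1 [L1 [r1p L1p b1]]] := C2_bounds oD Dp0 C1.
exists (Num.min r0 r1), (L0 + L1); rewrite lt_min r0p r1p addr_ge0 //; split=> //.
  move=> u; rewrite lt_min => /andP[u0 u1].
  have [Du G0 D0 I0] := b0 _ u0; have [_ G1 D1 I1] := b1 _ u1.
  have d0 := C0.1 _ Du; have d1 := C1.1 _ Du.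
  split=> //.
  - by move=> h; exact: norm_rV2_le.
  - by move=> h k; rewrite derive_conn // mulrDl; apply: norm_rV2_le.
  move=> h k; rewrite lt_min => /andP[k0 k1].
  have [I01 I02] := I0 _ k0; have [I11 I12] := I1 _ k1.
  rewrite derive_conn // /conn !mulrDl; split.
    by rewrite opprD addrACA -!scalerBr -mulrDl; apply: norm_rV2_le.
  have E : forall (a b : R) (x y x' y' z t : 'M[R]_p),
      a *: x + b *: y - (a *: x' + b *: y') - (a *: z + b *: t) =
      a *: (x - x' - z) + b *: (y - y' - t).
    by move=> *; apply/matrixP => i j; rewrite !mxE; ring.
  by rewrite E -mulrDl; apply: norm_rV2_le.
by move=> u; rewrite lt_min => /andP[u0 u1]; have [] := b0 _ u0.
Qed.

End Frobenius.

Section FrobeniusLocal.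
Context {R : realType} {p q : nat}.
Local Notation pt := 'rV[R]_2.

Lemma deriveZ_dir (V W : normedModType R) (f : V -> W) x (s : R) h :
  differentiable f x -> 'D_(s *: h) f x = s *: 'D_h f x.
Proof. by move=> df; rewrite !deriveE // linearZ. Qed.

Lemma mulmx_norm_le2 m n l (A : 'M[R]_(m, n)) (B : 'M[R]_(n, l)) a b :
  `|A| <= a -> `|B| <= b -> `|A *m B| <= n%:R * (a * b).
Proof.
by move=> Aa Bb; apply: le_trans (mulmx_norm_le _ _) _; rewrite ler_wpM2l // ler_pM.
Qed.

Lemma frobenius_local (A0 A1 : pt -> 'M[R]_p) p0 r L (X0 : 'M[R]_(p, q)) :
  0 < r -> r <= 1 -> 0 <= L -> p%:R * (L * r) <= 2^-1 ->
  connection_bounds A0 A1 p0 r L -> (forall u, `|u - p0| < r -> flat A0 A1 u) ->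
  exists f : pt -> 'M[R]_(p, q), f p0 = X0 /\ forall u, `|u - p0| < r ->
    differentiable f u /\ forall h, 'D_h f u = conn A0 A1 u h *m f u.
Proof.
move=> r0 r1 L0 Lr bnd fl; pose N : R := p%:R; have N0 : 0 <= N by exact: ler0n.
pose cn u h := conn A0 A1 u h.
pose B v (s : R) := cn (p0 + s *: v) v.
have inr v s : 0 <= s <= 1 -> `|v| < r -> `|p0 + s *: v - p0| < r.
  move=> /andP[s0 s1] vr; rewrite addrC addKr normrZ ger0_norm //.
  by apply: le_lt_trans vr; rewrite ler_piMl.
have dcn u h : `|u - p0| < r -> differentiable (cn^~ h) u.
  by move=> /bnd[? ? _ _ _]; exact: conn_differentiable.
have NB v s : 0 <= s <= 1 -> `|v| < r -> N * `|B v s| <= 2^-1.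
  move=> s01 vr; have [_ _ b _ _] := bnd _ (inr _ _ s01 vr).
  apply: le_trans (ler_wpM2l N0 (b v)) _; apply: le_trans Lr.
  by rewrite ler_wpM2l // ler_wpM2l // ltW.
have BX v s (X : 'M[R]_(p, q)) : 0 <= s <= 1 -> `|v| < r ->
    `|B v s *m X| <= 2^-1 * `|X|.
  move=> s01 vr; apply: le_trans (mulmx_norm_le _ _) _; rewrite mulrA.
  by rewrite ler_wpM2r // NB.
have ex_path v : exists f : R -> 'M[R]_(p, q), `|v| < r -> f 0 = X0 /\
    forall s : R, 0 <= s <= 1 -> is_derive s 1 f (B v s *m f s).
  have [vr|nvr] := pselect (`|v| < r); last by exists (fun=> 0).
  have [|s s01|f fP] := @linear_ode _ p q (B v) X0; last by exists f.
    move=> s s01; apply/differentiable_continuous/derivable1_diffP.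
    by have [] := is_derive_line (dcn _ v (inr _ _ s01 vr)).
  exact: NB.
have [Phi PhiP] := choice ex_path.
(* [Phi v s - X0] vanishes at s = 0 and satisfies the Gronwall hypothesis with defect |X0| / 2, so
   it is bounded by |X0|. *)
pose M := 2 * `|X0|; have M0 : 0 <= M by rewrite mulr_ge0.
have PhiM v s : 0 <= s <= 1 -> `|v| < r -> `|Phi v s| <= M.
  move=> s01 vr; have [Phi0 dPhi] := PhiP v vr.
  have : `|Phi v s - X0| <= 2 * (2^-1 * `|X0|).
    apply: (@small_gronwall _ _ _ (fun s => Phi v s - X0) (fun s => B v s *m Phi v s)) => //.
    - by rewrite Phi0 subrr.
    - by move=> t t01; have := is_deriveB (dPhi t t01) (is_derive_cst X0 t 1); rewrite subr0.
    move=> t t01; apply: le_trans (BX _ _ _ t01 vr) _; rewrite -mulrDr ler_wpM2l //.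
    by rewrite -{1}(subrK X0 (Phi v t)) ler_normD.
  rewrite mulrA mulfV ?pnatr_eq0 // mul1r => H.
  rewrite -(subrK X0 (Phi v s)); apply: le_trans (ler_normD _ _) _.
  by rewrite /M mulr_natl mulr2n lerD2r.
have shiftP v h s : p0 + s *: (v + h) = p0 + s *: v + s *: h.
  by rewrite scalerDr addrA.
have sh s h : 0 <= s <= 1 -> `|s *: h| <= `|h|.
  by move=> /andP[? ?]; rewrite normrZ ger0_norm // ler_piMl.
(* Lipschitz constant of [Phi] in the direction [v]. The outer 2 is Gronwall and [N] the matrix
   product; of the two [L], one pays for moving the base point and one for changing the
   direction. *)
pose C2 := 2 * (N * ((2 * L) * M)).
have C20 : 0 <= C2 by rewrite !mulr_ge0.
have PhiD v h s : 0 <= s <= 1 -> `|v| < r -> `|v + h| < r ->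
    `|Phi (v + h) s - Phi v s| <= C2 * `|h|.
  move=> s01 vr vhr; have [Phi0 dPhi] := PhiP v vr; have [Phih0 dPhih] := PhiP _ vhr.
  have -> : C2 * `|h| = 2 * (N * ((2 * L * `|h|) * M)) by rewrite /C2; ring.
  apply: (@small_gronwall _ _ _ (fun s => Phi (v + h) s - Phi v s)
    (fun s => B (v + h) s *m Phi (v + h) s - B v s *m Phi v s)) => //.
  - by rewrite !mulr_ge0.
  - by rewrite Phi0 Phih0 subrr.
  - by move=> t t01; exact: is_deriveB (dPhih t t01) (dPhi t t01).
  move=> t t01.
  have -> : B (v + h) t *m Phi (v + h) t - B v t *m Phi v t =
    B v t *m (Phi (v + h) t - Phi v t) + (B (v + h) t - B v t) *m Phi (v + h) t.
    by rewrite mulmxBr mulmxBl [RHS]addrC addrA subrK.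
  apply: le_trans (ler_normD _ _) (lerD (BX _ _ _ t01 vr) _).
  apply: mulmx_norm_le2; last exact: PhiM.
  have [_ _ b _ bI] := bnd _ (inr _ _ t01 vr).
  have thr : `|p0 + t *: v + t *: h - p0| < r by rewrite -shiftP inr.
  have [I _] := bI (v + h) _ thr.
  have -> : B (v + h) t - B v t = (cn (p0 + t *: v + t *: h) (v + h) -
       cn (p0 + t *: v) (v + h)) + cn (p0 + t *: v) h.
    rewrite /B shiftP /cn (connD _ _ (p0 + t *: v)).
    move: (conn _ _ _ (v + h)) (conn _ _ _ v) (conn _ _ _ h) => x y z.
    by rewrite opprD addrA subrK.
  apply: le_trans (ler_normD _ _) _.
  have -> : 2 * L * `|h| = L * `|h| + L * `|h| by ring.
  apply: lerD; last exact: b.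
  apply: le_trans I _; rewrite -[leRHS]mulr1 ler_pM ?mulr_ge0 //.
    by rewrite ler_wpM2l // sh.
  by rewrite ltW // (lt_le_trans vhr).
(* The two summands are the two errors found below: a second-order change of the coefficient times
   the solution, and a first-order coefficient times the first-order change [C2 * |h|] of the
   solution. *)
pose C := 2 * (N * (2 * L * M) + N * (2 * L * C2)).
have quad v h : `|v| < r -> `|v + h| < r ->
    `|Phi (v + h) 1 - Phi v 1 - cn (p0 + v) h *m Phi v 1| <= C * `|h| ^+ 2.
  move=> vr vhr; have [Phi0 dPhi] := PhiP v vr; have [Phih0 dPhih] := PhiP _ vhr.
  (* When [v] moves by [h], the point p0 + s v moves by s h; so the expected change of [Phi v s] is
     [s *: a s] applied to it. *)
  pose a s := cn (p0 + s *: v) h.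
  pose da s := 'D_v (cn^~ h) (p0 + s *: v).
  pose e := N * (2 * L * `|h| ^+ 2 * M) + N * (2 * L * `|h| * (C2 * `|h|)).
  have -> : C * `|h| ^+ 2 = 2 * e by rewrite /C /e; ring.
  have := @small_gronwall _ _ _
    (fun s => Phi (v + h) s - Phi v s - (s *: a s) *m Phi v s)
    (fun s => B (v + h) s *m Phi (v + h) s - B v s *m Phi v s
      - ((a s + s *: da s) *m Phi v s + (s *: a s) *m (B v s *m Phi v s))) e _ _ _ _ 1 _.
  rewrite /a !scale1r; apply.
  - by rewrite addr_ge0 // !mulr_ge0 // ?sqr_ge0.
  - by rewrite Phi0 Phih0 subrr scale0r mul0mx subr0.
  - move=> t t01; apply: is_deriveB; first exact: is_deriveB (dPhih t t01) (dPhi t t01).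
    apply: is_derive_mulmx (dPhi t t01); apply: is_derive_scale_id.
    by apply: is_derive_line; apply: dcn; exact: inr.
  - move=> t t01; have tr := inr _ _ t01 vr.
    have [d0 d1 b bD bI] := bnd _ tr.
    have thr : `|p0 + t *: v + t *: h - p0| < r by rewrite -shiftP inr.
    (* Flatness trades the derivative of the form along the ray for its derivative along [h], which
       is the linear part of the change of the coefficient. Only terms quadratic in [h] survive
       beside the homogeneous one. *)
    have F := flat_conn h v d0 d1 (fl _ tr); rewrite -/cn in F.
    set P := p0 + t *: v in d0 d1 b bD bI thr F tr *.
    have DE : 'D_(t *: h) (cn^~ v) P = t *: 'D_h (cn^~ v) P.
      exact: (deriveZ_dir t h (dcn P v tr)).
    have [I1 _] := bI h _ thr; have [_ I2] := bI v _ thr.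
    have E : B (v + h) t *m Phi (v + h) t - B v t *m Phi v t
      - ((cn P h + t *: da t) *m Phi v t + (t *: cn P h) *m (B v t *m Phi v t)) =
      B v t *m (Phi (v + h) t - Phi v t - (t *: cn P h) *m Phi v t)
      + (((cn (P + t *: h) v - cn P v - 'D_(t *: h) (cn^~ v) P)
            + (cn (P + t *: h) h - cn P h)) *m Phi (v + h) t
      + (cn P h + t *: 'D_h (cn^~ v) P) *m (Phi (v + h) t - Phi v t)).
      rewrite DE; have -> : B (v + h) t = cn (P + t *: h) v + cn (P + t *: h) h.
        by rewrite /B shiftP /cn connD.
      have -> : B v t = cn P v by [].
      have -> : da t = 'D_h (cn^~ v) P + cn P v *m cn P h - cn P h *m cn P v.
        by rewrite -F addrK.
      move: ('D_h _ P) (cn P h) (cn P v) (cn (P + t *: h) v) (cn (P + t *: h) h)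
        (Phi (v + h) t) (Phi v t) => D ah av av' ah' Y X.
      rewrite !(mulmxDl, mulmxDr, mulmxN, mulNmx, scalerDr, scalerN).
      rewrite -!(scalemxAl, scalemxAr) !mulmxA.
      move: (av' *m Y) (ah' *m Y) (av *m X) (av *m Y) (ah *m X) (ah *m Y) (D *m X)
        (D *m Y) (av *m ah *m X) (ah *m av *m X) => *.
      by apply/matrixP => i j; rewrite !mxE; ring.
    rewrite E; apply: le_trans (ler_normD _ _) (lerD (BX _ _ _ t01 vr) _).
    apply: le_trans (ler_normD _ _) _; apply: lerD; apply: mulmx_norm_le2.
    + have -> : 2 * L * `|h| ^+ 2 = L * `|h| ^+ 2 * 1 + L * `|h| * `|h| by ring.
      apply: le_trans (ler_normD _ _) _; apply: lerD.
        apply: le_trans I2 _; rewrite ler_pM ?mulr_ge0 ?sqr_ge0 //.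
          by rewrite ler_wpM2l // lerXn2r ?nnegrE // sh.
        by rewrite ltW // (lt_le_trans vr).
      by apply: le_trans I1 _; rewrite ler_wpM2r // ler_wpM2l // sh.
    + exact: PhiM.
    + have -> : 2 * L * `|h| = L * `|h| + L * `|h| * 1 by ring.
      apply: le_trans (ler_normD _ _) _; apply: lerD; first exact: b.
      rewrite -DE; apply: le_trans (bD _ _) _; rewrite ler_pM ?mulr_ge0 //.
        by rewrite ler_wpM2l // sh.
      by rewrite ltW // (lt_le_trans vr).
    exact: PhiD.
  - by rewrite ler01 lexx.
exists (fun u => Phi (u - p0) 1); split.
  (* The ray in direction 0 has coefficient zero, so its solution stays at [X0]. *)
  have z0 : `|0 : pt| < r by rewrite normr0.
  have [Phi0 dPhi] := PhiP 0 z0; rewrite subrr.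
  apply/eqP; rewrite -subr_eq0 -normr_le0 -Phi0.
  apply: (mean_value_le (lexx 0) dPhi); last by rewrite ler01 lexx.
  by move=> t t01; rewrite /B scaler0 addr0 /cn /conn !mxE !scale0r addr0 mul0mx normr0.
move=> u ur; set v := u - p0.
have upv : p0 + v = u by rewrite addrC subrK.
have rr : 0 < r - `|v| by rewrite subr_gt0.
apply: (@differentiable_quadratic _ _ _ _ (fun h => cn u h *m Phi v 1) u (r - `|v|) C
  (N * (L * `|Phi v 1|))) => //.
- move=> k x y; rewrite /cn connD connZ mulmxDl scalemxAl //.
- move=> h; have [_ _ b _ _] := bnd _ ur.
  by have := mulmx_norm_le2 (b h) (lexx `|Phi v 1|); rewrite -/N mulrAC mulrA mulrA.
move=> h hr; have := quad v h ur; rewrite upv.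
have -> : u + h - p0 = v + h by rewrite /v addrAC.
apply; apply: le_lt_trans (ler_normD _ _) _.
by rewrite addrC -ltrBrDr.
Qed.

End FrobeniusLocal.

(** * Smoothness of flows and uniqueness on connected sets *)

Section FrobeniusSmooth.
Context {R : realType}.
Local Notation pt := 'rV[R]_2.

Lemma CkZ (V W : normedModType R) k (U : set V) (a : R) (f : V -> W) : open U ->
  Ck k U f -> Ck k U (fun x => a *: f x).
Proof.
move=> oU; elim: k f => [|k IH] f /=.
  by move=> cf x Ux; apply: cvgZr; exact: cf.
move=> [df Df]; split=> [x Ux|v]; first by apply: differentiableZ; exact: df.
apply: (Ck_ext oU _ (IH _ (Df v))) => x Ux.
by rewrite (@deriveZ _ _ _ f) //; apply: diff_derivable; exact: df.
Qed.

Lemma ball_norm_open (p0 : pt) (r : R) : open [set u | `|u - p0| < r].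
Proof.
rewrite (_ : [set u | _] = ball p0 r); first exact: ball_open.
by apply/seteqP; split=> u; rewrite -ball_normE /= distrC.
Qed.

(** Bootstrapping: each directional derivative is a smooth coefficient times [f] itself, so C^k
    implies C^(k+1). *)
Lemma flow_smooth p q (A0 A1 : pt -> 'M[R]_p) (f : pt -> 'M[R]_(p, q)) (U : set pt) :
  open U -> smooth U A0 -> smooth U A1 ->
  (forall u, U u -> differentiable f u /\ forall h, 'D_h f u = conn A0 A1 u h *m f u) ->
  smooth U f.
Proof.
move=> oU s0 s1 df; elim=> [|k IH].
  by move=> u /df[? _]; exact: differentiable_continuous.
split=> [u /df[]//|v].
apply: (Ck_ext oU _ (Ck_mulmx oU _ IH)) => [u /df[_ ->]//|].
by apply: CkD => //; apply: CkZ.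
Qed.

Theorem frobenius p q (A0 A1 : pt -> 'M[R]_p) (D : set pt) p0 (X0 : 'M[R]_(p, q)) :
  open D -> D p0 -> smooth D A0 -> smooth D A1 -> (forall u, D u -> flat A0 A1 u) ->
  exists r (f : pt -> 'M[R]_(p, q)), [/\ 0 < r, forall u, `|u - p0| < r -> D u, f p0 = X0,
    smooth [set u | `|u - p0| < r] f & forall u, `|u - p0| < r ->
    differentiable f u /\ forall h, 'D_h f u = conn A0 A1 u h *m f u].
Proof.
move=> oD Dp0 s0 s1 fl.
have [r0 [L [r0p L0 bnd rD]]] := connection_boundsP oD Dp0 (s0 2) (s1 2).
(* A radius at most 1/c gives p L r <= 1/2; the summand 1 keeps [c] positive when p L vanishes. *)
pose c : R := 2 * (p%:R * L + 1).
have pL : 0 <= p%:R * L by rewrite mulr_ge0.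
have c0 : 0 < c by rewrite mulr_gt0 // ltr_wpDl.
pose r := Num.min r0 (Num.min 1 c^-1).
have rp : 0 < r by rewrite !lt_min r0p ltr01 invr_gt0.
have rr0 : r <= r0 by rewrite ge_min lexx.
have r1 : r <= 1 by rewrite !ge_min lexx orbT.
have rc : r <= c^-1 by rewrite !ge_min lexx !orbT.
have inD u : `|u - p0| < r -> D u by move=> ur; apply: rD; exact: lt_le_trans rr0.
have pLr : p%:R * (L * r) <= 2^-1.
  rewrite mulrA; apply: le_trans (ler_wpM2l pL rc) _.
  by rewrite ler_pdivrMr // /c mulrA mulVf ?pnatr_eq0 // mul1r lerDl.
have bnd' : connection_bounds A0 A1 p0 r L.
  move=> u ur; have [d0 d1 b bD bI] := bnd u (lt_le_trans ur rr0); split=> //.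
  by move=> h k kr; apply: bI; exact: lt_le_trans rr0.
have [f [f0 fP]] := frobenius_local X0 rp r1 L0 pLr bnd' (fun u ur => fl u (inD u ur)).
have sub : [set u | `|u - p0| < r] `<=` D by move=> u; exact: inD.
have s0' : smooth [set u | `|u - p0| < r] A0 by move=> k; apply: Ck_sub (s0 k).
have s1' : smooth [set u | `|u - p0| < r] A1 by move=> k; apply: Ck_sub (s1 k).
by exists r, f; split=> //; exact: flow_smooth (@ball_norm_open p0 r) s0' s1' fP.
Qed.

(** The zero set is closed in [U] by continuity, and open by Gronwall on a ball of radius at most 1
    / (2 (K + 1)) around each zero. The bound [K] may vary with the point, since coefficients need
    not be bounded on all of [U]. *)
Lemma connected_unique p q (X : pt -> 'M[R]_(p, q)) (U : set pt) p0 :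
  open U -> connected U -> U p0 -> X p0 = 0 ->
  (forall u, U u -> differentiable X u) ->
  (forall u, U u -> exists r K : R, [/\ 0 < r, 0 <= K & forall v, `|v - u| < r -> U v ->
     forall h, `|'D_h X v| <= K * `|h| * `|X v|]) ->
  forall u, U u -> X u = 0.
Proof.
move=> oU cU Up0 X0 dX bX.
have loc u : U u -> X u = 0 -> exists2 r : R, 0 < r & forall v, `|v - u| < r -> U v /\ X v = 0.
  move=> Uu Xu; have [r0 [K [r0p K0 b]]] := bX u Uu.
  have [r1 r1p r1U] : exists2 r : R, 0 < r & forall v, `|v - u| < r -> U v.
    have /nbhs_normP[r /= rp rU] : nbhs u U by exact: open_nbhs_nbhs.
    by exists r => // v vr; apply: rU; rewrite /= distrC.
  pose c := 2 * (K + 1); have c0 : 0 < c by rewrite mulr_gt0 // ltr_wpDl.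
  pose r := Num.min r0 (Num.min r1 c^-1).
  exists r; first by rewrite !lt_min r0p r1p invr_gt0.
  move=> v; rewrite !lt_min => /and3P[v0 v1 vc]; split; first exact: r1U.
  have inr t : 0 <= t <= 1 -> `|t *: (v - u)| <= `|v - u|.
    by move=> /andP[? ?]; rewrite normrZ ger0_norm // ler_piMl.
  have tU t : 0 <= t <= 1 -> U (u + t *: (v - u)).
    by move=> t01; apply: r1U; rewrite addrC addKr; apply: le_lt_trans v1; exact: inr.
  have := @small_gronwall _ _ _ (fun t : R => X (u + t *: (v - u)))
     (fun t => 'D_(v - u) X (u + t *: (v - u))) 0 (lexx _) _ _ _ 1.
  have uvE : u + (v - u) = v by rewrite addrC subrK.
  rewrite scale0r addr0 scale1r uvE mulr0 normr_le0 => H; apply/eqP; apply: H.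
  - by [].
  - by move=> t t01; apply: is_derive_line; apply: dX; exact: tU.
  - move=> t t01; rewrite addr0.
    have tr0 : `|u + t *: (v - u) - u| < r0.
      by rewrite addrC addKr; apply: le_lt_trans v0; exact: inr.
    apply: le_trans (b _ tr0 (tU _ t01) _) _; rewrite ler_wpM2r //.
    have K1 : K <= K + 1 by rewrite lerDl.
    apply: le_trans (ler_pM K0 (normr_ge0 _) K1 (ltW vc)) _.
    by rewrite /c invfM mulrCA mulfV ?mulr1 // gt_eqF // ltr_wpDl.
  - by rewrite ler01 lexx.
pose Z := U `&` [set u | X u = 0].
suff ZU : Z = U by move=> u; rewrite -ZU => -[].
apply: cU; first by exists p0.
- exists Z; last by rewrite /Z setIA setIid.
  rewrite openE => u [Uu Xu] /=.
  have [r rp rZ] := loc u Uu Xu.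
  apply: (@filterS _ _ _ [set v | `|v - u| < r] _ rZ).
  apply: open_nbhs_nbhs; split; first exact: ball_norm_open.
  by rewrite /= subrr normr0.
pose O := U `&` [set u | X u != 0].
have oO : open O.
  rewrite openE => u [Uu Xu] /=; apply: filterI; first exact: open_nbhs_nbhs.
  have cX : {for u, continuous X} by apply: differentiable_continuous; exact: dX.
  have /cvgrPdist_lt/(_ `|X u|) := cX; rewrite normr_gt0 => /(_ Xu).
  apply: filterS => v; apply: contraPneq => ->; rewrite subr0 ltxx //.
exists (~` O); first exact: open_closedC.
apply/seteqP; split=> u [Uu Xu]; split=> //; first by move=> [_ /eqP].
by apply/eqP/negPn/negP => nX; apply: Xu.
Qed.

End FrobeniusSmooth.

(** * The frame connection *)

Section PartialDerivatives.
Context {R : realType}.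
Local Notation pt := 'rV[R]_2.
Implicit Types (f g : pt -> R) (u : pt) (i : 'I_2).

Lemma pdD f g u i : differentiable f u -> differentiable g u ->
  pd i (fun v => f v + g v) u = pd i f u + pd i g u.
Proof. by move=> df dg; rewrite /pd (@deriveD _ _ _ f g) //; exact: diff_derivable. Qed.

Lemma pdN f u i : differentiable f u -> pd i (fun v => - f v) u = - pd i f u.
Proof. by move=> df; rewrite /pd (@deriveN _ _ _ f) //; exact: diff_derivable. Qed.

Lemma pdB f g u i : differentiable f u -> differentiable g u ->
  pd i (fun v => f v - g v) u = pd i f u - pd i g u.
Proof. by move=> df dg; rewrite /pd (@deriveB _ _ _ f g) //; exact: diff_derivable. Qed.

Lemma pdM f g u i : differentiable f u -> differentiable g u ->
  pd i (fun v => f v * g v) u = pd i f u * g u + f u * pd i g u.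
Proof.
move=> df dg; rewrite /pd (@deriveM _ _ f g); [|exact: diff_derivable..].
by rewrite addrC mulrC.
Qed.

Lemma pdV f u i : differentiable f u -> f u != 0 ->
  pd i (fun v => (f v)^-1) u = - (pd i f u / f u ^+ 2).
Proof.
move=> df f0; rewrite /pd (@deriveV _ _ f) //; last exact: diff_derivable.
by rewrite scaleNr mulrC.
Qed.

Lemma pd_cst (c : R) u i : pd i (fun=> c) u = 0.
Proof. exact: derive_cst. Qed.

Lemma pd_near (W : normedModType R) (F G : pt -> W) (U : set pt) u i : open U -> U u ->
  (forall v, U v -> F v = G v) -> pd i F u = pd i G u.
Proof.
move=> oU Uu FG; apply: near_eq_derive; apply: filterS FG _.
exact: open_nbhs_nbhs.
Qed.

Lemma Ck_pd (W : normedModType R) k (U : set pt) (F : pt -> W) i : Ck k.+1 U F -> Ck k U (pd i F).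
Proof. by move=> [_ /(_ (delta_mx 0 i))]. Qed.

Lemma smooth_pd (W : normedModType R) (U : set pt) (F : pt -> W) i : smooth U F -> smooth U (pd i F).
Proof. by move=> sF k; exact/Ck_pd. Qed.

Lemma smooth_diff (W : normedModType R) (U : set pt) (F : pt -> W) u : smooth U F -> U u -> differentiable F u.
Proof. by move=> /(_ 1) [dF _]; exact: dF. Qed.

Lemma pd_comm (U : set pt) f u i j : open U -> smooth U f -> U u ->
  pd i (pd j f) u = pd j (pd i f) u.
Proof. by move=> oU sf Uu; apply: (@derive_comm _ _ U). Qed.

Lemma ord2P (P : 'I_2 -> Prop) : P 0 -> P 1 -> forall i, P i.
Proof.
move=> P0 P1 [[|[|//]] Hi]; first by rewrite (_ : Ordinal Hi = 0) //; exact/val_inj.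
by rewrite (_ : Ordinal Hi = 1) //; exact/val_inj.
Qed.

Lemma ord5P (P : 'I_5 -> Prop) : P (@Ordinal 5 0 isT) -> P (@Ordinal 5 1 isT) ->
  P (@Ordinal 5 2 isT) -> P (@Ordinal 5 3 isT) -> P (@Ordinal 5 4 isT) -> forall k, P k.
Proof.
by move=> P0 P1 P2 P3 P4 [[|[|[|[|[|//]]]]] Hi]; rewrite (bool_irrelevance Hi isT).
Qed.

Lemma sum5 (F : 'I_5 -> R) : \sum_(k < 5) F k = F (@Ordinal 5 0 isT) + F (@Ordinal 5 1 isT) +
  F (@Ordinal 5 2 isT) + F (@Ordinal 5 3 isT) + F (@Ordinal 5 4 isT).
Proof.
rewrite !big_ord_recr big_ord0 /= add0r.
by congr (F _ + F _ + F _ + F _ + F _); exact/val_inj.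
Qed.

End PartialDerivatives.

Section FrameConnection.
Context {R : realType}.
Local Notation pt := 'rV[R]_2.
Implicit Types (l : seq (seq (pt -> R))) (u : pt) (i : 'I_2).

(** Lists of functions make every entry at numeral indices compute, so the 25 flatness equations
    appear as explicit five-term sums. *)
Definition mx5 l u : 'M[R]_5 := \matrix_(i, j) nth (fun=> 0) (nth [::] l i) j u.

Lemma smooth_mx5 (U : set pt) l : open U ->
  (forall p q, (p < 5)%N -> (q < 5)%N -> smooth U (nth (fun=> 0) (nth [::] l p) q)) -> smooth U (mx5 l).
Proof.
move=> oU H k; apply/Ck_mxP => // i j.
have Hij := H i j (ltn_ord i) (ltn_ord j) k.
by apply: (Ck_ext oU _ Hij) => u _; rewrite mxE.
Qed.

Lemma pd_mx5 (U : set pt) l u i : open U -> U u -> smooth U (mx5 l) ->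
  pd i (mx5 l) u = \matrix_(a, b) pd i (nth (fun=> 0) (nth [::] l a) b) u.
Proof.
move=> oU Uu sl; apply/matrixP => a b; rewrite mxE.
rewrite /pd derive_mxE; last by apply: diff_derivable; exact: smooth_diff Uu.
suff -> : (fun v => mx5 l v a b) = nth (fun=> 0) (nth [::] l a) b by [].
by apply/funext => v; rewrite mxE.
Qed.

Definition ent l (p q : nat) : pt -> R := nth (fun=> 0) (nth [::] l p) q.

Definition dot5 l l' (p q : nat) u :=
  ent l p 0 u * ent l' 0 q u + ent l p 1 u * ent l' 1 q u + ent l p 2 u * ent l' 2 q u
  + ent l p 3 u * ent l' 3 q u + ent l p 4 u * ent l' 4 q u.

Lemma flat_mx5 (U : set pt) l0 l1 u : open U -> U u -> smooth U (mx5 l0) -> smooth U (mx5 l1) ->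
  (forall p q, (p < 5)%N -> (q < 5)%N ->
     pd 0 (ent l1 p q) u + dot5 l1 l0 p q u = pd 1 (ent l0 p q) u + dot5 l0 l1 p q u) ->
  flat (mx5 l0) (mx5 l1) u.
Proof.
move=> oU Uu s0 s1 H; rewrite /flat !(pd_mx5 _ oU Uu) //.
have E l l' (i j : 'I_5) : (mx5 l u *m mx5 l' u) i j = dot5 l l' i j u.
  by rewrite mxE sum5 !mxE.
apply/matrixP => i j; rewrite mxE E [RHS]mxE E [X in X + _ = _]mxE [X in _ = X + _]mxE.
exact: H.
Qed.

Variables a b m w0 w1 s0 s1 s2 : pt -> R.

(** Half of d log m; the Christoffel symbols of m |du|^2 are signed sums of these. *)
Definition theta i u : R := pd i m u / (2 * m u).

(* The rows express the derivatives of (Y, Y*, xi, xi_1, xi_2) in that frame;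
   Omega = [[a, b], [b, -a]] and Omega* = [[s0, s1], [s1, s2]]. *)
Definition frame0 := mx5
  [:: [:: fun u => - w0 u; fun=> 0; fun=> 0; fun u => - (a u / m u); fun u => - (b u / m u)];
      [:: fun=> 0; w0; fun=> 0; fun u => - (s0 u / m u); fun u => - (s1 u / m u)];
      [:: fun=> 0; fun=> 0; fun=> 0; fun=> 1; fun=> 0];
      [:: fun u => - s0 u; fun u => - a u; fun u => - m u; theta 0; fun u => - theta 1 u];
      [:: fun u => - s1 u; fun u => - b u; fun=> 0; theta 1; theta 0] ].

Definition frame1 := mx5
  [:: [:: fun u => - w1 u; fun=> 0; fun=> 0; fun u => - (b u / m u); fun u => a u / m u];
      [:: fun=> 0; w1; fun=> 0; fun u => - (s1 u / m u); fun u => - (s2 u / m u)];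
      [:: fun=> 0; fun=> 0; fun=> 0; fun=> 0; fun=> 1];
      [:: fun u => - s1 u; fun u => - b u; fun=> 0; theta 1; theta 0];
      [:: fun u => - s2 u; a; fun u => - m u; fun u => - theta 0 u; theta 1] ].

Variable U : set pt.
Hypotheses (oU : open U) (m0 : forall u, U u -> m u != 0).
Hypotheses (sa : smooth U a) (sb : smooth U b) (sm : smooth U m)
  (sw0 : smooth U w0) (sw1 : smooth U w1)
  (ss0 : smooth U s0) (ss1 : smooth U s1) (ss2 : smooth U s2).

Lemma smooth_theta i : smooth U (theta i).
Proof.
move=> k; apply: CkM => //; first exact: smooth_pd.
apply: CkV => //; first by move=> u Uu; rewrite mulf_neq0 ?pnatr_eq0 // m0.
by apply: CkM => //; exact: Ck_cst.
Qed.

Lemma smooth_frac (f : pt -> R) : smooth U f -> smooth U (fun u => f u / m u).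
Proof. by move=> sf k; apply: CkM => //; apply: CkV. Qed.

Lemma smooth_opp (f : pt -> R) : smooth U f -> smooth U (fun u => - f u : R).
Proof. by move=> sf k; apply: CkN. Qed.

Lemma smooth_frame0 : smooth U frame0.
Proof.
apply: smooth_mx5 => // -[|[|[|[|[|//]]]]] [|[|[|[|[|//]]]]] _ _ /=;
  by [exact: (fun k => Ck_cst k U _) | exact: smooth_theta | exact/smooth_opp/smooth_frac |
      exact: smooth_frac | exact: smooth_opp | exact: smooth_opp (smooth_theta _) | ].
Qed.

Lemma smooth_frame1 : smooth U frame1.
Proof.
apply: smooth_mx5 => // -[|[|[|[|[|//]]]]] [|[|[|[|[|//]]]]] _ _ /=;
  by [exact: (fun k => Ck_cst k U _) | exact: smooth_theta | exact/smooth_opp/smooth_frac |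
      exact: smooth_frac | exact: smooth_opp | exact: smooth_opp (smooth_theta _) | ].
Qed.

(** The row of Y carries the Codazzi equations, the row of the dual vector the dual ones, the
    diagonal entries of these two rows the Ricci equation, and the block of xi_1 and xi_2 the Gauss
    equation. The other entries repeat them or hold identically. *)
Lemma flat_frame u : U u ->
  pd 1 a u - pd 0 b u = w0 u * b u - w1 u * a u ->
  pd 1 b u + pd 0 a u = - (w0 u * a u) - w1 u * b u ->
  pd 1 s0 u - pd 0 s1 u - theta 1 u * (s0 u + s2 u) = - (w0 u * s1 u) + w1 u * s0 u ->
  pd 1 s1 u - pd 0 s2 u + theta 0 u * (s0 u + s2 u) = - (w0 u * s2 u) + w1 u * s1 u ->
  pd 1 w0 u - pd 0 w1 u = (2 * a u * s1 u - (s0 u - s2 u) * b u) / m u ->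
  - (pd 0 (theta 0) u + pd 1 (theta 1) u) = m u + (a u * s0 u + 2 * b u * s1 u - a u * s2 u) / m u ->
  flat frame0 frame1 u.
Proof.
move=> Uu C1 C2 D1 D2 Ri G.
have mu0 := m0 Uu.
have dm i : pd i m u = 2 * m u * theta i u by rewrite /theta; field.
have dt i := smooth_diff (smooth_theta i) Uu.
have dpm i := smooth_diff (smooth_pd i sm) Uu.
have [[da db] dmm] := (smooth_diff sa Uu, smooth_diff sb Uu, smooth_diff sm Uu).
have [d0 d1] := (smooth_diff sw0 Uu, smooth_diff sw1 Uu).
have [[e0 e1] e2] := (smooth_diff ss0 Uu, smooth_diff ss1 Uu, smooth_diff ss2 Uu).
have dfr (f : pt -> R) : differentiable f u -> differentiable (fun v => f v / m v) u.
  by move=> df; apply: differentiableM => //; apply: differentiableV.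
have pdfr (f : pt -> R) i : differentiable f u ->
    pd i (fun v => f v / m v) u = (pd i f u - 2 * f u * theta i u) / m u.
  move=> df; rewrite pdM //; last exact: differentiableV.
  by rewrite pdV // dm; field.
(* The form [theta] is closed, being half of d log m; the diagonal entries in the rows of xi_1 and
   xi_2 say exactly this. *)
have T : pd 0 (theta 1) u = pd 1 (theta 0) u.
  have d2m : differentiable (fun v => 2 * m v) u by apply: differentiableM.
  have m20 : 2 * m u != 0 by rewrite mulf_neq0 // pnatr_eq0.
  have dV : differentiable (fun v => (2 * m v)^-1) u by exact: differentiableV.
  have d2 : differentiable (fun=> 2 : R) u by exact: differentiable_cst.
  rewrite /theta (pdM _ (dpm 0) dV) (pdM _ (dpm 1) dV) !(pdV _ d2m m20).
  rewrite (pd_comm 0 1 oU sm Uu) !(pdM _ d2 dmm) !pd_cst.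
  by move: (pd 1 (pd 0 m) u) (pd 0 m u) (pd 1 m u) (m u) mu0 => *; field.
(* Each condition is solved for one derivative. After substitution the remaining values are
   independent variables and all 25 equations become rational identities. *)
have {}C1 : pd 1 a u = w0 u * b u - w1 u * a u + pd 0 b u by rewrite -C1 subrK.
have {}C2 : pd 1 b u = - (w0 u * a u) - w1 u * b u - pd 0 a u by rewrite -C2 addrK.
have {}D1 : pd 1 s0 u = - (w0 u * s1 u) + w1 u * s0 u + theta 1 u * (s0 u + s2 u) + pd 0 s1 u.
  by rewrite -D1 !subrK.
have {}D2 : pd 1 s1 u = - (w0 u * s2 u) + w1 u * s1 u - theta 0 u * (s0 u + s2 u) + pd 0 s2 u.
  by rewrite -D2 addrK subrK.
have {}Ri : pd 1 w0 u = (2 * a u * s1 u - (s0 u - s2 u) * b u) / m u + pd 0 w1 u.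
  by rewrite -Ri subrK.
have {}G : pd 0 (theta 0) u = - (m u + (a u * s0 u + 2 * b u * s1 u - a u * s2 u) / m u) - pd 1 (theta 1) u.
  by rewrite -G opprK addrK.
apply: (flat_mx5 oU Uu smooth_frame0 smooth_frame1).
move=> [|[|[|[|[|p]]]]] [|[|[|[|[|q]]]]] p5 q5; try case: (notF p5); try case: (notF q5).
all: cbv [dot5 ent nth].
all: rewrite ?(pdN _ da) ?(pdN _ db) ?(pdN _ dmm) ?(pdN _ d0) ?(pdN _ d1) ?(pdN _ e0) ?(pdN _ e1)
  ?(pdN _ e2) ?(pdN _ (dt 0)) ?(pdN _ (dt 1)) ?(pdN _ (dfr _ da))
  ?(pdN _ (dfr _ db)) ?(pdN _ (dfr _ e0)) ?(pdN _ (dfr _ e1)) ?(pdN _ (dfr _ e2)).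
all: rewrite ?(pdfr _ _ da) ?(pdfr _ _ db) ?(pdfr _ _ e0) ?(pdfr _ _ e1) ?(pdfr _ _ e2).
all: rewrite ?pd_cst ?dm ?T ?C1 ?C2 ?D1 ?D2 ?Ri ?G.
clear C1 C2 D1 D2 Ri G dm T.
all: move: (pd 0 a u) (pd 0 b u) (pd 0 s0 u) (pd 0 s1 u) (pd 0 s2 u) (pd 0 w1 u)
  (pd 1 s2 u) (pd 1 (theta 1) u) (pd 1 (theta 0) u) => *.
all: move: (theta 0 u) (theta 1 u) (a u) (b u) (m u) mu0 (w0 u) (w1 u) (s0 u) (s1 u) (s2 u) => *.
all: by field.
Qed.

End FrameConnection.

(** * Curvature and Codazzi expressions of conformal metrics *)

Section ConformalMetrics.
Context {R : realType}.
Local Notation pt := 'rV[R]_2.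
Implicit Types (f E : pt -> R) (u : pt).

Lemma sum2 (F : 'I_2 -> R) : \sum_(k < 2) F k = F 0 + F 1.
Proof. by rewrite !big_ord_recr big_ord0 /= add0r; congr (F _ + F _); exact/val_inj. Qed.

Lemma pd_conformal f u (i j k : 'I_2) :
  pd i (fun v => conformal_metric f v j k) u = (j == k)%:R * pd i f u.
Proof.
rewrite /conformal_metric; have [<-|jk] := eqVneq j k.
  by rewrite mul1r; congr (pd _ _ _); apply/funext => v; rewrite mxE eqxx.
rewrite mul0r -(pd_cst 0 u i); congr (pd _ _ _); apply/funext => v.
by rewrite mxE (negbTE jk).
Qed.

Lemma christoffel_conformal f u (i j k : 'I_2) : f u != 0 ->
  christoffel (conformal_metric f) k i j u =
  (j == k)%:R * theta f i u + (i == k)%:R * theta f j u - (i == j)%:R * theta f k u.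
Proof.
move=> f0; rewrite /christoffel (bigD1 k) //= big1 => [|l lk].
  rewrite !pd_conformal /theta {1}/conformal_metric invmx_scalar !mxE eqxx mulr1n addr0.
  by move: (pd i f u) (pd j f u) (pd k f u) (f u) f0 => *; field.
by rewrite {1}/conformal_metric invmx_scalar mxE eq_sym (negbTE lk) mulr0n mul0r.
Qed.

(** Antisymmetrizing the covariant derivative leaves from the Christoffel terms only the trace of
    [T] times [theta]. For a traceless form the metric therefore drops out; for Omega* a change of
    conformal factor costs a multiple of the trace. *)
Lemma codazzi_conformal f u (T : pt -> 'M[R]_2) : f u != 0 ->
  (T u 1 0 = T u 0 1) ->
  cov2 (conformal_metric f) T 0 0 1 u - cov2 (conformal_metric f) T 0 1 0 u =
    pd 1 (fun v => T v 0 0) u - pd 0 (fun v => T v 0 1) u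
    - theta f 1 u * (T u 0 0 + T u 1 1) /\
  cov2 (conformal_metric f) T 0 1 1 u - cov2 (conformal_metric f) T 1 1 0 u =
    pd 1 (fun v => T v 0 1) u - pd 0 (fun v => T v 1 1) u
    + theta f 0 u * (T u 0 0 + T u 1 1).
Proof.
move=> f0 T10; rewrite /cov2 !sum2 !christoffel_conformal // T10 /=.
move: (pd 1 (fun v => T v 0 0) u) (pd 0 (fun v => T v 0 1) u) (pd 1 (fun v => T v 0 1) u)
  (pd 0 (fun v => T v 1 1) u) (theta f 0 u) (theta f 1 u) => *.
by split; ring.
Qed.

(** The classical K = - (Laplacian of log f) / (2 f), with [theta] as half the gradient of log f. *)
Lemma gauss_conformal f (U : set pt) u : open U -> U u -> smooth U f ->
  (forall v, U v -> f v != 0) ->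
  gauss_curvature (conformal_metric f) u =
  - (pd 0 (theta f 0) u + pd 1 (theta f 1) u) / f u.
Proof.
move=> oU Uu sf f0; have fu := f0 _ Uu.
have st i : differentiable (theta f i) u.
  exact: smooth_diff (smooth_theta oU f0 sf i) Uu.
have P i j k l : pd i (christoffel (conformal_metric f) j k l) u = pd i (fun v =>
   (l == j)%:R * theta f k v + (k == j)%:R * theta f l v - (k == l)%:R * theta f j v) u.
  by apply: (pd_near _ oU Uu) => v Uv; exact: christoffel_conformal (f0 _ Uv).
have dZ (c : R) i : differentiable (fun v => c * theta f i v) u.
  by apply: differentiableM => //; exact: differentiable_cst.
have pdZ (c : R) i j : pd i (fun v => c * theta f j v) u = c * pd i (theta f j) u.
  by rewrite (pdM _ (differentiable_cst _ _) (st j)) pd_cst mul0r add0r.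
have P2 i j k l : pd i (christoffel (conformal_metric f) j k l) u =
   (l == j)%:R * pd i (theta f k) u + (k == j)%:R * pd i (theta f l) u
     - (k == l)%:R * pd i (theta f j) u.
  have dl := dZ (l == j)%:R k; have dk := dZ (k == j)%:R l; have dj := dZ (k == l)%:R j.
  apply: etrans (P i j k l) (etrans (pdB i (differentiableD dl dk) dj) _).
  exact: (congr2 (fun a b => a - b) (etrans (pdD i dl dk) (congr2 +%R (pdZ _ _ _) (pdZ _ _ _)))).
rewrite /gauss_curvature /riemann !sum2 !P2 !christoffel_conformal //.
rewrite /conformal_metric det_scalar !mxE /=.
move: fu; generalize (pd 0 (theta f 0) u) (pd 1 (theta f 1) u) (pd 0 (theta f 1) u)
  (pd 1 (theta f 0) u) (theta f 0 u) (theta f 1 u) (f u) => *.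
by field.
Qed.

End ConformalMetrics.

Section ScalarConditions.
Context {R : realType}.
Local Notation pt := 'rV[R]_2.
Variables (D : set pt) (Om : pt -> 'M[R]_2) (m E : pt -> R) (Oms : pt -> 'M[R]_2).
Hypotheses (oD : open D) (sOm : smooth D Om) (sm : smooth D m) (sE : smooth D E).
Hypothesis Om_sym : forall u, D u -> (Om u)^T = Om u.
Hypothesis Om_traceless : forall u, D u -> Om u 0 0 + Om u 1 1 = 0.
Hypothesis E0 : forall u, D u -> E u != 0.
Hypothesis m0 : forall u, D u -> m u != 0.
Hypothesis m_def : forall u, D u -> m u = - \det (Om u) / E u.

Lemma sym10 (T : 'M[R]_2) : T^T = T -> T 1 0 = T 0 1.
Proof. by move=> /matrixP/(_ 0 1); rewrite mxE. Qed.

Lemma det2 (T : 'M[R]_2) : \det T = T 0 0 * T 1 1 - T 0 1 * T 1 0.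
Proof.
rewrite (expand_det_row _ 0) sum2 /cofactor !det_mx11 !mxE /=.
have -> : lift 0 0 = 1 :> 'I_2 by exact/val_inj.
have -> : lift 1 0 = 0 :> 'I_2 by exact/val_inj.
by rewrite mul1r mulN1r mulrN.
Qed.

Lemma Om_norm u : D u -> Om u 0 0 ^+ 2 + Om u 0 1 ^+ 2 = m u * E u.
Proof.
move=> Du; rewrite (m_def Du) det2 (sym10 (Om_sym Du)).
have -> : Om u 1 1 = - Om u 0 0 by apply/eqP; rewrite -addr_eq0 addrC Om_traceless.
by rewrite divfK ?E0 //; ring.
Qed.

Lemma sqnormE u : D u -> sqnorm E Om u = 2 * m u / E u.
Proof.
move=> Du; rewrite /sqnorm !sum2 (sym10 (Om_sym Du)).
have -> : Om u 1 1 = - Om u 0 0 by apply/eqP; rewrite -addr_eq0 addrC Om_traceless.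
have N := Om_norm Du; have e := E0 Du.
rewrite (_ : _ + _ + _ = 2 * (Om u 0 0 ^+ 2 + Om u 0 1 ^+ 2)); last by ring.
by rewrite N; field.
Qed.

(** Since |Omega|^2 = 2 m / E, its logarithmic derivative compares [theta] for [m] with [theta] for
    [E]; it converts the dual Codazzi equations from the metric E |du|^2 to m |du|^2. *)
Lemma dlog_sqnorm u i : D u ->
  (sqnorm E Om u)^-1 * pd i (sqnorm E Om) u = 2 * (theta m i u - theta E i u).
Proof.
move=> Du; rewrite sqnormE //.
rewrite (pd_near _ oD Du (G := fun v => 2 * m v / E v)); last exact: sqnormE.
have dm := smooth_diff sm Du; have dE := smooth_diff sE Du.
have d2 : differentiable (fun=> 2 : R) u by exact: differentiable_cst.
have d2m : differentiable (fun v => 2 * m v) u.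
  by apply: differentiableM => //; exact: differentiable_cst.
rewrite (pdM _ d2m (differentiableV dE (E0 Du))) (pdV _ dE (E0 Du)).
rewrite (pdM _ d2 dm) pd_cst /theta.
have e := E0 Du; have mm := m0 Du.
move: (pd i m u) (pd i E u) (m u) (E u) e mm => x y z t t0 z0.
by field; rewrite t0 z0.
Qed.

End ScalarConditions.

(** * From the integrability conditions to flatness *)

Section DataConnection.
Context {R : realType}.
Local Notation pt := 'rV[R]_2.
Variables (Om : pt -> 'M[R]_2) (m : pt -> R) (w : pt -> 'rV[R]_2) (Oms : pt -> 'M[R]_2).

Definition structure0 : pt -> 'M[R]_5 :=
  frame0 (fun u => Om u 0 0) (fun u => Om u 0 1) m (fun u => w u 0 0)
    (fun u => Oms u 0 0) (fun u => Oms u 0 1).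

Definition structure1 : pt -> 'M[R]_5 :=
  frame1 (fun u => Om u 0 0) (fun u => Om u 0 1) m (fun u => w u 0 1)
    (fun u => Oms u 0 1) (fun u => Oms u 1 1).

Variables (D : set pt) (E : pt -> R).
Hypothesis D_open : open D.
Hypotheses (Om_smooth : smooth D Om) (m_smooth : smooth D m) (E_smooth : smooth D E)
  (w_smooth : smooth D w) (Oms_smooth : smooth D Oms).
Hypothesis m_neq0 : forall u, D u -> m u != 0.

Lemma smooth_mx_entry p q (M : pt -> 'M[R]_(p, q)) i j : smooth D M -> smooth D (fun u => M u i j).
Proof. by move=> sM k; exact: (Ck_mxP k M D_open).1 (sM k) i j. Qed.

Lemma smooth_structure0 : smooth D structure0.
Proof. by apply: smooth_frame0 => //; exact: smooth_mx_entry. Qed.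

Lemma smooth_structure1 : smooth D structure1.
Proof. by apply: smooth_frame1 => //; exact: smooth_mx_entry. Qed.

Lemma structure_flat
  (Om_sym : forall u, D u -> (Om u)^T = Om u)
  (Om_traceless : forall u, D u -> Om u 0 0 + Om u 1 1 = 0)
  (E_neq0 : forall u, D u -> E u != 0)
  (m_def : forall u, D u -> m u = - \det (Om u) / E u)
  (Oms_sym : forall u, D u -> (Oms u)^T = Oms u)
  (codazzi1 : forall u, D u ->
    cov2 (conformal_metric E) Om 0 0 1 u - cov2 (conformal_metric E) Om 0 1 0 u
    = w u 0 0 * Om u 0 1 - w u 0 1 * Om u 0 0)
  (codazzi2 : forall u, D u ->
    cov2 (conformal_metric E) Om 0 1 1 u - cov2 (conformal_metric E) Om 1 1 0 u
    = w u 0 0 * Om u 1 1 - w u 0 1 * Om u 0 1)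
  (dual_codazzi1 : forall u, D u ->
    cov2 (conformal_metric E) Oms 0 0 1 u - cov2 (conformal_metric E) Oms 0 1 0 u
    = - (w u 0 0 * Oms u 0 1) + w u 0 1 * Oms u 0 0
      + 2^-1 * ((Oms u 0 0 + Oms u 1 1) / sqnorm E Om u) * pd 1 (sqnorm E Om) u)
  (dual_codazzi2 : forall u, D u ->
    cov2 (conformal_metric E) Oms 0 1 1 u - cov2 (conformal_metric E) Oms 1 1 0 u
    = - (w u 0 0 * Oms u 1 1) + w u 0 1 * Oms u 0 1
      - 2^-1 * ((Oms u 0 0 + Oms u 1 1) / sqnorm E Om u) * pd 0 (sqnorm E Om) u)
  (ricci : forall u, D u ->
    cov1 (conformal_metric E) w 0 1 u - cov1 (conformal_metric E) w 1 0 u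
    = (m u)^-1 * ((Om u 0 0 - Om u 1 1) * Oms u 0 1
                  - (Oms u 0 0 - Oms u 1 1) * Om u 0 1))
  (gauss : forall u, D u ->
    gauss_curvature (conformal_metric m) u - 1
    = (m u) ^- 2 * \tr (Om u *m Oms u)) :
  forall u, D u -> flat structure0 structure1 u.
Proof.
move=> u Du; have e0 := E_neq0 _ Du; have mu0 := m_neq0 Du.
have O10 := sym10 (Om_sym _ Du); have S10 := sym10 (Oms_sym _ Du).
have O11 v : D v -> Om v 1 1 = - Om v 0 0.
  by move=> Dv; apply/eqP; rewrite -addr_eq0 addrC Om_traceless.
have pO11 i : pd i (fun v => Om v 1 1) u = - pd i (fun v => Om v 0 0) u.
  rewrite (pd_near _ D_open Du O11) pdN //.
  exact: smooth_diff (smooth_mx_entry 0 0 Om_smooth) Du.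
have [cE1 cE2] := codazzi_conformal e0 O10.
have [cS1 cS2] := codazzi_conformal e0 S10.
have dl i := dlog_sqnorm D_open m_smooth E_smooth Om_sym Om_traceless E_neq0 m_neq0 m_def i Du.
apply: (flat_frame D_open m_neq0) => //; try exact: smooth_mx_entry.
- rewrite -(codazzi1 _ Du) cE1 Om_traceless //.
  by generalize (pd 1 (fun v => Om v 0 0) u) (pd 0 (fun v => Om v 0 1) u) (theta E 1 u); intros; ring.
- have := codazzi2 _ Du; rewrite cE2 Om_traceless // pO11 O11 //.
  generalize (pd 1 (fun v => Om v 0 1) u) (pd 0 (fun v => Om v 0 0) u) (theta E 0 u).
  by move=> x y z; rewrite opprK mulr0 addr0 mulrN.
- have := dual_codazzi1 _ Du; rewrite cS1.
  rewrite (_ : 2^-1 * _ * _ = 2^-1 * (Oms u 0 0 + Oms u 1 1) *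
    ((sqnorm E Om u)^-1 * pd 1 (sqnorm E Om) u)); last first.
    by move: (_^-1) (pd 1 (sqnorm E Om) u) => *; ring.
  rewrite dl.
  move: (pd 1 _ u) (pd 0 _ u) (theta E 1 u) (theta m 1 u) => x y z t H.
  by move: H => /(canRL (subrK _)) ->; field.
- have := dual_codazzi2 _ Du; rewrite cS2.
  rewrite (_ : 2^-1 * _ * _ = 2^-1 * (Oms u 0 0 + Oms u 1 1) *
    ((sqnorm E Om u)^-1 * pd 0 (sqnorm E Om) u)); last first.
    by move: (_^-1) (pd 0 (sqnorm E Om) u) => *; ring.
  rewrite dl.
  move: (pd 1 _ u) (pd 0 _ u) (theta E 0 u) (theta m 0 u) => x y z t H.
  by move: H => /(canRL (addrK _)) ->; field.
(* The Christoffel symbols are symmetric in the lower indices and cancel in the difference of the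
   two covariant derivatives. *)
- have := ricci _ Du; rewrite /cov1 !sum2 !christoffel_conformal // O11 //=.
  move: (pd 1 _ u) (pd 0 _ u) (theta E 0 u) (theta E 1 u) (w u 0 0) (w u 0 1)
    (Om u 0 0) (Om u 0 1) (Oms u 0 0) (Oms u 0 1) (Oms u 1 1) (m u) => x y z t c d e f g h i j H.
  have -> : x - y = j^-1 * ((e - - e) * h - (g - i) * f) by rewrite -H; ring.
  by ring.
have := gauss _ Du; rewrite (gauss_conformal D_open Du m_smooth m_neq0).
rewrite /mxtrace sum2 !mxE !sum2 O10 S10 O11 //.
move: (pd 0 _ u) (pd 1 _ u) (Om u 0 0) (Om u 0 1) (Oms u 0 0) (Oms u 0 1) (Oms u 1 1)
  (m u) mu0 => x y e f g h i j j0 H.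
have -> : - (x + y) = j * (- (x + y) / j - 1 + 1) by field.
by rewrite H; field.
Qed.

End DataConnection.

(** * Minkowski space *)

(* hoelder.v also defines a constant of this name. *)
Notation minkowski := Defs.minkowski.

Section Minkowski.
Context {R : realType}.
Local Notation pt := 'rV[R]_2.
Local Notation R14 := (R * 'rV[R]_4)%type.
Implicit Types (p q r : R14) (c : R).

Lemma dotE (x y : 'rV[R]_4) : dot x y = (x *m y^T) 0 0.
Proof. by rewrite mxE; apply: eq_bigr => k _; rewrite mxE. Qed.

Lemma dotC (x y : 'rV[R]_4) : dot x y = dot y x.
Proof. by apply: eq_bigr => k _; rewrite mulrC. Qed.

Lemma dotDl (x y z : 'rV[R]_4) : dot (x + y) z = dot x z + dot y z.
Proof. by rewrite !dotE mulmxDl mxE. Qed.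

Lemma dotZl c (x y : 'rV[R]_4) : dot (c *: x) y = c * dot x y.
Proof. by rewrite !dotE -scalemxAl mxE. Qed.

Lemma dotDr (x y z : 'rV[R]_4) : dot x (y + z) = dot x y + dot x z.
Proof. by rewrite !(dotC x) dotDl. Qed.

Lemma dotZr c (x y : 'rV[R]_4) : dot x (c *: y) = c * dot x y.
Proof. by rewrite !(dotC x) dotZl. Qed.

Lemma dotNl (x y : 'rV[R]_4) : dot (- x) y = - dot x y.
Proof. by rewrite -scaleN1r dotZl mulN1r. Qed.

Lemma dotNr (x y : 'rV[R]_4) : dot x (- y) = - dot x y.
Proof. by rewrite dotC dotNl dotC. Qed.

Lemma dot0l (x : 'rV[R]_4) : dot 0 x = 0.
Proof. by rewrite -(scale0r 0) dotZl mul0r. Qed.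

Lemma dot_ge0 (x : 'rV[R]_4) : 0 <= dot x x.
Proof. by apply: sumr_ge0 => k _; rewrite -expr2 sqr_ge0. Qed.

Lemma dot_eq0 (x : 'rV[R]_4) : dot x x = 0 -> x = 0.
Proof.
move=> /eqP; rewrite psumr_eq0 => [|k _]; last by rewrite -expr2 sqr_ge0.
move=> /allP H; apply/rowP => k; rewrite mxE; apply/eqP.
by have := H k (mem_index_enum k); rewrite -expr2 sqrf_eq0.
Qed.

Lemma minkC p q : minkowski p q = minkowski q p.
Proof. by rewrite /minkowski dotC mulrC. Qed.

Lemma minkDl p q r : minkowski (p + q) r = minkowski p r + minkowski q r.
Proof. by rewrite /minkowski /= dotDl mulrDl opprD addrACA. Qed.

Lemma minkZl c p q : minkowski (c *: p) q = c * minkowski p q.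
Proof. by rewrite /minkowski /= dotZl -mulrA -mulrN mulrDr. Qed.

Lemma minkDr p q r : minkowski p (q + r) = minkowski p q + minkowski p r.
Proof. by rewrite !(minkC p) minkDl. Qed.

Lemma minkZr c p q : minkowski p (c *: q) = c * minkowski p q.
Proof. by rewrite !(minkC p) minkZl. Qed.

Lemma minkNl p q : minkowski (- p) q = - minkowski p q.
Proof. by rewrite -scaleN1r minkZl mulN1r. Qed.

Lemma minkNr p q : minkowski p (- q) = - minkowski p q.
Proof. by rewrite minkC minkNl minkC. Qed.

Definition minkE := (minkDl, minkDr, minkZl, minkZr, minkNl, minkNr).

Lemma differentiable_fst (V : normedModType R) (f : V -> R14) u :
  differentiable f u -> differentiable (fun v => (f v).1) u.
Proof.
move=> df; apply: (@differentiable_comp _ _ _ _ f fst) => //.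
by apply: linear_differentiable => p; exact: cvg_fst.
Qed.

Lemma differentiable_snd (V : normedModType R) (f : V -> R14) u :
  differentiable f u -> differentiable (fun v => (f v).2) u.
Proof.
move=> df; apply: (@differentiable_comp _ _ _ _ f snd) => //.
by apply: linear_differentiable => p; exact: cvg_snd.
Qed.

Lemma pd_pair (f : pt -> R) (g : pt -> 'rV[R]_4) u i :
  differentiable f u -> differentiable g u ->
  pd i (fun v => (f v, g v) : R14) u = (pd i f u, pd i g u).
Proof.
move=> df dg; rewrite /pd !deriveE //; last exact: differentiable_pair.
by rewrite diff_pair.
Qed.

Lemma pd_fst (f : pt -> R14) u i : differentiable f u ->
  (pd i f u).1 = pd i (fun v => (f v).1) u.
Proof.
move=> df; have := pd_pair i (differentiable_fst df) (differentiable_snd df).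
have -> : (fun v => ((f v).1, (f v).2)) = f by apply/funext => v; case: (f v).
by move=> ->.
Qed.

Lemma pd_snd (f : pt -> R14) u i : differentiable f u ->
  (pd i f u).2 = pd i (fun v => (f v).2) u.
Proof.
move=> df; have := pd_pair i (differentiable_fst df) (differentiable_snd df).
have -> : (fun v => ((f v).1, (f v).2)) = f by apply/funext => v; case: (f v).
by move=> ->.
Qed.

Lemma pd_mx j k (M : pt -> 'M[R]_(j, k)) u i a b : differentiable M u ->
  pd i M u a b = pd i (fun v => M v a b) u.
Proof. by move=> dM; rewrite /pd derive_mxE //; exact: diff_derivable. Qed.

Lemma pd_sum n (f : 'I_n -> pt -> R) u i : (forall k, differentiable (f k) u) ->
  pd i (fun v => \sum_(k < n) f k v) u = \sum_(k < n) pd i (f k) u.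
Proof.
move=> df; rewrite /pd -derive_sum => [|k]; last exact: diff_derivable.
by have -> : (fun v => \sum_(k < n) f k v) = \sum_(k < n) f k
  by apply/funext => v; rewrite fct_sumE.
Qed.

Lemma differentiable_dot (f g : pt -> 'rV[R]_4) u : differentiable f u ->
  differentiable g u -> differentiable (fun v => dot (f v) (g v)) u.
Proof.
move=> /differentiable_mxP df /differentiable_mxP dg.
have -> : (fun v => dot (f v) (g v)) = \sum_(k < 4) (fun v => f v 0 k * g v 0 k).
  by apply/funext => v; rewrite fct_sumE.
by apply: differentiable_sum => k; apply: differentiableM.
Qed.

Lemma pd_dot (f g : pt -> 'rV[R]_4) u i : differentiable f u -> differentiable g u ->
  pd i (fun v => dot (f v) (g v)) u = dot (pd i f u) (g u) + dot (f u) (pd i g u).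
Proof.
move=> df dg; have dfk k := (differentiable_mxP f u).1 df 0 k.
have dgk k := (differentiable_mxP g u).1 dg 0 k.
rewrite pd_sum => [|k]; last by apply: differentiableM.
rewrite -big_split /=; apply: eq_bigr => k _.
by rewrite (pdM _ (dfk k) (dgk k)) !pd_mx.
Qed.

Lemma pd_mink (f g : pt -> R14) u i : differentiable f u -> differentiable g u ->
  pd i (fun v => minkowski (f v) (g v)) u =
  minkowski (pd i f u) (g u) + minkowski (f u) (pd i g u).
Proof.
move=> df dg.
have [f1 g1] := (differentiable_fst df, differentiable_fst dg).
have [f2 g2] := (differentiable_snd df, differentiable_snd dg).
have fg1 : differentiable (fun v => (f v).1 * (g v).1) u by exact: differentiableM.
have alg (p q : R14) a b c e : p.1 = a -> p.2 = b -> q.1 = c -> q.2 = e ->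
    - (a * (g u).1 + (f u).1 * c) + (dot b (g u).2 + dot (f u).2 e) =
    minkowski p (g u) + minkowski (f u) q.
  by move=> <- <- <- <-; rewrite /minkowski opprD addrACA.
rewrite /minkowski (pdD _ (differentiableN fg1) (differentiable_dot f2 g2)).
rewrite (pdN i fg1) (pdM i f1 g1) (pd_dot i f2 g2).
exact: alg (pd_fst i df) (pd_snd i df) (pd_fst i dg) (pd_snd i dg).
Qed.

(** Vectors are rows: connection matrices act on a frame from the left and constant linear maps from
    the right, so the two actions commute. *)
Definition vec p : 'rV[R]_5 := row_mx (p.1%:M : 'M[R]_1) p.2 : 'rV[R]_(1 + 4).

Definition Jmx : 'M[R]_5 := block_mx (- 1%:M : 'M[R]_1) 0 0 (1%:M : 'M[R]_4) : 'M[R]_(1 + 4).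

Lemma vecD p q : vec (p + q) = vec p + vec q.
Proof. by rewrite /vec raddfD /= -add_row_mx. Qed.

Lemma vecZ c p : vec (c *: p) = c *: vec p.
Proof. by have := @scale_row_mx _ 1 1 4 c p.1%:M p.2; rewrite scale_scalar_mx. Qed.

Lemma vec_inj : injective vec.
Proof.
move=> [a x] [b y] /(@eq_row_mx _ 1 1 4)[/= E ->]; congr (_, _).
by move/matrixP/(_ 0 0): E; rewrite !mxE.
Qed.

Lemma vec_mink p q : vec p *m Jmx *m (vec q)^T = (minkowski p q)%:M.
Proof.
rewrite /vec /Jmx (@mul_row_block _ _ 1 4 1 4) !mulmx0 addr0 add0r mulmx1 mulmxN mulmx1.
rewrite (@tr_row_mx _ _ 1 4) (@mul_row_col _ _ 1 4) tr_scalar_mx mulNmx -scalar_mxM.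
by rewrite [X in _ + X]mx11_scalar -dotE /minkowski raddfD /= raddfN.
Qed.

Lemma vec_minkE p q : (vec p *m Jmx *m (vec q)^T) 0 0 = minkowski p q.
Proof. by rewrite vec_mink mxE. Qed.

Definition unvec (v : 'rV[R]_5) : R14 :=
  ((lsubmx (v : 'rV[R]_(1 + 4))) 0 0, rsubmx (v : 'rV[R]_(1 + 4))).

Lemma vecK : cancel vec unvec.
Proof. by move=> [a x]; rewrite /vec /unvec row_mxKl row_mxKr mxE. Qed.

Lemma unvecK : cancel unvec vec.
Proof. by move=> v; rewrite /vec /unvec /= -mx11_scalar hsubmxK. Qed.

End Minkowski.

(** * Frames with a prescribed Gram matrix *)

Section Frames.
Context {R : realType}.
Local Notation pt := 'rV[R]_2.
Local Notation R14 := (R * 'rV[R]_4)%type.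
Local Notation o k := (@Ordinal 5 k isT).
Implicit Types (f : 'I_5 -> R14) (c m : R) (v : R14).

Definition framemx f : 'M[R]_5 := \matrix_(i, j) vec (f i) 0 j.

Lemma row_framemx f i : row i (framemx f) = vec (f i).
Proof. by apply/rowP => j; rewrite !mxE. Qed.

Lemma framemx_inj f g : framemx f = framemx g -> f =1 g.
Proof. by move=> E i; apply: vec_inj; rewrite -!row_framemx E. Qed.

Lemma sum5Z (V : lmodType R) (F : 'I_5 -> V) :
  \sum_(k < 5) F k = F (o 0) + F (o 1) + F (o 2) + F (o 3) + F (o 4).
Proof.
rewrite !big_ord_recr big_ord0 /= add0r.
by congr (F _ + F _ + F _ + F _ + F _); exact/val_inj.
Qed.

Lemma vec0 : vec (0 : R14) = 0.
Proof. by rewrite -(scale0r 0) vecZ scale0r. Qed.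

Lemma mul_framemx (A : 'M[R]_5) f :
  A *m framemx f = framemx (fun i => \sum_(k < 5) A i k *: f k).
Proof.
apply/row_matrixP => i; rewrite row_mul mulmx_sum_row row_framemx.
rewrite (big_morph vec vecD vec0); apply: eq_bigr => k _.
by rewrite vecZ row_framemx mxE.
Qed.

Lemma framemx_mink f g i j : (framemx f *m Jmx *m (framemx g)^T) i j = minkowski (f i) (g j).
Proof.
rewrite -vec_minkE -!row_framemx -row_mul tr_row mxE [RHS]mxE.
by apply: eq_bigr => k _; rewrite [X in _ = X * _]mxE [X in _ = _ * X]mxE.
Qed.

Lemma Jmx_sq : @Jmx R *m Jmx = 1%:M.
Proof.
rewrite /Jmx (@mulmx_block _ 1 4 1 4 1 4) !mulmx0 !mul0mx !addr0 !add0r mulmx1.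
by rewrite mulNmx mulmxN opprK mulmx1 -scalar_mx_block.
Qed.

Lemma Jmx_tr : (@Jmx R)^T = Jmx.
Proof. by rewrite /Jmx (@tr_block_mx _ 1 4 1 4) !trmx0 tr_scalar_mx raddfN /= tr_scalar_mx. Qed.

(* Gram matrix of the frame (Y, Y*, xi, xi_1, xi_2). *)
Definition gram m : 'M[R]_5 := \matrix_(i, j) nth 0 (nth [::]
  [:: [:: 0; -1; 0; 0; 0]; [:: -1; 0; 0; 0; 0]; [:: 0; 0; 1; 0; 0];
      [:: 0; 0; 0; m; 0]; [:: 0; 0; 0; 0; m] ] i) j.

Lemma gramV m : m != 0 -> gram m *m gram m^-1 = 1%:M.
Proof.
move=> m0; apply/matrixP; apply: ord5P; apply: ord5P; rewrite mxE sum5 !mxE /=;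
  rewrite ?mulr1n ?mulr0n; by field.
Qed.

Definition adapted f m := forall i j, minkowski (f i) (f j) = gram m i j.

Lemma adaptedP f m : adapted f m <-> framemx f *m Jmx *m (framemx f)^T = gram m.
Proof.
split=> [H|H i j]; last by rewrite -H framemx_mink.
by apply/matrixP => i j; rewrite framemx_mink.
Qed.

Lemma adapted_unit f m : m != 0 -> adapted f m -> framemx f \in unitmx.
Proof.
move=> m0 /adaptedP E; have := gramV m0; rewrite -E -!mulmxA => /mulmx1_unit.
by case.
Qed.

Lemma adapted_nondegenerate f m v : m != 0 -> adapted f m ->
  (forall k, minkowski v (f k) = 0) -> v = 0.
Proof.
move=> m0 fm vf; apply: vec_inj.
have F1 := adapted_unit m0 fm.
have Z : vec v *m Jmx *m (framemx f)^T = 0.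
  apply/rowP => k; rewrite [RHS]mxE -(vf k) -vec_minkE -row_framemx tr_row.
  by rewrite [LHS]mxE [RHS]mxE; apply: eq_bigr => l _; rewrite [X in _ = _ * X]mxE.
have J1 : @Jmx R \in unitmx by have /mulmx1_unit[] := Jmx_sq.
have : vec v *m Jmx = 0.
  have FT : (framemx f)^T \in unitmx by rewrite unitmx_tr.
  by rewrite -[LHS](mulmxK FT) Z mul0mx.
rewrite vec0.
by move=> VJ; rewrite -[vec v](mulmxK J1) VJ mul0mx.
Qed.

(** Expansion in the dual basis. The first two vectors are null with product -1, so their
    coefficients are exchanged and change sign. The two sides have equal products with the frame,
    which is nondegenerate. *)
Lemma adapted_expand f m v : m != 0 -> adapted f m ->
  v = - minkowski v (f (o 1)) *: f (o 0) - minkowski v (f (o 0)) *: f (o 1)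
      + minkowski v (f (o 2)) *: f (o 2) + (minkowski v (f (o 3)) / m) *: f (o 3)
      + (minkowski v (f (o 4)) / m) *: f (o 4).
Proof.
move=> m0 fm; apply/eqP; rewrite -subr_eq0; apply/eqP.
apply: (adapted_nondegenerate m0 fm); apply: ord5P; rewrite !minkE !fm !mxE /=.
all: move: (minkowski v (f (o 0))) (minkowski v (f (o 1))) (minkowski v (f (o 2)))
  (minkowski v (f (o 3))) (minkowski v (f (o 4))) => *; by field.
Qed.

(** The linear conditions fix [z] up to a multiple of the first frame vector, and nullity forces
    that multiple to be zero. *)
Lemma adapted_dual_unique f m z : m != 0 -> adapted f m -> minkowski z z = 0 ->
  minkowski z (f (o 0)) = -1 -> minkowski z (f (o 2)) = 0 ->
  minkowski z (f (o 3)) = 0 -> minkowski z (f (o 4)) = 0 -> z = f (o 1).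
Proof.
move=> m0 fm zz z0 z2 z3 z4.
have E := adapted_expand z m0 fm.
move: E; rewrite z0 z2 z3 z4 !mul0r !scale0r !addr0 scaleN1r opprK => E.
have : minkowski z z = 2 * minkowski z (f (o 1)).
  by rewrite {2}E !minkE z0; ring.
rewrite zz => /esym/eqP; rewrite mulf_eq0 pnatr_eq0 /= => /eqP z1.
by rewrite E z1 oppr0 scale0r add0r.
Qed.

End Frames.

Section MovingFrames.
Context {R : realType}.
Local Notation pt := 'rV[R]_2.
Local Notation R14 := (R * 'rV[R]_4)%type.
Implicit Types (f : 'I_5 -> pt -> R14) (u : pt).

Definition movmx f u := framemx (f^~ u).

Lemma vecE (p : R14) (j : 'I_5) :
  vec p 0 j = match fintype.split (j : 'I_(1 + 4)) with inl _ => p.1 | inr k => p.2 0 k end.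
Proof. by rewrite /vec mxE; case: fintype.split => // k; rewrite mxE ord1 eqxx. Qed.

Lemma differentiable_movmx f u : (forall i, differentiable (f i) u) -> differentiable (movmx f) u.
Proof.
move=> df; apply/differentiable_mxP => i j.
have -> : (fun v => movmx f v i j) = (fun v => vec (f i v) 0 j) by apply/funext => v; rewrite mxE.
have -> : (fun v => vec (f i v) 0 j) = (fun v => match fintype.split (j : 'I_(1 + 4)) with
   inl _ => (f i v).1 | inr k => (f i v).2 0 k end) by apply/funext => v; exact: vecE.
case: fintype.split => k; first exact: differentiable_fst.
by have /differentiable_mxP := differentiable_snd (df i).
Qed.

Lemma pd_movmx f u i : (forall k, differentiable (f k) u) ->
  pd i (movmx f) u = framemx (fun k => pd i (f k) u).
Proof.
move=> df; apply/matrixP => k j; rewrite pd_mx; last exact: differentiable_movmx.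
have -> : (fun v => movmx f v k j) = (fun v => match fintype.split (j : 'I_(1 + 4)) with
   inl _ => (f k v).1 | inr l => (f k v).2 0 l end).
  by apply/funext => v; rewrite mxE vecE.
rewrite mxE vecE; case: fintype.split => l; first by rewrite pd_fst.
by rewrite pd_snd // pd_mx //; exact: differentiable_snd.
Qed.

Lemma differentiable_unvec (F : pt -> 'M[R]_5) (i : 'I_5) u : differentiable F u ->
  differentiable (fun v => unvec (row i (F v))) u.
Proof.
move=> /differentiable_mxP dF; apply: differentiable_pair.
  have -> : (fun v => lsubmx (row i (F v) : 'rV[R]_(1 + 4)) 0 0) =
    (fun v => F v i (lshift 4 (0 : 'I_1))) by apply/funext => v; rewrite !mxE.
  exact: dF.
apply/differentiable_mxP => a b; rewrite ord1.
have -> : (fun v => rsubmx (row i (F v) : 'rV[R]_(1 + 4)) 0 b) =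
    (fun v => F v i (rshift 1 b : 'I_5)) by apply/funext => v; rewrite !mxE.
exact: dF.
Qed.

Lemma movmx_unvec (F : pt -> 'M[R]_5) : movmx (fun i v => unvec (row i (F v))) = F.
Proof.
apply/funext => v; apply/row_matrixP => i.
by rewrite row_framemx unvecK.
Qed.

End MovingFrames.

(** * Propagation of the Gram relations *)

Section GramPropagation.
Context {R : realType}.
Local Notation pt := 'rV[R]_2.
Local Notation R14 := (R * 'rV[R]_4)%type.
Local Notation o k := (@Ordinal 5 k isT).
Implicit Types (u : pt).

Lemma differentiable_mulmx p q r (A : pt -> 'M[R]_(p, q)) (B : pt -> 'M[R]_(q, r)) u :
  differentiable A u -> differentiable B u -> differentiable (fun v => A v *m B v) u.
Proof.
move=> /differentiable_mxP dA /differentiable_mxP dB; apply/differentiable_mxP => i j.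
have -> : (fun v => (A v *m B v) i j) = \sum_(k < q) (fun v => A v i k * B v k j).
  by apply/funext => v; rewrite mxE fct_sumE.
by apply: differentiable_sum => k; apply: differentiableM.
Qed.

Lemma pd_mulmx p q r (A : pt -> 'M[R]_(p, q)) (B : pt -> 'M[R]_(q, r)) u i :
  differentiable A u -> differentiable B u ->
  pd i (fun v => A v *m B v) u = pd i A u *m B u + A u *m pd i B u.
Proof.
move=> dA dB; have dAk := (differentiable_mxP A u).1 dA.
have dBk := (differentiable_mxP B u).1 dB.
apply/matrixP => a b; rewrite pd_mx; last exact: differentiable_mulmx.
have -> : (fun v => (A v *m B v) a b) = (fun v => \sum_(k < q) A v a k * B v k b).
  by apply/funext => v; rewrite mxE.
rewrite pd_sum => [|k]; last by apply: differentiableM.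
rewrite !mxE -big_split /=; apply: eq_bigr => k _.
by rewrite (pdM _ (dAk _ _) (dBk _ _)) !pd_mx.
Qed.

Lemma differentiable_tr p q (A : pt -> 'M[R]_(p, q)) u :
  differentiable A u -> differentiable (fun v => (A v)^T) u.
Proof.
move=> /differentiable_mxP dA; apply/differentiable_mxP => i j.
have -> : (fun v => (A v)^T i j) = (fun v => A v j i) by apply/funext => v; rewrite mxE.
exact: dA.
Qed.

Lemma pd_tr p q (A : pt -> 'M[R]_(p, q)) u i : differentiable A u ->
  pd i (fun v => (A v)^T) u = (pd i A u)^T.
Proof.
move=> dA; apply/matrixP => a b.
rewrite mxE (pd_mx _ _ _ (differentiable_tr dA)) (pd_mx _ _ _ dA).
have -> // : (fun v => (A v)^T a b) = (fun v => A v b a).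
by apply/funext => v; rewrite mxE.
Qed.

Lemma norm_trmx p q (A : 'M[R]_(p, q)) : `|A^T| <= `|A|.
Proof. by apply: mx_norm_le => // i j; rewrite mxE le_mx_norm. Qed.

Lemma mul_mx5E l l' u (i j : 'I_5) : (mx5 l u *m mx5 l' u : 'M[R]_5) i j = dot5 l l' i j u.
Proof. by rewrite mxE sum5 !mxE. Qed.

Definition gram_entries (m : pt -> R) : seq (seq (pt -> R)) :=
  [:: [:: fun=> 0; fun=> -1; fun=> 0; fun=> 0; fun=> 0];
      [:: fun=> -1; fun=> 0; fun=> 0; fun=> 0; fun=> 0];
      [:: fun=> 0; fun=> 0; fun=> 1; fun=> 0; fun=> 0];
      [:: fun=> 0; fun=> 0; fun=> 0; m; fun=> 0];
      [:: fun=> 0; fun=> 0; fun=> 0; fun=> 0; m] ].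

Lemma gramE m u : gram (m u) = mx5 (gram_entries m) u.
Proof. by apply/matrixP; apply: ord5P; apply: ord5P; rewrite !mxE. Qed.

Variables (Om : pt -> 'M[R]_2) (m : pt -> R) (w : pt -> 'rV[R]_2) (Oms : pt -> 'M[R]_2).
Variable (D : set pt).
Hypothesis D_open : open D.
Hypotheses (Om_smooth : smooth D Om) (m_smooth : smooth D m)
  (w_smooth : smooth D w) (Oms_smooth : smooth D Oms).
Hypothesis m_neq0 : forall u, D u -> m u != 0.
Local Notation S0 := (structure0 Om m w Oms).
Local Notation S1 := (structure1 Om m w Oms).

Lemma smooth_gram : smooth D (mx5 (gram_entries m)).
Proof.
apply: smooth_mx5 => // -[|[|[|[|[|p]]]]] [|[|[|[|[|q]]]]] p5 q5;
  try case: (notF p5); try case: (notF q5);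
  by [exact: m_smooth | move=> k; exact: Ck_cst].
Qed.

(** Compatibility of the connection with the metric: the prescribed Gram matrix obeys the same
    linear equation as F J F^T for a solution F. The entries [theta] account for the variation of
    [m]. *)
Lemma gram_flow u : D u ->
  pd 0 (fun v => gram (m v)) u = S0 u *m gram (m u) + (S0 u *m gram (m u))^T /\
  pd 1 (fun v => gram (m v)) u = S1 u *m gram (m u) + (S1 u *m gram (m u))^T.
Proof.
move=> Du; have mu0 := m_neq0 Du.
have -> : (fun v => gram (m v)) = mx5 (gram_entries m) by apply/funext => v; exact: gramE.
have dm i : pd i m u = 2 * m u * theta m i u.
  by rewrite /theta; move: (pd i m u) (m u) mu0 => *; field.
rewrite !(pd_mx5 _ D_open Du smooth_gram) gramE.
split; apply/matrixP => i j; rewrite mxE [RHS]mxE [X in _ + X]mxE !mul_mx5E;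
  move: i j; apply: ord5P; apply: ord5P; cbv [dot5 ent nth gram_entries nat_of_ord];
  rewrite ?pd_cst ?dm; move: (theta m 0 u) (theta m 1 u) (m u) mu0 (Om u 0 0) (Om u 0 1)
   (Oms u 0 0) (Oms u 0 1) (Oms u 1 1) (w u 0 0) (w u 0 1) => *; by field.
Qed.

Lemma derive_flow (W : normedModType R) (F : pt -> W) (G0 G1 : W) u h : differentiable F u ->
  pd 0 F u = G0 -> pd 1 F u = G1 -> 'D_h F u = h 0 0 *: G0 + h 0 1 *: G1.
Proof. by move=> dF <- <-; rewrite derive_rV2. Qed.

Lemma pd_conn p q (A0 A1 : pt -> 'M[R]_p) (F : pt -> 'M[R]_(p, q)) u :
  (forall h, 'D_h F u = conn A0 A1 u h *m F u) ->
  pd 0 F u = A0 u *m F u /\ pd 1 F u = A1 u *m F u.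
Proof.
move=> H; rewrite /pd !H /conn !mxE /=.
by rewrite !scale1r !scale0r addr0 add0r.
Qed.

(** The difference X of the two sides satisfies the homogeneous equation dX = A X + (A X)^T and
    vanishes at [p0], so uniqueness on connected sets applies to it. *)
Lemma gram_propagation (U : set pt) p0 (F : pt -> 'M[R]_5) : open U -> connected U -> U p0 ->
  U `<=` D ->
  (forall u, U u -> differentiable F u /\ forall h, 'D_h F u = conn S0 S1 u h *m F u) ->
  F p0 *m Jmx *m (F p0)^T = gram (m p0) ->
  forall u, U u -> F u *m Jmx *m (F u)^T = gram (m u).
Proof.
move=> oU cU Up0 UD dF F0 u Uu; apply/eqP; rewrite -subr_eq0; apply/eqP; move: u Uu.
have dFJ v : U v -> differentiable (fun v => F v *m Jmx) v.
  move=> /dF[d _]; apply: differentiable_mulmx => //; exact: differentiable_cst.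
have dFT v : U v -> differentiable (fun v => (F v)^T) v.
  by move=> /dF[d _]; exact: differentiable_tr.
have dFJF v : U v -> differentiable (fun v => F v *m Jmx *m (F v)^T) v.
  by move=> Uv; apply: differentiable_mulmx; [exact: dFJ | exact: dFT].
have dG v : U v -> differentiable (fun v => gram (m v)) v.
  move=> Uv; have -> : (fun v => gram (m v)) = mx5 (gram_entries m).
    by apply/funext => x; exact: gramE.
  exact: smooth_diff smooth_gram (UD _ Uv).
have pJ v k (A : 'M[R]_5) : U v -> pd k F v = A *m F v ->
    pd k (fun v => F v *m Jmx *m (F v)^T) v =
    A *m (F v *m Jmx *m (F v)^T) + (A *m (F v *m Jmx *m (F v)^T))^T.
  move=> Uv E; have [d _] := dF _ Uv.
  have dJ := @differentiable_cst _ _ _ (@Jmx R) v.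
  rewrite (pd_mulmx _ (dFJ _ Uv) (dFT _ Uv)) (pd_mulmx _ d dJ) (pd_tr _ d) E.
  have -> : pd k (cst (@Jmx R)) v = 0 by exact: derive_cst.
  by rewrite mulmx0 addr0 !trmx_mul Jmx_tr trmxK !mulmxA.
apply: (@connected_unique _ _ _ (fun v => F v *m Jmx *m (F v)^T - gram (m v)) U p0 oU cU Up0).
- by rewrite F0 subrr.
- by move=> v Uv; apply: differentiableB; [exact: dFJF | exact: dG].
move=> u Uu; have Du := UD _ Uu.
have [r [L [rp L0 bnd _]]] := connection_boundsP D_open Du
  (smooth_structure0 D_open Om_smooth m_smooth w_smooth Oms_smooth m_neq0 2)
  (smooth_structure1 D_open Om_smooth m_smooth w_smooth Oms_smooth m_neq0 2).
exists r, (2 * (5%:R * L)); split=> // [|v vr Uv h]; first by rewrite !mulr_ge0.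
set X := F v *m Jmx *m (F v)^T - gram (m v).
have [_ dFv] := dF _ Uv; have [p0F p1F] := pd_conn dFv.
have [g0 g1] := gram_flow (UD _ Uv).
have E k (A : 'M[R]_5) : pd k F v = A *m F v ->
    pd k (fun v => gram (m v)) v = A *m gram (m v) + (A *m gram (m v))^T ->
    pd k (fun v => F v *m Jmx *m (F v)^T - gram (m v)) v = A *m X + (A *m X)^T.
  move=> EF EG; rewrite /pd (@deriveB _ _ _ (fun v => F v *m Jmx *m (F v)^T)).
  - rewrite -/(pd k _ v) -/(pd k (fun v => gram (m v)) v) (pJ _ _ _ Uv EF) EG /X.
    by rewrite mulmxBr raddfB /= opprD addrACA.
  - by apply: diff_derivable; exact: dFJF.
  - by apply: diff_derivable; exact: dG.
rewrite (derive_flow _ (differentiableB (dFJF _ Uv) (dG _ Uv)) (E _ _ p0F g0) (E _ _ p1F g1)).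
have sym_conn (a b : R) (P Q Z : 'M[R]_5) : a *: (P *m Z + (P *m Z)^T) +
    b *: (Q *m Z + (Q *m Z)^T) = (a *: P + b *: Q) *m Z + ((a *: P + b *: Q) *m Z)^T.
  rewrite mulmxDl -!scalemxAl; move: (P *m Z) (Q *m Z) => x y.
  by apply/matrixP => i j; rewrite !mxE; ring.
rewrite sym_conn -/(conn S0 S1 v h).
apply: le_trans (ler_normD _ _) _.
have B : `|conn S0 S1 v h *m X| <= 5%:R * (L * `|h|  * `|X|).
  by have [_ _ b _ _] := bnd _ vr; exact: mulmx_norm_le2.
have -> : 2 * (5%:R * L) * `|h| * `|X| = 5%:R * (L * `|h| * `|X|) + 5%:R * (L * `|h| * `|X|).
  by move: `|h| `|X| => *; ring.
by apply: lerD => //; apply: le_trans (norm_trmx _) _.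
Qed.

End GramPropagation.

(** * Existence *)

Section SphereGeometry.
Context {R : realType}.
Local Notation pt := 'rV[R]_2.
Local Notation R4 := 'rV[R]_4.
Local Notation R14 := (R * 'rV[R]_4)%type.
Local Notation o k := (@Ordinal 5 k isT).

Lemma dot_CauchySchwarz (x y : R4) : dot x y ^+ 2 <= dot x x * dot y y.
Proof.
have [/dot_eq0 ->|y0] := eqVneq (dot y y) 0.
  by rewrite dotC !dot0l expr0n mulr0.
have yp : 0 < dot y y by rewrite lt_def y0 dot_ge0.
(* This squared length is [dot y y] times the defect of the inequality. *)
have := dot_ge0 (dot y y *: x - dot x y *: y).
rewrite !(dotDl, dotDr, dotNl, dotNr, dotZl, dotZr) (dotC y x).
move: (dot x x) (dot x y) (dot y y) yp => a b c c0 H.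
rewrite -subr_ge0 -(pmulr_rge0 _ c0).
apply: le_trans H _; rewrite le_eqVlt; apply/orP; left; apply/eqP; ring.
Qed.

(** If [q] pointed to the past, Cauchy-Schwarz on the spatial parts would make the product
    nonnegative. This is the only source of time orientation, both for the dual vector and for
    Lorentz maps. *)
Lemma null_future (p q : R14) : minkowski p p = 0 -> minkowski q q = 0 ->
  0 < p.1 -> minkowski p q < 0 -> 0 < q.1.
Proof.
move=> pp qq p1; rewrite ltNge => /negP pq; rewrite ltNge; apply/negP => q1; apply: pq.
rewrite /minkowski in pp qq *.
have P : dot p.2 p.2 = p.1 * p.1 by apply/eqP; rewrite -subr_eq0 addrC pp.
have Q : dot q.2 q.2 = q.1 * q.1 by apply/eqP; rewrite -subr_eq0 addrC qq.
have := dot_CauchySchwarz p.2 q.2; rewrite P Q => CS.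
have B : 0 <= - (p.1 * q.1) by rewrite oppr_ge0 mulr_ge0_le0 // ltW.
have : `|dot p.2 q.2| <= - (p.1 * q.1).
  rewrite -(ler_pXn2r (n := 2)) ?nnegrE // real_normK ?num_real //.
  by apply: le_trans CS _; rewrite sqrrN expr2 mulrACA.
by rewrite ler_norml opprK => /andP[H _]; lra.
Qed.

(** Normalizing the product with (1, x) to -1 forces the time component of [z] to be 1 / (1 - x .
    x'), where x' is the normalized spatial part. Hence [y_star] gives back the dual lift. *)
Lemma normalize_null (x : R4) (z : R14) : z.1 != 0 -> minkowski z (1, x) = -1 ->
  (1 - dot x (z.1^-1 *: z.2))^-1 *: ((1, z.1^-1 *: z.2) : R14) = z.
Proof.
case: z => [t z] /= t0; rewrite /minkowski /= mulr1 dotZr (dotC x) => H.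
have -> : 1 - t^-1 * dot z x = t^-1.
  have -> : dot z x = t - 1 by lra.
  by field.
rewrite invrK; congr (_, _); first by rewrite /GRing.scale /= mulr1.
by rewrite /= scalerA mulfV // scale1r.
Qed.

Lemma jacobian_mul_tr (x : pt -> R4) u : differentiable x u ->
  jacobian x u *m (jacobian x u)^T = fstFF x u.
Proof.
move=> dx; apply/matrixP => i j; rewrite mxE [RHS]mxE; apply: eq_bigr => k _.
have E l : jacobian x u l k = pd l x u 0 k.
  by rewrite /pd deriveEjacobian // -rowE [RHS]mxE.
by rewrite [X in _ * X]mxE !E.
Qed.

(** The rows of the Jacobian are the partial derivatives, so the first fundamental form is their
    Gram matrix; a vector in its kernel gives a combination of the rows of zero length. *)
Lemma row_free_jacobian (x : pt -> R4) u : differentiable x u ->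
  row_free (jacobian x u) = (fstFF x u \in unitmx).
Proof.
move=> dx; apply/idP/idP => [free|U].
  rewrite -row_free_unit -kermx_eq0; apply/eqP/row_matrixP => i.
  rewrite row0; set v := row i _.
  have v0 : v *m fstFF x u = 0 by apply/sub_kermxP; exact: row_sub.
  have /dot_eq0 : dot (v *m jacobian x u) (v *m jacobian x u) = 0.
    by rewrite dotE trmx_mul mulmxA -[v *m _ *m _]mulmxA jacobian_mul_tr // v0 mul0mx mxE.
  have /row_freeP[B JB] := free.
  by move=> /(congr1 (mulmx^~ B)); rewrite -mulmxA JB mulmx1 mul0mx.
apply/row_freeP; exists ((jacobian x u)^T *m invmx (fstFF x u)).
by rewrite mulmxA jacobian_mul_tr // mulmxV.
Qed.

Lemma pd_ln (lam : pt -> R) u i : differentiable lam u -> 0 < lam u ->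
  pd i (fun v => ln (lam v)) u = pd i lam u / lam u.
Proof.
move=> dl l0.
have dln1 : derivable (@ln R) (lam u) 1 by have [] := is_derive1_ln l0.
have dln : differentiable (@ln R) (lam u) by apply/derivable1_diffP.
rewrite /pd deriveE; last exact: (@differentiable_comp _ _ _ _ lam (@ln R)).
rewrite (@diff_comp _ _ _ _ lam (@ln R) _ dl dln) [LHS]/= deriveE //.
rewrite (deriv1E dln1) derive1E.
by have [_ ->] := is_derive1_ln l0.
Qed.

(** [dual_lift] is a choice from a set, so its value is known once the set is shown to be a
    singleton. The factor [c] undoes the weights: the frame starts with c y, hence its second vector
    is y* / c. *)
Lemma dual_liftE (x n : pt -> R4) u (f : 'I_5 -> R14) (c m : R) : 0 < c -> m != 0 ->
  adapted f m -> f (o 0) = c *: y_lift x u -> f (o 2) = conformal_gauss x n u ->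
  f (o 3) = pd 0 (conformal_gauss x n) u -> f (o 4) = pd 1 (conformal_gauss x n) u ->
  dual_lift x n u = c *: f (o 1) /\ y_star x n u = c *: f (o 1).
Proof.
move=> c0 m0 fm f0 f2 f3 f4.
have cn0 : c != 0 by rewrite gt_eqF.
have yE : y_lift x u = c^-1 *: f (o 0) by rewrite f0 scalerA mulVf // scale1r.
have zy : minkowski (c *: f (o 1)) (y_lift x u) = -1.
  by rewrite yE !minkE fm mxE /= mulrA mulfV // mul1r.
have zz : minkowski (c *: f (o 1)) (c *: f (o 1)) = 0.
  by rewrite !minkE fm mxE /= !mulr0.
(* The Gram matrix is blind to time orientation; the dual vector points to the future because its
   product with the future vector (1, x) is negative. *)
have z1 : 0 < (c *: f (o 1)).1.
  apply: (@null_future (y_lift x u)) => //; last by rewrite minkC zy oppr_lt0.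
  by rewrite yE !minkE fm mxE /= !mulr0.
have DE : dual_lift x n u = c *: f (o 1).
  rewrite /dual_lift; case: xgetP => [z zE [[z0 zp] zY zX zi]|/(_ (c *: f (o 1)))[]].
    suff <- : c^-1 *: z = f (o 1) by rewrite scalerA mulfV // scale1r.
    apply: (adapted_dual_unique m0 fm); rewrite !minkE.
    - by rewrite z0 !mulr0.
    - by rewrite f0 minkE zY mulrA mulVf // mul1r.
    - by rewrite f2 zX mulr0.
    - by rewrite f3 zi mulr0.
    - by rewrite f4 zi mulr0.
  split=> //; first by rewrite -f2 !minkE fm mxE /= mulr0.
  by apply: ord2P; [rewrite -f3|rewrite -f4]; rewrite !minkE fm mxE /= mulr0.
split=> //; rewrite /y_star /conformal_transform DE; apply: normalize_null => //.
by rewrite gt_eqF.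
Qed.

End SphereGeometry.

Section ScaleRule.
Context {R : realType}.
Local Notation pt := 'rV[R]_2.
Local Notation R4 := 'rV[R]_4.
Local Notation R14 := (R * 'rV[R]_4)%type.

Lemma pd_scale4 (c : pt -> R) (g : pt -> R4) u i : differentiable c u ->
  differentiable g u -> differentiable (fun v => c v *: g v) u /\
  pd i (fun v => c v *: g v) u = pd i c u *: g u + c u *: pd i g u.
Proof.
move=> dc dg; have dgk := (differentiable_mxP g u).1 dg.
have E1 a b : (fun v => (c v *: g v) a b) = (fun v => c v * g v a b).
  by apply/funext => v; rewrite mxE.
have dcg : differentiable (fun v => c v *: g v) u.
  by apply/differentiable_mxP => a b; rewrite E1; exact: differentiableM.
split=> //; apply/matrixP => a b.
by rewrite (pd_mx _ _ _ dcg) E1 (pdM _ dc (dgk _ _)) !mxE (pd_mx _ _ _ dg).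
Qed.

Lemma pd_scale14 (c : pt -> R) (g : pt -> R14) u i : differentiable c u ->
  differentiable g u -> differentiable (fun v => c v *: g v) u /\
  pd i (fun v => c v *: g v) u = pd i c u *: g u + c u *: pd i g u.
Proof.
move=> dc dg; have [dg1 dg2] := (differentiable_fst dg, differentiable_snd dg).
have E1 : (fun v => c v *: g v) = (fun v => (c v * (g v).1, c v *: (g v).2)) by [].
have [d2 e2] := pd_scale4 i dc dg2; have d1 := differentiableM dc dg1.
rewrite E1; split; first exact: (differentiable_pair d1 d2).
by rewrite (pd_pair _ d1 d2) (pdM _ dc dg1) e2 [RHS]surjective_pairing /= -pd_fst // -pd_snd.
Qed.

Lemma solve_derivative (V : lmodType R) (v Y A B : V) (l li c a b m : R) : l != 0 -> m != 0 ->
  li *: (l^-1 *: Y) + l *: v = - c *: Y - (a / m) *: A - (b / m) *: B ->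
  v = (l^-1 * (- c - li / l)) *: Y - (a / (m * l)) *: A - (b / (m * l)) *: B.
Proof.
move=> l0 m0 /(canRL (addKr _)) H.
have -> : v = l^-1 *: (l *: v) by rewrite scalerA mulVf // scale1r.
rewrite H !scalerDr !scalerN !scalerA !addrA -scaleNr -scalerDl.
congr (_ *: _ - _ *: _ - _ *: _); by field; rewrite ?l0 ?m0.
Qed.

End ScaleRule.

(** * The surface read off a frame *)

Section SurfaceOfFrame.
Context {R : realType}.
Local Notation pt := 'rV[R]_2.
Local Notation R4 := 'rV[R]_4.
Local Notation R14 := (R * 'rV[R]_4)%type.
Local Notation o k := (@Ordinal 5 k isT).
Variables (U : set pt) (p0 : pt) (f : 'I_5 -> pt -> R14).
Variables (Om : pt -> 'M[R]_2) (m E : pt -> R) (w : pt -> 'rV[R]_2) (Oms : pt -> 'M[R]_2).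
Hypothesis U_open : open U.
Hypothesis df : forall k u, U u -> differentiable (f k) u.
Hypothesis sf1 : forall k, smooth U (fun u => (f k u).1).
Hypothesis sf2 : forall k, smooth U (fun u => (f k u).2).
Hypothesis f_adapted : forall u, U u -> adapted (f^~ u) (m u).
Hypothesis pdY : forall u i, U u -> pd i (f (o 0)) u = - w u 0 i *: f (o 0) u
  - (Om u i 0 / m u) *: f (o 3) u - (Om u i 1 / m u) *: f (o 4) u.
Hypothesis pdYs : forall u i, U u -> pd i (f (o 1)) u = w u 0 i *: f (o 1) u
  - (Oms u i 0 / m u) *: f (o 3) u - (Oms u i 1 / m u) *: f (o 4) u.
Hypothesis pdX0 : forall u, U u -> pd 0 (f (o 2)) u = f (o 3) u.
Hypothesis pdX1 : forall u, U u -> pd 1 (f (o 2)) u = f (o 4) u.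
Hypothesis m_gt0 : forall u, U u -> 0 < m u.
Hypothesis E_gt0 : forall u, U u -> 0 < E u.
Hypothesis Om10 : forall u, U u -> Om u 1 0 = Om u 0 1.
Hypothesis Om11 : forall u, U u -> Om u 1 1 = - Om u 0 0.
Hypothesis Om_norm : forall u, U u -> Om u 0 0 ^+ 2 + Om u 0 1 ^+ 2 = m u * E u.
Hypothesis Oms10 : forall u, U u -> Oms u 1 0 = Oms u 0 1.

Definition lam_of u := (f (o 0) u).1.
(** The time component of xi = H (1, x) + (0, n), hence a candidate for the mean curvature. *)
Definition h_of u := (f (o 2) u).1.
Definition x_of u : R4 := (lam_of u)^-1 *: (f (o 0) u).2.
Definition n_of u : R4 := (f (o 2) u).2 - h_of u *: x_of u.
Local Notation lam := lam_of.
Local Notation hX := h_of.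
Local Notation x := x_of.
Local Notation n := n_of.
Local Notation y := (fun u => (1, x u) : R14).
Local Notation nn := (fun u => (0, n u) : R14).

Hypothesis lam_gt0 : forall u, U u -> 0 < lam u.
Hypothesis lam_p0 : lam p0 = 1.

Let lam0 u : U u -> lam u != 0. Proof. by move=> /lam_gt0; rewrite lt0r => /andP[]. Qed.
Let mu0 u : U u -> m u != 0. Proof. by move=> /m_gt0; rewrite lt0r => /andP[]. Qed.

Lemma smooth_scale4 (c : pt -> R) (g : pt -> R4) : smooth U c -> smooth U g ->
  smooth U (fun u => c u *: g u).
Proof.
move=> sc sg k; apply/Ck_mxP => // i j.
apply: (Ck_ext U_open _ (CkM U_open (sc k) ((Ck_mxP k g U_open).1 (sg k) i j))) => v _.
by rewrite mxE.
Qed.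

Lemma x_smooth : smooth U x.
Proof.
apply: smooth_scale4; last exact: sf2.
by move=> k; apply: CkV => //; exact: sf1.
Qed.

Lemma n_smooth : smooth U n.
Proof.
have sx := smooth_scale4 (sf1 (o 2)) x_smooth.
move=> k; apply: (Ck_ext U_open _ (CkD U_open (sf2 (o 2) k) (CkZ (-1) U_open (sx k)))) => v _.
by rewrite scaleN1r.
Qed.

Lemma Y_lam u : U u -> f (o 0) u = lam u *: (1, x u).
Proof.
move=> Uu; rewrite /x /= [LHS]surjective_pairing; congr (_, _).
  by rewrite /GRing.scale /= mulr1.
by rewrite /= scalerA mulfV ?lam0 // scale1r.
Qed.

Lemma X_split u : f (o 2) u = hX u *: (1, x u) + (0, n u).
Proof.
rewrite [LHS]surjective_pairing; congr (_, _) => /=.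
  by rewrite addr0 /GRing.scale /= mulr1.
by rewrite /n addrC subrK.
Qed.

Let dlam u : U u -> differentiable lam u.
Proof. by move=> Uu; exact: smooth_diff (sf1 (o 0)) Uu. Qed.
Let dh u : U u -> differentiable hX u.
Proof. by move=> Uu; exact: smooth_diff (sf1 (o 2)) Uu. Qed.
Let dx u : U u -> differentiable x u.
Proof. by move=> Uu; exact: smooth_diff x_smooth Uu. Qed.
Let dn u : U u -> differentiable n u.
Proof. by move=> Uu; exact: smooth_diff n_smooth Uu. Qed.

Lemma pd_y u i : U u -> pd i y u = (0, pd i x u).
Proof.
by move=> Uu; rewrite (pd_pair _ (differentiable_cst _ _) (dx Uu)) pd_cst.
Qed.

Lemma pd_nn u i : U u -> pd i nn u = (0, pd i n u).
Proof.
by move=> Uu; rewrite (pd_pair _ (differentiable_cst _ _) (dn Uu)) pd_cst.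
Qed.

Let dy u : U u -> differentiable y u.
Proof. by move=> Uu; exact: differentiable_pair (differentiable_cst _ _) (dx Uu). Qed.
Let dnn u : U u -> differentiable nn u.
Proof. by move=> Uu; exact: differentiable_pair (differentiable_cst _ _) (dn Uu). Qed.

(** The first coefficient stays unnamed: the first frame vector is orthogonal to itself, to xi and
    to xi_1, xi_2, so it contributes to none of the products taken below. *)
Lemma pd_y_frame u i : U u -> exists c, pd i y u = c *: f (o 0) u
  - (Om u i 0 / (m u * lam u)) *: f (o 3) u - (Om u i 1 / (m u * lam u)) *: f (o 4) u.
Proof.
move=> Uu; have [_ E1] := pd_scale14 i (dlam Uu) (dy Uu).
have := pdY i Uu; rewrite (pd_near _ U_open Uu Y_lam) E1 => E2.
have l0 := lam0 Uu; have m0 := mu0 Uu.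
have yE : y u = (lam u)^-1 *: f (o 0) u by rewrite Y_lam // scalerA mulVf // scale1r.
exists ((lam u)^-1 * (- w u 0 i - pd i lam u / lam u)).
by apply: solve_derivative => //; rewrite -yE.
Qed.

Lemma fm u i j : U u -> minkowski (f i u) (f j u) = gram (m u) i j.
Proof. by move=> Uu; exact: f_adapted. Qed.

Lemma pd_y_products u i : U u ->
  [/\ minkowski (pd i y u) (f (o 0) u) = 0, minkowski (pd i y u) (f (o 2) u) = 0,
      minkowski (pd i y u) (f (o 3) u) = - (Om u i 0 / lam u) &
      minkowski (pd i y u) (f (o 4) u) = - (Om u i 1 / lam u)].
Proof.
move=> Uu; have [c ->] := pd_y_frame i Uu; have l0 := lam0 Uu; have m0 := mu0 Uu.
rewrite !minkE !fm // !mxE /=; move: (Om u i 0) (Om u i 1) (m u) (lam u) m0 l0 => a b c' d c0 d0.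
by split; field; rewrite ?c0 ?d0.
Qed.

(** Conformality of [x] holds because a traceless symmetric matrix of size 2 squares to a scalar,
    here m E. *)
Lemma fstFF_frame u : U u -> fstFF x u = (E u / lam u ^+ 2)%:M.
Proof.
move=> Uu; apply/matrixP => i j; have l0 := lam0 Uu; have m0 := mu0 Uu.
have -> : fstFF x u i j = minkowski (pd i y u) (pd j y u).
  by rewrite mxE !pd_y // /minkowski /= mulr0 oppr0 add0r.
have [c ->] := pd_y_frame j Uu; rewrite !minkE.
have [-> _ -> ->] := pd_y_products i Uu.
have -> : E u = (Om u 0 0 ^+ 2 + Om u 0 1 ^+ 2) / m u.
  by rewrite Om_norm // mulrAC mulfV // mul1r.
rewrite mxE; move: j i; apply: ord2P; apply: ord2P;
rewrite ?Om10 ?Om11 //= ?mulr1n ?mulr0n;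
move: (Om u 0 0) (Om u 0 1) (m u) (lam u) m0 l0 => a b c' d c0 d0; by field; rewrite ?c0 ?d0.
Qed.

(** The product of a derivative of (1, x) with a derivative of xi is evaluated twice: through xi = H
    (1, x) + (0, n), which brings in both fundamental forms, and through the frame, which brings in
    Omega. *)
Lemma sndFF_frame u : U u -> sndFF x n u = hX u *: fstFF x u + (lam u)^-1 *: Om u.
Proof.
move=> Uu; apply/matrixP => i j.
have E2 : pd j (f (o 2)) u = pd j hX u *: y u + hX u *: pd j y u + pd j nn u.
  have [d1 e1] := pd_scale14 j (dh Uu) (dy Uu).
  rewrite (pd_near _ U_open Uu (fun v _ => X_split v)).
  rewrite /pd (@deriveD _ _ _ (fun v => hX v *: y v) nn).
  - by rewrite -/(pd j _ u) e1.
  - exact: diff_derivable.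
  - by apply: diff_derivable; exact: dnn.
have Y0 : minkowski (pd i y u) (y u) = 0.
  have [H _ _ _] := pd_y_products i Uu; move: H; rewrite Y_lam // minkE => /eqP.
  by rewrite mulf_eq0 (negbTE (lam0 Uu)) => /eqP.
have E3 : minkowski (pd i y u) (pd j (f (o 2)) u) =
    hX u * fstFF x u i j + dot (pd i x u) (pd j n u).
  rewrite E2 !minkE Y0 mulr0 add0r pd_nn // pd_y // pd_y // /minkowski /= mxE.
  by rewrite !mul0r !oppr0 !add0r.
have E4 : minkowski (pd i y u) (pd j (f (o 2)) u) = - (Om u i j / lam u).
  have [_ _ H3 H4] := pd_y_products i Uu.
  by move: j {E2 E3}; apply: ord2P; rewrite ?pdX0 ?pdX1.
rewrite mxE [RHS]mxE [X in _ = X + _]mxE [X in _ = _ + X]mxE.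
move: E4; rewrite E3; move: (fstFF x u i j) (dot _ _) (Om u i j) (lam u)^-1 (hX u) => a b c d e H.
lra.
Qed.

Lemma meanH_frame u : U u -> meanH x n u = hX u.
Proof.
move=> Uu; have l0 := lam0 Uu; have e0 : E u != 0 by have := E_gt0 Uu; rewrite lt0r => /andP[].
rewrite /meanH sndFF_frame // fstFF_frame // invmx_scalar mul_scalar_mx.
rewrite linearZ /= raddfD /= !linearZ /= mxtrace_scalar /mxtrace sum2 Om11 //.
rewrite subrr mulr0 addr0.
by move: (E u) (lam u) (hX u) e0 l0 => a b c a0 b0; rewrite mulr2n; field; rewrite a0 b0.
Qed.

Lemma sndFF0_frame u : U u -> sndFF0 x n u = (lam u)^-1 *: Om u.
Proof. by move=> Uu; rewrite /sndFF0 sndFF_frame // meanH_frame // addrC addKr. Qed.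

Lemma conformal_gauss_frame u : U u -> conformal_gauss x n u = f (o 2) u.
Proof. by move=> Uu; rewrite /conformal_gauss meanH_frame // -X_split. Qed.

Lemma pd_conformal_gauss u : U u -> pd 0 (conformal_gauss x n) u = f (o 3) u /\
  pd 1 (conformal_gauss x n) u = f (o 4) u.
Proof.
by move=> Uu; split; rewrite (pd_near _ U_open Uu conformal_gauss_frame) ?pdX0 ?pdX1.
Qed.

Lemma y_star_frame u : U u -> y_star x n u = lam u *: f (o 1) u.
Proof.
move=> Uu; have [g0 g1] := pd_conformal_gauss Uu.
have [_ ->] // := @dual_liftE _ x n u (f^~ u) (lam u) (m u) (lam_gt0 Uu) (mu0 Uu) (f_adapted Uu)
  (Y_lam Uu) (esym (conformal_gauss_frame Uu)) (esym g0) (esym g1).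
Qed.

Lemma nnE u : (0, n u) = f (o 2) u - hX u *: (1, x u) :> R14.
Proof. by rewrite X_split addrAC subrr add0r. Qed.

Lemma minkY u k : U u -> minkowski (1, x u) (f k u) = (lam u)^-1 * gram (m u) (o 0) k.
Proof.
move=> Uu; rewrite -(fm (o 0) k Uu) Y_lam // minkZl mulrA mulVf ?lam0 // mul1r //.
Qed.

Lemma minkyy u : U u -> minkowski (1, x u) (1, x u) = 0.
Proof.
move=> Uu; apply: (mulfI (lam0 Uu)); rewrite -minkZr -Y_lam // minkY //.
by rewrite mxE /= !mulr0.
Qed.

Lemma immersed_surface_frame : immersed_surface U x n.
Proof.
have yX u : U u -> minkowski (1, x u) (f (o 2) u) = 0.
  by move=> Uu; rewrite minkY // mxE /= mulr0.
have nnM u (p : R14) : minkowski (0, n u) p = dot (n u) p.2.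
  by rewrite /minkowski /= mul0r oppr0 add0r.
split.
- exact: x_smooth.
- by move=> u Uu; apply/eqP; rewrite -subr_eq0 addrC -(minkyy Uu) /minkowski /= mulr1.
- move=> u Uu; rewrite (row_free_jacobian (dx Uu)) fstFF_frame //.
  rewrite unitmxE det_scalar unitrX // unitfE mulf_neq0 ?invr_eq0 ?expf_neq0 ?lam0 //.
  by rewrite gt_eqF // E_gt0.
- exact: n_smooth.
- move=> u Uu; rewrite -(nnM u (0, n u)) nnE !minkE (minkC _ (1, x u)) yX // minkyy //.
  by rewrite fm // mxE /=; ring.
- move=> u Uu; rewrite -(nnM u (1, x u)) nnE !minkE (minkC _ (1, x u)) yX // minkyy //.
  by rewrite mulr0 subr0.
move=> u Uu i; have [H0 H2 _ _] := pd_y_products i Uu.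
rewrite -(nnM u (0, pd i x u)) -(pd_y _ Uu) nnE !minkE minkC H2.
have -> : minkowski (1, x u) (pd i y u) = 0; last by rewrite mulr0 subr0.
by apply: (mulfI (lam0 Uu)); rewrite -minkZl -Y_lam // minkC H0 mulr0.
Qed.

Lemma realizes_frame : realizes p0 Om m w Oms U x n lam.
Proof.
split.
- exact: immersed_surface_frame.
- move=> u Uu; rewrite /umbilical sndFF0_frame // => H.
  have O0 : Om u = 0.
    by rewrite -[Om u]scale1r -(mulfV (lam0 Uu)) -scalerA H scaler0.
  have := Om_norm Uu; rewrite O0 !mxE expr0n /= addr0 => /esym/eqP.
  by rewrite mulf_eq0 !gt_eqF ?m_gt0 ?E_gt0.
- exact: sf1.
- exact: lam_gt0.
- exact: lam_p0.
- by move=> u Uu; rewrite sndFF0_frame // scalerA mulfV ?lam0 // scale1r.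
- move=> u Uu; have [g0 g1] := pd_conformal_gauss Uu.
  by apply: ord2P; apply: ord2P; rewrite ?g0 ?g1 fm // !mxE /= ?mulr1n.
- move=> u Uu i.
  have l0 := lam0 Uu; have m0 := mu0 Uu.
  have e0 : E u != 0 by have := E_gt0 Uu; rewrite lt0r => /andP[].
  have invOm : invmx ((lam u)^-1 *: Om u) = (lam u / (m u * E u)) *: Om u.
    have OO : Om u *m Om u = (m u * E u)%:M.
      rewrite -Om_norm //; apply/matrixP; apply: ord2P; apply: ord2P;
      rewrite !mxE sum2 ?Om10 ?Om11 //= ?mulr1n ?mulr0n; ring.
    have P : ((lam u)^-1 *: Om u) *m ((lam u / (m u * E u)) *: Om u) = 1%:M.
      rewrite -scalemxAl -scalemxAr OO scalerA scale_scalar_mx; congr (_%:M).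
      by move: (lam u) (m u) (E u) l0 m0 e0 => a b c a0 b0 c0; field; rewrite a0 b0 c0.
    have /mulmx1_unit[U1 _] := P.
    by rewrite -[RHS]mul1mx -(mulVmx U1) -mulmxA P mulmx1.
  have dHE : dH x n u = \col_k (f (if k == 0 then o 3 else o 4) u).1.
    apply/colP; apply: ord2P; rewrite !mxE /= (pd_near _ U_open Uu meanH_frame) -pd_fst ?pdX0 ?pdX1 //; exact: df.
  (* Condition (c) is the time component of the equation for dY: the time components of Y, xi_1 and
     xi_2 are [lam] and the derivatives of the mean curvature. *)
  have lE : pd i lam u = - w u 0 i * lam u - (Om u i 0 / m u) * (f (o 3) u).1
     - (Om u i 1 / m u) * (f (o 4) u).1.
    by rewrite -pd_fst ?pdY //; exact: df.
  rewrite sndFF0_frame // fstFF_frame // invOm dHE (pd_ln _ (dlam Uu) (lam_gt0 Uu)) lE.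
  rewrite mul_scalar_mx !mxE sum2 !mxE /=.
  move: (lam u) (m u) (E u) (w u 0 i) (Om u i 0) (Om u i 1) (f (o 3) u).1 (f (o 4) u).1 l0 m0 e0.
  by move=> a b c d e g h k a0 b0 c0; field; rewrite ?a0 ?b0 ?c0.
move=> u Uu i j.
have l0 := lam0 Uu; have m0 := mu0 Uu.
have [g0 g1] := pd_conformal_gauss Uu.
(* With y* equal to lam times the second frame vector, the term in d lam points along that vector,
   which is orthogonal to xi_1 and xi_2. *)
rewrite (pd_near j U_open Uu y_star_frame).
have [_ ->] := pd_scale14 j (dlam Uu) (df (o 1) Uu).
rewrite pdYs // !minkE.
move: i j; apply: ord2P => j; rewrite ?g0 ?g1 !fm // !mxE /=; move: j; apply: ord2P;
rewrite ?Oms10 //; move: (pd _ lam u) (lam u) (m u) (Oms u 0 0) (Oms u 0 1) (Oms u 1 1) (w u 0 0) (w u 0 1) l0 m0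
  => a b c d e g h k b0 c0; by field; rewrite ?b0 ?c0.
Qed.

End SurfaceOfFrame.

Section Existence.
Context {R : realType}.
Local Notation pt := 'rV[R]_2.
Local Notation R4 := 'rV[R]_4.
Local Notation R14 := (R * 'rV[R]_4)%type.
Local Notation o k := (@Ordinal 5 k isT).

Lemma ball_connected (p0 : pt) (r : R) : 0 < r -> connected [set u | `|u - p0| < r].
Proof.
move=> r0; pose I (v : pt) := (fun s : R => p0 + s *: v) @` `[0, 1].
have -> : [set u | `|u - p0| < r] = \bigcup_(v in [set v | `|v| < r]) I v.
  apply/seteqP; split=> u /=.
    move=> ur; exists (u - p0) => //; exists 1; rewrite /= ?in_itv /= ?ler01 ?lexx //.
    by rewrite scale1r addrC subrK.
  move=> [v /= vr [s]]; rewrite /= in_itv /= => /andP[s0 s1] <-.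
  rewrite addrC addKr normrZ ger0_norm //; apply: le_lt_trans vr.
  by rewrite ler_piMl.
apply: bigcup_connected.
  exists p0 => v _; exists 0; rewrite /= ?in_itv /= ?ler01 ?lexx //.
  by rewrite scale0r addr0.
move=> v _; apply: connected_continuous_connected; first exact: segment_connected.
apply: continuous_subspaceT => s.
by apply: cvgD; [exact: cvg_cst|exact: scalel_continuous].
Qed.

(** The first vector has time component 1, which will give lam p0 = 1. The second is half of the
    antipodal future null vector, the factor making their product -1. The number [c] will be the
    square root of [m p0]. *)
Definition initial_frame (c : R) (i : 'I_5) : R14 := nth 0
  [:: (1, delta_mx 0 0); (2^-1, - 2^-1 *: delta_mx 0 0); (0, delta_mx 0 1);
      (0, c *: delta_mx 0 2%:R); (0, c *: delta_mx 0 3%:R)] i.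

Lemma dot_delta (i j : 'I_4) : dot (delta_mx 0 i) (delta_mx 0 j : R4) = (i == j)%:R.
Proof.
by rewrite dotE trmx_delta mul_delta_mx_cond; case: eqP => _; rewrite ?mulr1n ?mulr0n !mxE.
Qed.

Lemma initial_adapted (c : R) : adapted (initial_frame c) (c ^+ 2).
Proof.
move=> i j; rewrite /gram mxE /initial_frame /minkowski; move: i j; apply: ord5P; apply: ord5P;
  rewrite /= ?(dotZl, dotZr, dotNl, dotNr) !dot_delta /= ?mulr1 ?mulr0; by field.
Qed.

Lemma smooth_unvec (U : set pt) (F : pt -> 'M[R]_5) i : open U -> smooth U F ->
  smooth U (fun u => (unvec (row i (F u))).1) /\ smooth U (fun u => (unvec (row i (F u))).2).
Proof.
move=> oU sF; split=> k.
  apply: (Ck_ext oU _ ((Ck_mxP k F oU).1 (sF k) i (lshift 4 (0 : 'I_1)))) => v _.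
  by rewrite /unvec /= !mxE.
apply/(Ck_mxP k _ oU) => a b; rewrite ord1.
apply: (Ck_ext oU _ ((Ck_mxP k F oU).1 (sF k) i (rshift 1 b : 'I_5))) => v _.
by rewrite /unvec /= !mxE.
Qed.

Lemma movmx_flow (f : 'I_5 -> pt -> R14) (A : 'M[R]_5) k u :
  (forall i, differentiable (f i) u) ->
  pd k (movmx f) u = A *m movmx f u <->
  forall i, pd k (f i) u = \sum_(l < 5) A i l *: f l u.
Proof.
move=> df; rewrite pd_movmx // mul_framemx; split=> [/framemx_inj//|H].
by congr framemx; apply/funext.
Qed.

Lemma exists_surface (D : set pt)
  (Om : pt -> 'M[R]_2) (m E : pt -> R) (w : pt -> 'rV[R]_2) (Oms : pt -> 'M[R]_2)
  (D_open : open D)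
  (Om_smooth : smooth D Om) (m_smooth : smooth D m)
  (w_smooth : smooth D w) (Oms_smooth : smooth D Oms)
  (m_gt0 : forall u, D u -> 0 < m u)
  (E_gt0 : forall u, D u -> 0 < E u)
  (Om10 : forall u, D u -> Om u 1 0 = Om u 0 1)
  (Om11 : forall u, D u -> Om u 1 1 = - Om u 0 0)
  (Om_norm : forall u, D u -> Om u 0 0 ^+ 2 + Om u 0 1 ^+ 2 = m u * E u)
  (Oms10 : forall u, D u -> Oms u 1 0 = Oms u 0 1)
  (fl : forall u, D u -> flat (structure0 Om m w Oms) (structure1 Om m w Oms) u)
  (p0 : pt) (p0D : D p0) :
  exists (D0 : set pt) (x n : pt -> R4) (lam : pt -> R),
     [/\ open D0, connected D0, D0 p0, D0 `<=` D & realizes p0 Om m w Oms D0 x n lam].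
Proof.
have m_neq0 u : D u -> m u != 0 by move=> /m_gt0; rewrite lt0r => /andP[].
pose c := Num.sqrt (m p0).
have c2 : c ^+ 2 = m p0 by rewrite sqr_sqrtr // ltW // m_gt0.
have [r [F [rp rD F0 sF dF]]] := frobenius (framemx (initial_frame c)) D_open p0D
  (smooth_structure0 D_open Om_smooth m_smooth w_smooth Oms_smooth m_neq0)
  (smooth_structure1 D_open Om_smooth m_smooth w_smooth Oms_smooth m_neq0) fl.
pose B := [set u : pt | `|u - p0| < r].
have oB : open B := @ball_norm_open R p0 r.
have Bp0 : B p0 by rewrite /B /= subrr normr0.
have G0 : F p0 *m Jmx *m (F p0)^T = gram (m p0).
  by rewrite F0 -c2; apply/adaptedP; exact: initial_adapted.
have gr := @gram_propagation _ Om m w Oms D D_open Om_smooth m_smooth w_smooth Oms_smooth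
  m_neq0 B p0 F oB (ball_connected rp) Bp0 rD dF G0.
pose f k u := unvec (row k (F u)).
have s1 k : smooth B (fun u => (f k u).1) by have [] := smooth_unvec k oB sF.
have s2 k : smooth B (fun u => (f k u).2) by have [] := smooth_unvec k oB sF.
have df k u : B u -> differentiable (f k) u.
  by move=> Bu; apply: differentiable_unvec; have [] := dF u Bu.
have mF : movmx f = F := movmx_unvec F.
have lam1 : (f (o 0) p0).1 = 1.
  by rewrite /f F0 row_framemx vecK.
(* The time component of Y equals 1 at [p0], so it stays positive on a smaller ball, where division
   by it defines [x]. *)
have [r1 r1p r1P] : exists2 r1 : R, 0 < r1 & forall u, `|u - p0| < r1 -> B u /\ 0 < (f (o 0) u).1.
  have cl : {for p0, continuous (fun u => (f (o 0) u).1)}.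
    by apply: differentiable_continuous; exact: smooth_diff (s1 _) Bp0.
  have nl : \forall u \near p0, 0 < (f (o 0) u).1.
    have := cl; move=> /cvgr_gt; apply; rewrite lam1; exact: ltr01.
  have nB : nbhs p0 B by exact: open_nbhs_nbhs.
  have /nbhs_normP[r1 /= r1p H] : \forall u \near p0, B u /\ 0 < (f (o 0) u).1.
    exact: filterI nB nl.
  by exists r1 => // u ur; apply: H; rewrite /= distrC.
pose U := [set u : pt | `|u - p0| < r1].
have UB u : U u -> B u by move=> /r1P[].
have UD u : U u -> D u by move=> /UB; exact: rD.
exists U, (x_of f), (n_of f), (lam_of f); split=> //.
- exact: ball_norm_open.
- exact: (ball_connected r1p).
- by rewrite /U /= subrr normr0.
have row_flow u : U u -> (forall i, pd 0 (f i) u = \sum_(l < 5) structure0 Om m w Oms u i l *: f l u) /\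
    (forall i, pd 1 (f i) u = \sum_(l < 5) structure1 Om m w Oms u i l *: f l u).
  move=> Uu; have dfu i := df i u (UB _ Uu); have [_ dFu] := dF _ (UB _ Uu).
  have [p0F p1F] := pd_conn dFu.
  by split; apply/movmx_flow => //; rewrite mF.
apply: (@realizes_frame _ U p0 f Om m E w Oms).
- exact: ball_norm_open.
- by move=> k u /UB; exact: df.
- by move=> k j; apply: Ck_sub (s1 k j) => u; exact: UB.
- by move=> k j; apply: Ck_sub (s2 k j) => u; exact: UB.
- move=> u Uu; apply/adaptedP; rewrite -(gr _ (UB _ Uu)).
  by have -> : framemx (f^~ u) = F u by rewrite -mF.
- move=> u i Uu; have [H0 H1] := row_flow _ Uu; have Du := UD _ Uu.
  move: i; apply: ord2P; rewrite ?H0 ?H1 sum5Z !mxE /= !scale0r !addr0 ?Om10 // ?Om11 //;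
    by rewrite ?scaleNr // mulNr scaleNr opprK.
- move=> u i Uu; have [H0 H1] := row_flow _ Uu; have Du := UD _ Uu.
  move: i; apply: ord2P; rewrite ?H0 ?H1 sum5Z !mxE /= !scale0r !addr0 add0r ?Oms10 //;
    by rewrite ?scaleNr.
- move=> u Uu; have [H0 _] := row_flow _ Uu.
  by rewrite H0 sum5Z !mxE /= !scale0r !addr0 !add0r scale1r.
- move=> u Uu; have [_ H1] := row_flow _ Uu.
  by rewrite H1 sum5Z !mxE /= !scale0r !add0r scale1r.
- by move=> u /UD; exact: m_gt0.
- by move=> u /UD; exact: E_gt0.
- by move=> u /UD; exact: Om10.
- by move=> u /UD; exact: Om11.
- by move=> u /UD; exact: Om_norm.
- by move=> u /UD; exact: Oms10.
- by move=> u /r1P[].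
- exact: lam1.
Qed.

End Existence.

(** * The frame of a surface *)

Lemma pdDW (R : realType) (W : normedModType R) (f g : 'rV[R]_2 -> W) u i :
  differentiable f u -> differentiable g u ->
  pd i (fun v => f v + g v) u = pd i f u + pd i g u.
Proof. by move=> df dg; rewrite /pd (@deriveD _ _ _ f g) //; exact: diff_derivable. Qed.

Section SmoothMinkowskiMaps.
Context {R : realType}.
Local Notation pt := 'rV[R]_2.
Local Notation R14 := (R * 'rV[R]_4)%type.
Variable (U : set pt).
Hypothesis U_open : open U.

Definition smooth14 (f : pt -> R14) := smooth U (fun u => (f u).1) /\ smooth U (fun u => (f u).2).

Lemma smooth14_diff f u : smooth14 f -> U u -> differentiable f u.
Proof.
move=> [s1 s2] Uu.
have -> : f = (fun v => ((f v).1, (f v).2)) by apply/funext => v; case: (f v).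
exact: differentiable_pair (smooth_diff s1 Uu) (smooth_diff s2 Uu).
Qed.

Lemma smooth14_pd f i : smooth14 f -> smooth14 (pd i f).
Proof.
move=> sf; have [s1 s2] := sf; split=> k.
  apply: (Ck_ext U_open _ (smooth_pd i s1 k)) => v Uv.
  by rewrite pd_fst //; exact: smooth14_diff sf Uv.
apply: (Ck_ext U_open _ (smooth_pd i s2 k)) => v Uv.
by rewrite pd_snd //; exact: smooth14_diff sf Uv.
Qed.

Lemma pd_comm14 f u i j : smooth14 f -> U u -> pd i (pd j f) u = pd j (pd i f) u.
Proof.
move=> sf Uu; have [s1 s2] := sf.
have d a : differentiable (pd a f) u := smooth14_diff (smooth14_pd a sf) Uu.
have F a b : (pd a (pd b f) u).1 = pd a (pd b (fun v => (f v).1)) u.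
  rewrite pd_fst; last exact: d.
  by apply: (pd_near _ U_open Uu) => v Uv; rewrite pd_fst //; exact: smooth14_diff sf Uv.
have S a b k : (pd a (pd b f) u).2 0 k = pd a (pd b (fun v => (f v).2 0 k)) u.
  have db := d b.
  rewrite pd_snd // pd_mx; last exact: differentiable_snd.
  apply: (pd_near _ U_open Uu) => v Uv.
  have dv := smooth14_diff sf Uv.
  by rewrite pd_snd // pd_mx //; exact: differentiable_snd.
have E1 : (pd i (pd j f) u).1 = (pd j (pd i f) u).1.
  exact (etrans (F i j) (etrans (pd_comm i j U_open s1 Uu) (esym (F j i)))).
have E2 : (pd i (pd j f) u).2 = (pd j (pd i f) u).2.
  apply/rowP => k; have s2k : smooth U (fun v => (f v).2 0 k).
    by move=> l; exact: (Ck_mxP l _ U_open).1 (s2 l) 0 k.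
  exact (etrans (S i j k) (etrans (pd_comm i j U_open s2k Uu) (esym (S j i k)))).
by rewrite (surjective_pairing (pd i (pd j f) u)) E1 E2 -surjective_pairing.
Qed.

End SmoothMinkowskiMaps.

Lemma invmx_scaled (R : realType) (O : 'M[R]_2) (l c : R) : l != 0 -> c != 0 -> O *m O = c%:M ->
  invmx (l^-1 *: O) = (l / c) *: O.
Proof.
move=> l0 c0 OO.
have P : (l^-1 *: O) *m ((l / c) *: O) = 1%:M.
  by rewrite -scalemxAl -scalemxAr OO scalerA scale_scalar_mx; congr (_%:M); field; rewrite l0 c0.
have /mulmx1_unit[U1 _] := P.
by rewrite -[RHS]mul1mx -(mulVmx U1) -mulmxA P mulmx1.
Qed.

Section AdaptedVectors.
Context {R : realType}.
Local Notation R14 := (R * 'rV[R]_4)%type.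
Variables (y z X X0 X1 : R14) (h h0 h1 m l : R).
Hypotheses (m0 : m != 0) (l0 : l != 0).
Hypotheses (yy : minkowski y y = 0) (Xy : minkowski X y = 0) (XX : minkowski X X = 1)
  (X0y : minkowski X0 y = 0) (X1y : minkowski X1 y = 0)
  (X0X : minkowski X0 X = 0) (X1X : minkowski X1 X = 0)
  (X00 : minkowski X0 X0 = m) (X01 : minkowski X0 X1 = 0) (X11 : minkowski X1 X1 = m).

Lemma adapted_vectors d : minkowski d y = -1 -> minkowski d X = 0 ->
  minkowski d X0 = 0 -> minkowski d X1 = 0 -> minkowski d d = 0 ->
  adapted (fun k : 'I_5 => nth 0 [:: l *: y; l^-1 *: d; X; X0; X1] k) m.
Proof.
move=> dy dX dX0 dX1 dd; apply: ord5P; apply: ord5P;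
  rewrite mxE /= ?(minkZl, minkZr) ?(minkC _ d) ?(minkC y) ?(minkC X X0) ?(minkC X X1) ?(minkC X1 X0)
    ?dy ?dX ?dX0 ?dX1 ?dd ?yy ?Xy ?XX ?X0y ?X1y ?X0X ?X1X ?X00 ?X01 ?X11 //; by field.
Qed.

Hypotheses (zy : minkowski z y = -1) (zz : minkowski z z = 0) (zX : minkowski z X = - h)
  (zX0 : minkowski z X0 = - h0) (zX1 : minkowski z X1 = - h1).

(** The terms in [X], [X0], [X1] remove the projection of [z] onto their span. This lowers the
    square from 0 to -(h^2 + (h0^2 + h1^2) / m), and since the product with [y] is -1, half of that
    amount along [y] restores nullity. *)
Definition dual_vector : R14 := z + h *: X + (h0 / m) *: X0 + (h1 / m) *: X1
  - (2^-1 * (h ^+ 2 + (h0 ^+ 2 + h1 ^+ 2) / m)) *: y.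

Lemma dual_vector_products : [/\ minkowski dual_vector y = -1,
  minkowski dual_vector X = 0, minkowski dual_vector X0 = 0,
  minkowski dual_vector X1 = 0 & minkowski dual_vector dual_vector = 0].
Proof.
have [e0 e1 e2 e3] : [/\ minkowski dual_vector y = -1, minkowski dual_vector X = 0,
    minkowski dual_vector X0 = 0 & minkowski dual_vector X1 = 0].
  rewrite /dual_vector; split; rewrite !(minkDl, minkZl, minkNl) ?zy ?zX ?zX0 ?zX1
    ?(minkC y) ?(minkC X X0) ?(minkC X X1) ?(minkC X1 X0)
    ?yy ?Xy ?XX ?X0y ?X1y ?X0X ?X1X ?X00 ?X01 ?X11; by field.
(* Only one of the two arguments is unfolded at first, so that the four products just computed can
   be reused. *)
split=> //; rewrite {2}/dual_vector !(minkDr, minkZr, minkNr) e0 e1 e2 e3.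
rewrite (minkC _ z) /dual_vector !(minkDr, minkZr, minkNr) zz zX zX0 zX1 zy.
by field.
Qed.

End AdaptedVectors.

Section DerivativeProducts.
Context {R : realType}.
Local Notation pt := 'rV[R]_2.
Local Notation R14 := (R * 'rV[R]_4)%type.
Local Notation o k := (@Ordinal 5 k isT).

Lemma expand_products (f : 'I_5 -> R14) (c : R) (v : R14) q0 q1 q2 q3 q4 : c != 0 -> adapted f c ->
  minkowski v (f (o 0)) = q0 -> minkowski v (f (o 1)) = q1 -> minkowski v (f (o 2)) = q2 ->
  minkowski v (f (o 3)) = q3 -> minkowski v (f (o 4)) = q4 ->
  v = - q1 *: f (o 0) - q0 *: f (o 1) + q2 *: f (o 2) + (q3 / c) *: f (o 3) + (q4 / c) *: f (o 4).
Proof. by move=> c0 fc <- <- <- <- <-; exact: adapted_expand. Qed.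

Lemma mink_comb3 (v' v p q r : R14) a b c q1 q2 q3 : v = a *: p + b *: q + c *: r ->
  minkowski v' p = q1 -> minkowski v' q = q2 -> minkowski v' r = q3 ->
  minkowski v' v = a * q1 + b * q2 + c * q3.
Proof. by move=> -> <- <- <-; rewrite !minkE. Qed.

Lemma fst_comb3 (v p q r : R14) a b c p1 q1 r1 : v = a *: p + b *: q + c *: r -> v.1 = 0 ->
  p.1 = p1 -> q.1 = q1 -> r.1 = r1 -> a * p1 + b * q1 + c * r1 = 0.
Proof. by move=> -> <- <- <- <-. Qed.

Lemma mink_comb2 (a b : R) (p q r : R14) : minkowski q r = 0 ->
  minkowski (a *: q + b *: p) r = b * minkowski p r.
Proof. by move=> qr; rewrite !minkE qr mulr0 add0r. Qed.

Lemma derivative_products (y v V f1 X X0 X1 : R14) (l l' a b c : R) : l != 0 ->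
  V = l' *: y + l *: v -> minkowski y f1 = - l^-1 -> minkowski y y = 0 ->
  minkowski y X = 0 -> minkowski y X0 = 0 -> minkowski y X1 = 0 -> minkowski v y = 0 ->
  minkowski v X = 0 -> minkowski v X0 = - (a / l) -> minkowski v X1 = - (b / l) ->
  l * minkowski v f1 - l' / l = c ->
  [/\ minkowski V (l *: y) = 0, minkowski V f1 = c, minkowski V X = 0,
      minkowski V X0 = - a & minkowski V X1 = - b].
Proof.
move=> l0 -> yf yy yX y0 y1 vy vX v0 v1 <-.
by split; rewrite !minkE ?yf ?yy ?yX ?y0 ?y1 ?vy ?vX ?v0 ?v1; field.
Qed.

Variables (f : 'I_5 -> pt -> R14) (u : pt) (Om Oms : pt -> 'M[R]_2) (m : pt -> R) (w : pt -> 'rV[R]_2).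
Hypothesis df : forall k, differentiable (f k) u.
Hypothesis m0 : m u != 0.
Hypothesis fm : adapted (f^~ u) (m u).

Definition products_are (v : R14) (q0 q1 q2 q3 q4 : R) :=
  [/\ minkowski v (f (o 0) u) = q0, minkowski v (f (o 1) u) = q1, minkowski v (f (o 2) u) = q2,
      minkowski v (f (o 3) u) = q3 & minkowski v (f (o 4) u) = q4].

Lemma expand_products_are v q0 q1 q2 q3 q4 : products_are v q0 q1 q2 q3 q4 ->
  v = - q1 *: f (o 0) u - q0 *: f (o 1) u + q2 *: f (o 2) u + (q3 / m u) *: f (o 3) u
    + (q4 / m u) *: f (o 4) u.
Proof. by move=> [a b c d e]; apply: (expand_products m0 fm a b c d e). Qed.

(** A row of the connection matrix is the list of products of a derivative with the frame, passed
    through the inverse Gram matrix; this puts the surface into the form of the linear system. *)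
Lemma structure0_of_products : Oms u 1 0 = Oms u 0 1 ->
  products_are (pd 0 (f (o 0)) u) 0 (w u 0 0) 0 (- Om u 0 0) (- Om u 0 1) ->
  products_are (pd 0 (f (o 1)) u) (- w u 0 0) 0 0 (- Oms u 0 0) (- Oms u 1 0) ->
  pd 0 (f (o 2)) u = f (o 3) u ->
  products_are (pd 0 (f (o 3)) u) (Om u 0 0) (Oms u 0 0) (- (1 * m u))
    (2^-1 * pd 0 m u) (- (2^-1 * pd 1 m u)) ->
  products_are (pd 0 (f (o 4)) u) (Om u 0 1) (Oms u 1 0) (- (0 * m u))
    (2^-1 * pd 1 m u) (2^-1 * pd 0 m u) ->
  pd 0 (movmx f) u = structure0 Om m w Oms u *m movmx f u.
Proof.
move=> O10 /expand_products_are e0 /expand_products_are e1 e2 /expand_products_are e3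
  /expand_products_are e4.
apply/movmx_flow => //; apply: ord5P; rewrite sum5Z !mxE /=.
- apply: etrans e0 _.
  by rewrite !scale0r subr0 !addr0 !mulNr.
- apply: etrans e1 _; rewrite O10.
  by rewrite !scale0r oppr0 !scale0r !add0r !addr0 !mulNr scaleNr opprK.
- by apply: etrans e2 _; rewrite !scale0r !add0r !addr0 scale1r.
- apply: etrans e3 _; rewrite /theta mul1r -scaleNr.
  generalize (pd 0 m u) (pd 1 m u) => p q; move: (m u) m0 => c c0.
  by congr (_ + _ *: _ + _ *: _); field.
apply: etrans e4 _; rewrite /theta mul0r oppr0 !scale0r O10 -scaleNr.
generalize (pd 0 m u) (pd 1 m u) => p q; move: (m u) m0 => c c0.
by congr (_ + _ *: _ + _ *: _); field.
Qed.

Lemma structure1_of_products : Om u 1 0 = Om u 0 1 -> Om u 1 1 = - Om u 0 0 ->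
  products_are (pd 1 (f (o 0)) u) 0 (w u 0 1) 0 (- Om u 1 0) (- Om u 1 1) ->
  products_are (pd 1 (f (o 1)) u) (- w u 0 1) 0 0 (- Oms u 0 1) (- Oms u 1 1) ->
  pd 1 (f (o 2)) u = f (o 4) u ->
  products_are (pd 1 (f (o 3)) u) (Om u 1 0) (Oms u 0 1) (- (0 * m u))
    (2^-1 * pd 1 m u) (2^-1 * pd 0 m u) ->
  products_are (pd 1 (f (o 4)) u) (Om u 1 1) (Oms u 1 1) (- (1 * m u))
    (- (2^-1 * pd 0 m u)) (2^-1 * pd 1 m u) ->
  pd 1 (movmx f) u = structure1 Om m w Oms u *m movmx f u.
Proof.
move=> O10 O11 /expand_products_are e0 /expand_products_are e1 e2 /expand_products_are e3
  /expand_products_are e4.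
apply/movmx_flow => //; apply: ord5P; rewrite sum5Z !mxE /=.
- apply: etrans e0 _; rewrite O10 O11.
  by rewrite !scale0r subr0 !addr0 opprK !mulNr.
- apply: etrans e1 _.
  by rewrite !scale0r oppr0 !scale0r !add0r !addr0 !mulNr scaleNr opprK.
- by apply: etrans e2 _; rewrite !scale0r !add0r scale1r.
- apply: etrans e3 _; rewrite /theta mul0r oppr0 !scale0r O10 -scaleNr.
  generalize (pd 0 m u) (pd 1 m u) => p q; move: (m u) m0 => c c0.
  by congr (_ + _ *: _ + _ *: _); field.
apply: etrans e4 _; rewrite /theta mul1r O11 -scaleNr opprK.
generalize (pd 0 m u) (pd 1 m u) => p q; move: (m u) m0 => c c0.
by congr (_ + _ *: _ + _ *: _); field.
Qed.

End DerivativeProducts.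

Section FrameOfSurface.
Context {R : realType}.
Local Notation pt := 'rV[R]_2.
Local Notation R4 := 'rV[R]_4.
Local Notation R14 := (R * 'rV[R]_4)%type.
Local Notation o k := (@Ordinal 5 k isT).
Variables (U : set pt) (p0 : pt) (x n : pt -> R4) (lam : pt -> R).
Variables (Om : pt -> 'M[R]_2) (m E : pt -> R) (w : pt -> 'rV[R]_2) (Oms : pt -> 'M[R]_2).
Hypothesis U_open : open U.
Hypothesis m_smooth : smooth U m.
Hypothesis m_gt0 : forall u, U u -> 0 < m u.
Hypothesis E_gt0 : forall u, U u -> 0 < E u.
Hypothesis Om10 : forall u, U u -> Om u 1 0 = Om u 0 1.
Hypothesis Om11 : forall u, U u -> Om u 1 1 = - Om u 0 0.
Hypothesis Om_norm : forall u, U u -> Om u 0 0 ^+ 2 + Om u 0 1 ^+ 2 = m u * E u.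
Hypothesis Oms10 : forall u, U u -> Oms u 1 0 = Oms u 0 1.
Hypothesis rz : realizes p0 Om m w Oms U x n lam.

Local Notation H := (meanH x n).
Local Notation xi := (conformal_gauss x n).
Local Notation y := (fun u => (1, x u) : R14).
Local Notation nn := (fun u => (0, n u) : R14).

Let surf := rz_surface rz.
Let lam0 u : U u -> lam u != 0. Proof. by move=> /(rz_lam_gt0 rz); rewrite lt0r => /andP[]. Qed.
Let mu0 u : U u -> m u != 0. Proof. by move=> /m_gt0; rewrite lt0r => /andP[]. Qed.
Let dx u : U u -> differentiable x u.
Proof. exact: smooth_diff (is_smooth surf). Qed.
Let dn u : U u -> differentiable n u.
Proof. exact: smooth_diff (is_normal_smooth surf). Qed.
Let dlam u : U u -> differentiable lam u.
Proof. exact: smooth_diff (rz_lam_smooth rz). Qed.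
Let dm u : U u -> differentiable m u.
Proof. exact: smooth_diff m_smooth. Qed.

Lemma smooth_dot (f g : pt -> R4) : smooth U f -> smooth U g ->
  smooth U (fun u => dot (f u) (g u)).
Proof.
move=> sf sg k; apply: Ck_sum => // i.
by apply: CkM => //; [exact: (Ck_mxP k f U_open).1 (sf k) 0 i | exact: (Ck_mxP k g U_open).1 (sg k) 0 i].
Qed.

(** The adjugate formula exhibits the mean curvature as a rational function of inner products of
    derivatives, from which its smoothness follows. *)
Lemma tr_invmx2 (A B : 'M[R]_2) : A \in unitmx -> \tr (invmx A *m B) = (\det A)^-1 *
  (A 1 1 * B 0 0 + A 0 0 * B 1 1 - A 0 1 * B 1 0 - A 1 0 * B 0 1).
Proof.
move=> UA; have d0 : \det A != 0 by rewrite -unitfE -unitmxE.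
pose P : 'M[R]_2 := \matrix_(i, j)
  if i == 0 then if j == 0 then A 1 1 else - A 0 1 else if j == 0 then - A 1 0 else A 0 0.
have -> : invmx A = (\det A)^-1 *: P.
  suff AP : A *m ((\det A)^-1 *: P) = 1%:M by rewrite -[LHS]mulmx1 -AP mulKmx.
  move: d0; rewrite -scalemxAr det2 => d0.
  apply/matrixP; apply: ord2P; apply: ord2P; rewrite !mxE sum2 !mxE /= ?mulr1n ?mulr0n;
  by field.
rewrite -scalemxAl linearZ /= /mxtrace sum2 !mxE !sum2 !mxE /=.
by congr (_ * _); ring.
Qed.

Lemma fstFF_unit u : U u -> fstFF x u \in unitmx.
Proof. by move=> Uu; rewrite -(row_free_jacobian (dx Uu)); exact: is_immersion surf _ Uu. Qed.

Lemma meanH_smooth : smooth U H.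
Proof.
have sI i j : smooth U (fun u => dot (pd i x u) (pd j x u)).
  by apply: smooth_dot; apply: smooth_pd; exact: is_smooth surf.
have sII i j : smooth U (fun u => - dot (pd i x u) (pd j n u)).
  move=> k; apply: CkN => //; apply: smooth_dot; apply: smooth_pd.
    exact: is_smooth surf.
  exact: is_normal_smooth surf.
have sIII i j p q : smooth U (fun u => dot (pd i x u) (pd j x u) * - dot (pd p x u) (pd q n u)).
  by move=> k; apply: CkM => //; [exact: sI|exact: sII].
pose d u := dot (pd 0 x u) (pd 0 x u) * dot (pd 1 x u) (pd 1 x u) -
  dot (pd 0 x u) (pd 1 x u) * dot (pd 1 x u) (pd 0 x u).
have dE u : d u = \det (fstFF x u) by rewrite det2 !mxE.
have sd : smooth U (fun u => (d u)^-1).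
  move=> k; apply: CkV => // [u Uu|].
    by rewrite dE -unitfE -unitmxE fstFF_unit.
  by apply: CkB => //; apply: CkM => //; exact: sI.
have s2 k : Ck k U (fun=> 2^-1 : R) := Ck_cst k U _.
move=> k; have S i j p q := sIII i j p q k.
apply: (Ck_ext U_open _ (CkM U_open (s2 k) (CkM U_open (sd k)
  (CkB U_open (CkB U_open (CkD U_open (S 1 1 0 0) (S 0 0 1 1)) (S 0 1 1 0)) (S 1 0 0 1))))).
by move=> u Uu; rewrite /meanH tr_invmx2 ?fstFF_unit // -dE !mxE.
Qed.

Let dH u : U u -> differentiable H u.
Proof. exact: smooth_diff meanH_smooth. Qed.
Let dpH u i : U u -> differentiable (pd i H) u.
Proof. exact: smooth_diff (smooth_pd i meanH_smooth). Qed.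

Lemma xi_smooth : smooth U (fun u => (xi u).1) /\ smooth U (fun u => (xi u).2).
Proof.
split=> k.
  by apply: (Ck_ext U_open _ (meanH_smooth k)) => u _; rewrite /= addr0 /GRing.scale /= mulr1.
apply: (Ck_ext U_open _ (CkD U_open (smooth_scale4 U_open meanH_smooth (is_smooth surf) k)
  (is_normal_smooth surf k))) => u _ //.
Qed.

Let dy u : U u -> differentiable y u.
Proof. by move=> Uu; exact: differentiable_pair (differentiable_cst _ _) (dx Uu). Qed.
Let dnn u : U u -> differentiable nn u.
Proof. by move=> Uu; exact: differentiable_pair (differentiable_cst _ _) (dn Uu). Qed.
Let dxi u : U u -> differentiable xi u.
Proof.
move=> Uu; have [d _] := pd_scale14 0 (dH Uu) (dy Uu).
exact: differentiableD d (dnn Uu).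
Qed.

Lemma pd_xi u i : U u -> pd i xi u = pd i H u *: y u + H u *: pd i y u + pd i nn u.
Proof.
move=> Uu; have [d e] := pd_scale14 i (dH Uu) (dy Uu).
by rewrite (pdDW _ d (dnn Uu)) e.
Qed.

Lemma surface_pd_y u i : U u -> pd i y u = (0, pd i x u).
Proof. by move=> Uu; rewrite (pd_pair _ (differentiable_cst _ _) (dx Uu)) pd_cst. Qed.

Lemma surface_pd_n u i : U u -> pd i nn u = (0, pd i n u).
Proof. by move=> Uu; rewrite (pd_pair _ (differentiable_cst _ _) (dn Uu)) pd_cst. Qed.

Lemma mink_yy u : U u -> minkowski (y u) (y u) = 0.
Proof. by move=> Uu; rewrite /minkowski /= (is_sphere surf Uu) mulr1 addNr. Qed.

Lemma mink_xiy u : U u -> minkowski (xi u) (y u) = 0.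
Proof.
move=> Uu; rewrite /conformal_gauss minkDl minkZl mink_yy // mulr0 add0r /minkowski /=.
by rewrite mul0r oppr0 add0r (is_normal_tangent surf Uu).
Qed.

Lemma mink_xixi u : U u -> minkowski (xi u) (xi u) = 1.
Proof.
move=> Uu; rewrite {2}/conformal_gauss minkDr minkZr mink_xiy // mulr0 add0r.
rewrite /conformal_gauss minkDl minkZl /minkowski /= !mul0r mulr0 oppr0 !add0r.
by rewrite dotC (is_normal_tangent surf Uu) (is_normal_unit surf Uu) mulr0 add0r.
Qed.

Lemma mink_pd_const (f g : pt -> R14) (c : R) u i : U u -> differentiable f u ->
  differentiable g u -> (forall v, U v -> minkowski (f v) (g v) = c) ->
  minkowski (pd i f u) (g u) = - minkowski (f u) (pd i g u).
Proof.
move=> Uu df dg fg; apply/eqP; rewrite -addr_eq0 -pd_mink //.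
by rewrite (pd_near i U_open Uu fg) pd_cst.
Qed.

Lemma mink_pd_self (f : pt -> R14) (c : R) u i : U u -> differentiable f u ->
  (forall v, U v -> minkowski (f v) (f v) = c) -> minkowski (pd i f u) (f u) = 0.
Proof.
move=> Uu df ff; have := mink_pd_const i Uu df df ff; rewrite (minkC (f u)) => /eqP.
by rewrite -addr_eq0 -mulr2n mulrn_eq0 /= => /eqP.
Qed.

Lemma mink_pdy_y u i : U u -> minkowski (pd i y u) (y u) = 0.
Proof. by move=> Uu; apply: (mink_pd_self i Uu (dy Uu) mink_yy). Qed.

Lemma mink_pdxi_xi u i : U u -> minkowski (pd i xi u) (xi u) = 0.
Proof. by move=> Uu; apply: (mink_pd_self i Uu (dxi Uu) mink_xixi). Qed.

Lemma mink_pdy_xi u i : U u -> minkowski (pd i y u) (xi u) = 0.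
Proof.
move=> Uu; rewrite /conformal_gauss minkDr minkZr mink_pdy_y // mulr0 add0r.
by rewrite surface_pd_y // /minkowski /= mul0r oppr0 add0r dotC (is_normal_orth surf Uu).
Qed.

Lemma mink_pdxi_y u i : U u -> minkowski (pd i xi u) (y u) = 0.
Proof.
move=> Uu; rewrite (mink_pd_const i Uu (dxi Uu) (dy Uu) mink_xiy).
by rewrite minkC mink_pdy_xi // oppr0.
Qed.

Lemma mink_pdy_pdxi u i j : U u -> minkowski (pd i y u) (pd j xi u) = - sndFF0 x n u i j.
Proof.
move=> Uu; rewrite pd_xi // minkDr minkDr !minkZr mink_pdy_y // mulr0 add0r.
rewrite surface_pd_n // !surface_pd_y // /minkowski /= !mul0r !oppr0 !add0r.
rewrite /sndFF0 !mxE; move: (H u) (dot _ _) (dot _ _) => *; ring.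
Qed.

Let sxi : smooth14 U xi := xi_smooth.
Let dpxi u i : U u -> differentiable (pd i xi) u.
Proof. exact: smooth14_diff (smooth14_pd U_open i sxi). Qed.

Lemma pdxi_fst u i : U u -> (pd i xi u).1 = pd i H u.
Proof.
move=> Uu; rewrite pd_fst; last exact: dxi.
by apply: (pd_near _ U_open Uu) => v _; rewrite /= addr0 /GRing.scale /= mulr1.
Qed.

Lemma mink_pdxi_pdxi u i j : U u -> minkowski (pd i xi u) (pd j xi u) = (i == j)%:R * m u.
Proof. by move=> Uu; rewrite (rz_m rz Uu) mxE mulr_natl. Qed.

(* A null vector with <antipode, y> = -1; projecting it orthogonally to the
   span of xi and its derivatives, then correcting along y, gives y*. *)
Definition antipode u : R14 := (2^-1, - 2^-1 *: x u).

(** Its products with xi and its derivatives are thereby minus their time components, that is, minus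
    the mean curvature and its derivatives. *)
Lemma mink_antipode u (v : R14) : minkowski v (y u) = 0 -> minkowski (antipode u) v = - v.1.
Proof.
rewrite /minkowski /= mulr1 dotC dotZl => h.
have -> : dot (x u) v.2 = v.1 by lra.
lra.
Qed.

Definition dual u : R14 :=
  dual_vector (y u) (antipode u) (xi u) (pd 0 xi u) (pd 1 xi u) (H u) (pd 0 H u) (pd 1 H u) (m u).

(** The second vector uses the explicit formula [dual], whose differentiability is visible; [y_star]
    goes through a choice and is identified with [dual] afterwards. *)
Definition surface_frame (k : 'I_5) u : R14 := nth 0
  [:: lam u *: y u; (lam u)^-1 *: dual u; xi u; pd 0 xi u; pd 1 xi u] k.
Local Notation fr := surface_frame.

Lemma surface_frame_adapted u : U u -> adapted (fr^~ u) (m u).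
Proof.
move=> Uu; have l0 := lam0 Uu; have m0 := mu0 Uu.
have zy : minkowski (antipode u) (y u) = -1.
  rewrite /minkowski /= dotZl (is_sphere surf Uu); lra.
have zz : minkowski (antipode u) (antipode u) = 0.
  rewrite /minkowski /= dotZl dotZr (is_sphere surf Uu); lra.
have zX : minkowski (antipode u) (xi u) = - H u.
  by rewrite (mink_antipode (mink_xiy Uu)) /= addr0 /GRing.scale /= mulr1.
have zXi i : minkowski (antipode u) (pd i xi u) = - pd i H u.
  by rewrite (mink_antipode (mink_pdxi_y i Uu)) pdxi_fst.
have X00 : minkowski (pd 0 xi u) (pd 0 xi u) = m u.
  by rewrite (mink_pdxi_pdxi 0 0 Uu) mul1r.
have X01 : minkowski (pd 0 xi u) (pd 1 xi u) = 0.
  by rewrite (mink_pdxi_pdxi 0 1 Uu) mul0r.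
have X11 : minkowski (pd 1 xi u) (pd 1 xi u) = m u.
  by rewrite (mink_pdxi_pdxi 1 1 Uu) mul1r.
have [e0 e1 e2 e3 e4] := dual_vector_products m0 (mink_yy Uu) (mink_xiy Uu) (mink_xixi Uu)
  (mink_pdxi_y 0 Uu) (mink_pdxi_y 1 Uu) (mink_pdxi_xi 0 Uu) (mink_pdxi_xi 1 Uu) X00 X01 X11
  zy zz zX (zXi 0) (zXi 1).
exact: (adapted_vectors l0 (mink_yy Uu) (mink_xiy Uu) (mink_xixi Uu)
  (mink_pdxi_y 0 Uu) (mink_pdxi_y 1 Uu) (mink_pdxi_xi 0 Uu) (mink_pdxi_xi 1 Uu) X00 X01 X11
  e0 e1 e2 e3 e4).
Qed.

Lemma y_star_dual u : U u -> y_star x n u = dual u.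
Proof.
move=> Uu; have [_ ->] := @dual_liftE _ x n u (fr^~ u) (lam u) (m u) (rz_lam_gt0 rz Uu)
  (mu0 Uu) (surface_frame_adapted Uu) erefl erefl erefl erefl.
by rewrite /surface_frame /= scalerA mulfV ?lam0 // scale1r.
Qed.

Let ddual u : U u -> differentiable dual u.
Proof.
move=> Uu.
have dz : differentiable antipode u.
  apply: differentiable_pair; first exact: differentiable_cst.
  exact: differentiableZ (dx Uu).
have dV := differentiableV (dm Uu) (mu0 Uu).
have dq i : differentiable (fun v => pd i H v / m v) u by exact: differentiableM (dpH i Uu) dV.
have [d1 _] := pd_scale14 0 (dH Uu) (dxi Uu).
have [d2 _] := pd_scale14 0 (dq 0) (dpxi 0 Uu).
have [d3 _] := pd_scale14 0 (dq 1) (dpxi 1 Uu).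
have dsq (f : pt -> R) : differentiable f u -> differentiable (fun v => f v ^+ 2 : R) u.
  by move=> d; apply: (differentiableM d d).
have dc : differentiable (fun v => 2^-1 * (H v ^+ 2 + (pd 0 H v ^+ 2 + pd 1 H v ^+ 2) / m v)) u.
  apply: differentiableM; first exact: differentiable_cst.
  apply: differentiableD; first exact: dsq (dH Uu).
  apply: differentiableM => //.
  by apply: differentiableD; [exact: dsq (dpH 0 Uu)|exact: dsq (dpH 1 Uu)].
have [d4 _] := pd_scale14 0 dc (dy Uu).
exact: differentiableB (differentiableD (differentiableD (differentiableD dz d1) d2) d3) d4.
Qed.

Lemma surface_frame_diff u k : U u -> differentiable (fr k) u.
Proof.
move=> Uu; move: k; apply: ord5P.
- by have [d _] := pd_scale14 0 (dlam Uu) (dy Uu).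
- by have [d _] := pd_scale14 0 (differentiableV (dlam Uu) (lam0 Uu)) (ddual Uu).
- exact: dxi.
- exact: dpxi.
- exact: dpxi.
Qed.
Let fm u (Uu : U u) := surface_frame_adapted Uu.

Lemma sndFF0_Om u : U u -> sndFF0 x n u = (lam u)^-1 *: Om u.
Proof. by move=> Uu; rewrite (rz_Om rz Uu) scalerA mulVf ?lam0 // scale1r. Qed.

Lemma mink_pdy_pdxi_Om u i j : U u -> minkowski (pd i y u) (pd j xi u) = - (Om u i j / lam u).
Proof. by move=> Uu; rewrite (mink_pdy_pdxi i j Uu) sndFF0_Om // mxE mulrC. Qed.

Lemma mink_pdy_Y u i : U u -> minkowski (pd i y u) (fr (o 0) u) = 0.
Proof. by move=> Uu; rewrite minkZr (mink_pdy_y i Uu) mulr0. Qed.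

Lemma pd_y_expand u i : U u -> pd i y u = - minkowski (pd i y u) (fr (o 1) u) *: fr (o 0) u
  + (- (Om u i 0 / lam u) / m u) *: pd 0 xi u + (- (Om u i 1 / lam u) / m u) *: pd 1 xi u.
Proof.
move=> Uu.
have EE := @expand_products _ (fr^~ u) (m u) (pd i y u) _ _ _ _ _ (mu0 Uu) (fm Uu)
  (mink_pdy_Y i Uu) erefl (mink_pdy_xi i Uu) (mink_pdy_pdxi_Om i 0 Uu) (mink_pdy_pdxi_Om i 1 Uu).
apply: (etrans EE).
by rewrite !scale0r subr0 addr0.
Qed.

(** [realizes] does not mention [E]; this form of the induced metric is forced by (a) and (b), which
    determine the components of the derivatives of (1, x) along xi_1 and xi_2. *)
Lemma fstFF_surface u : U u -> fstFF x u = (E u / lam u ^+ 2)%:M.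
Proof.
move=> Uu; apply/matrixP => i j; have l0 := lam0 Uu; have m0 := mu0 Uu.
have -> : fstFF x u i j = minkowski (pd i y u) (pd j y u).
  by rewrite mxE !surface_pd_y // /minkowski /= mulr0 oppr0 add0r.
have := mink_comb3 (pd_y_expand j Uu) (mink_pdy_Y i Uu) (mink_pdy_pdxi_Om i 0 Uu)
  (mink_pdy_pdxi_Om i 1 Uu).
generalize (minkowski (pd j y u) (fr (o 1) u)) (minkowski (pd i y u) (pd j y u)) => k q ->.
have -> : E u = (Om u 0 0 ^+ 2 + Om u 0 1 ^+ 2) / m u.
  by rewrite Om_norm // mulrAC mulfV // mul1r.
rewrite mxE; move: j i; apply: ord2P; apply: ord2P;
rewrite ?Om10 ?Om11 //= ?mulr1n ?mulr0n;
move: (Om u 0 0) (Om u 0 1) (m u) (lam u) m0 l0 => a b c' d c0 d0; by field; rewrite ?c0 ?d0.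
Qed.

Lemma w_surface u i : U u -> w u 0 i = - (Om u i 0 * pd 0 H u + Om u i 1 * pd 1 H u) / (m u * lam u)
  - pd i lam u / lam u.
Proof.
move=> Uu; have l0 := lam0 Uu; have m0 := mu0 Uu.
have e0 : E u != 0 by have := E_gt0 Uu; rewrite lt0r => /andP[].
have W := rz_w rz Uu i; rewrite (pd_ln i (dlam Uu) (rz_lam_gt0 rz Uu)) in W.
rewrite W; congr (_ - _).
rewrite sndFF0_Om // fstFF_surface // (@invmx_scaled _ _ _ (m u * E u)) ?mulf_neq0 //.
  have -> : Defs.dH x n u = \col_k (if k == 0 then pd 0 H u else pd 1 H u).
    by apply/colP; apply: ord2P; rewrite !mxE.
  generalize (pd 0 H u) (pd 1 H u) => h k.
  rewrite mul_scalar_mx !mxE sum2 !mxE /=.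
  move: (lam u) (m u) (E u) (Om u i 0) (Om u i 1) l0 m0 e0.
  by move=> a b c e g a0 b0 c0; field; rewrite ?a0 ?b0 ?c0.
rewrite -Om_norm //; apply/matrixP; apply: ord2P; apply: ord2P;
  rewrite !mxE sum2 ?Om10 ?Om11 //= ?mulr1n ?mulr0n; ring.
Qed.

Lemma products_Y u i : U u -> [/\ minkowski (pd i (fr (o 0)) u) (fr (o 0) u) = 0,
  minkowski (pd i (fr (o 0)) u) (fr (o 1) u) = w u 0 i,
  minkowski (pd i (fr (o 0)) u) (fr (o 2) u) = 0,
  minkowski (pd i (fr (o 0)) u) (fr (o 3) u) = - Om u i 0 &
  minkowski (pd i (fr (o 0)) u) (fr (o 4) u) = - Om u i 1].
Proof.
move=> Uu; have l0 := lam0 Uu; have m0 := mu0 Uu.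
have [_ E1] := pd_scale14 i (dlam Uu) (dy Uu).
have y1 : minkowski (y u) (fr (o 1) u) = - (lam u)^-1.
  by have := fm Uu (o 0) (o 1); rewrite minkZl mxE /= => /(canRL (mulKf l0)) ->; rewrite mulrN1.
have yx : minkowski (y u) (xi u) = 0 by rewrite minkC (mink_xiy Uu).
have yi j : minkowski (y u) (pd j xi u) = 0 by rewrite minkC (mink_pdxi_y j Uu).
(* The time component of (1, x) is constant, so it vanishes in the expansion of the derivative. This
   expresses the product with the dual vector through the derivatives of the mean curvature, and
   condition (c) turns it into [w]. *)
have wE : w u 0 i = lam u * minkowski (pd i y u) (fr (o 1) u) - pd i lam u / lam u.
  rewrite w_surface //; congr (_ - _).
  have K : (pd i y u).1 = 0 by rewrite surface_pd_y.
  have Y1 : (fr (o 0) u).1 = lam u by rewrite /= /GRing.scale /= mulr1.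
  have := fst_comb3 (pd_y_expand i Uu) K Y1 (pdxi_fst 0 Uu) (pdxi_fst 1 Uu).
  generalize (minkowski (pd i y u) (fr (o 1) u)) (pd 0 H u) (pd 1 H u).
  move: (Om u i 0) (Om u i 1) (lam u) (m u) l0 m0 => a b g h g0 h0 k c d L.
  have -> : g * k = - (a / g) / h * c + - (b / g) / h * d.
    by apply/eqP; rewrite -subr_eq0 -oppr_eq0 -L; apply/eqP; ring.
  by field; rewrite ?g0 ?h0.
have := derivative_products l0 E1 y1 (mink_yy Uu) yx (yi 0) (yi 1) (mink_pdy_y i Uu)
  (mink_pdy_xi i Uu) (mink_pdy_pdxi_Om i 0 Uu) (mink_pdy_pdxi_Om i 1 Uu) (esym wE).
exact.
Qed.

Lemma gram_const (i j : 'I_5) (c : R) : (forall k, gram k i j = c) ->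
  forall v, U v -> minkowski (fr i v) (fr j v) = c.
Proof. by move=> gc v Uv; rewrite (fm Uv) gc. Qed.

Lemma products_Ys u i : U u -> [/\ minkowski (pd i (fr (o 1)) u) (fr (o 0) u) = - w u 0 i,
  minkowski (pd i (fr (o 1)) u) (fr (o 1) u) = 0,
  minkowski (pd i (fr (o 1)) u) (fr (o 2) u) = 0 &
  forall j, minkowski (pd i (fr (o 1)) u) (pd j xi u) = - Oms u j i].
Proof.
move=> Uu; have l0 := lam0 Uu.
have d k := surface_frame_diff k Uu.
have [_ Y1 _ _ _] := products_Y i Uu.
have g10 : forall v, U v -> minkowski (fr (o 1) v) (fr (o 0) v) = -1.
  by apply: gram_const => k; rewrite mxE.
have g11 : forall v, U v -> minkowski (fr (o 1) v) (fr (o 1) v) = 0.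
  by apply: gram_const => k; rewrite mxE.
have g12 : forall v, U v -> minkowski (fr (o 1) v) (fr (o 2) v) = 0.
  by apply: gram_const => k; rewrite mxE.
have g1i j : minkowski (fr (o 1) u) (pd j xi u) = 0.
  by move: j; apply: ord2P; [have := fm Uu (o 1) (o 3)|have := fm Uu (o 1) (o 4)]; rewrite mxE.
split.
- apply: etrans (mink_pd_const i Uu (d _) (d _) g10) _.
  by congr (- _); apply: etrans (minkC _ _) Y1.
- exact: mink_pd_self i Uu (d _) g11.
- apply: etrans (mink_pd_const i Uu (d _) (d _) g12) _.
  have Z : minkowski (fr (o 1) u) (pd i (fr (o 2)) u) = 0 := g1i i.
  by rewrite Z oppr0.
move=> j.
(* Condition (d) speaks of y*, the frame of y* / lam; the term in d lam disappears because y* is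
   orthogonal to the derivatives of xi. *)
have yE v : U v -> y_star x n v = lam v *: fr (o 1) v.
  by move=> Uv; rewrite y_star_dual // /surface_frame /= scalerA mulfV ?lam0 // scale1r.
have [_ S1] := pd_scale14 i (dlam Uu) (d (o 1)).
have S : pd i (y_star x n) u = pd i lam u *: fr (o 1) u + lam u *: pd i (fr (o 1)) u.
  exact: etrans (pd_near i U_open Uu yE) S1.
have O := rz_Oms rz Uu j i; rewrite S in O.
have := mink_comb2 (pd i lam u) (lam u) (pd i (fr (o 1)) u) (g1i j) => M.
have {}O := etrans O (congr1 (fun t => - ((lam u)^-1 * t)) (etrans (minkC _ _) M)).
rewrite O.
by generalize (minkowski (pd i (fr (o 1)) u) (pd j xi u)) => k; rewrite mulKf // opprK.
Qed.

(** The Koszul formula: symmetry of second derivatives and the derivatives of the metric products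
    determine the tangential part of the second derivatives of xi. For m |du|^2 the result is its
    Christoffel symbols. *)
Lemma koszul u : U u ->
  let c k j l := minkowski (pd k (pd j xi) u) (pd l xi u) in
  [/\ c 0 0 0 = 2^-1 * pd 0 m u, c 0 0 1 = - (2^-1 * pd 1 m u),
      c 0 1 0 = 2^-1 * pd 1 m u & c 0 1 1 = 2^-1 * pd 0 m u] /\
  [/\ c 1 0 0 = 2^-1 * pd 1 m u, c 1 0 1 = 2^-1 * pd 0 m u,
      c 1 1 0 = - (2^-1 * pd 0 m u) & c 1 1 1 = 2^-1 * pd 1 m u].
Proof.
move=> Uu c.
have csym l : c 0 1 l = c 1 0 l.
  exact (congr1 (fun v => minkowski v (pd l xi u)) (pd_comm14 U_open 0 1 sxi Uu)).
have cmet k j l : c k j l + c k l j = (j == l)%:R * pd k m u.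
  have P := pd_mink k (dpxi j Uu) (dpxi l Uu).
  have Q := pd_near k U_open Uu (fun v Uv => mink_pdxi_pdxi j l Uv).
  have Q2 := pdM k (@differentiable_cst _ _ _ ((j == l)%:R : R) u) (dm Uu).
  rewrite pd_cst mul0r add0r in Q2.
  apply: etrans (etrans (esym P) (etrans Q Q2)).
  exact (congr1 (fun t => c k j l + t) (minkC _ _)).
have := (cmet 0 0 0, cmet 0 0 1, cmet 0 1 1, cmet 1 0 0, cmet 1 0 1, cmet 1 1 1).
have := (csym 0, csym 1); clear csym cmet.
generalize (c 0 0 0) (c 0 0 1) (c 0 1 0) (c 0 1 1) (c 1 0 0) (c 1 0 1) (c 1 1 0) (c 1 1 1).
generalize (pd 0 m u) (pd 1 m u).
move=> p q a b d e f g h k /= [S1 S2]; rewrite !mul0r !mul1r => -[[[[[A B] C] F] G] K].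
by split; split; lra.
Qed.

Lemma products_Xj u i j : U u -> [/\
  minkowski (pd i (pd j xi) u) (fr (o 0) u) = Om u i j,
  minkowski (pd i (pd j xi) u) (fr (o 1) u) = Oms u j i &
  minkowski (pd i (pd j xi) u) (fr (o 2) u) = - ((j == i)%:R * m u)].
Proof.
move=> Uu; have d k := surface_frame_diff k Uu.
have gc (k : 'I_5) : (forall c : R, gram c (o 3) k = 0) -> (forall c : R, gram c (o 4) k = 0) ->
    forall v, U v -> minkowski (pd j xi v) (fr k v) = 0.
  move=> g3 g4 v Uv; have := (fm Uv (o 3) k, fm Uv (o 4) k); rewrite g3 g4 => -[e3 e4].
  by move: j; apply: ord2P; [exact: e3|exact: e4].
have j0 : forall v, U v -> minkowski (pd j xi v) (fr (o 0) v) = 0.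
  by apply: gc => c; rewrite mxE.
have j1 : forall v, U v -> minkowski (pd j xi v) (fr (o 1) v) = 0.
  by apply: gc => c; rewrite mxE.
have j2 : forall v, U v -> minkowski (pd j xi v) (fr (o 2) v) = 0.
  by apply: gc => c; rewrite mxE.
have [_ _ _ Y3 Y4] := products_Y i Uu; have [_ _ _ Ys] := products_Ys i Uu.
have Yj : minkowski (pd i (fr (o 0)) u) (pd j xi u) = - Om u i j.
  by move: j {gc j0 j1 j2}; apply: ord2P; [exact: Y3|exact: Y4].
split.
- apply: etrans (mink_pd_const i Uu (dpxi j Uu) (d _) j0) _.
  by apply: etrans (congr1 (fun t : R => - t) (etrans (minkC _ _) Yj)) _; rewrite opprK.
- apply: etrans (mink_pd_const i Uu (dpxi j Uu) (d _) j1) _.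
  by apply: etrans (congr1 (fun t : R => - t) (etrans (minkC _ _) (Ys j))) _; rewrite opprK.
apply: etrans (mink_pd_const i Uu (dpxi j Uu) (d _) j2) _.
exact (congr1 (fun t : R => - t) (mink_pdxi_pdxi j i Uu)).
Qed.

Lemma surface_structure u : U u ->
  [/\ differentiable (movmx fr) u, pd 0 (movmx fr) u = structure0 Om m w Oms u *m movmx fr u &
      pd 1 (movmx fr) u = structure1 Om m w Oms u *m movmx fr u].
Proof.
move=> Uu; have d k := surface_frame_diff k Uu.
have [[c000 c001 c010 c011] [c100 c101 c110 c111]] := koszul Uu.
split; first exact: differentiable_movmx.
  have [q0 q1 q2] := products_Xj 0 0 Uu; have [r0 r1 r2] := products_Xj 0 1 Uu.
  have [s0 s1 s2 s3] := products_Ys 0 Uu.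
  exact: (structure0_of_products d (mu0 Uu) (fm Uu) (Oms10 Uu) (products_Y 0 Uu)
    (And5 s0 s1 s2 (s3 0) (s3 1)) erefl (And5 q0 q1 q2 c000 c001) (And5 r0 r1 r2 c010 c011)).
have [q0 q1 q2] := products_Xj 1 0 Uu; have [r0 r1 r2] := products_Xj 1 1 Uu.
have [s0 s1 s2 s3] := products_Ys 1 Uu.
exact: (structure1_of_products d (mu0 Uu) (fm Uu) (Om10 Uu) (Om11 Uu) (products_Y 1 Uu)
    (And5 s0 s1 s2 (s3 0) (s3 1)) erefl (And5 q0 q1 q2 c100 c101) (And5 r0 r1 r2 c110 c111)).
Qed.

End FrameOfSurface.

(** * Lorentz maps and uniqueness *)

Section LorentzMaps.
Context {R : realType}.
Local Notation R4 := 'rV[R]_4.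
Local Notation R14 := (R * 'rV[R]_4)%type.

Definition lorentz (T : 'M[R]_5) : Prop := T *m Jmx *m T^T = Jmx.

Definition lin14 (T : 'M[R]_5) (v : R14) : R14 := unvec (vec v *m T).

(** The action on null lines, each represented by its point with time component 1. *)
Definition sphere_map (T : 'M[R]_5) (p : R4) : R4 :=
  (lin14 T (1, p)).1^-1 *: (lin14 T (1, p)).2.

Lemma vec_lin14 T v : vec (lin14 T v) = vec v *m T.
Proof. exact: unvecK. Qed.

Lemma lin14D T v v' : lin14 T (v + v') = lin14 T v + lin14 T v'.
Proof. by apply: vec_inj; rewrite vecD !vec_lin14 vecD mulmxDl. Qed.

Lemma lin14Z T c v : lin14 T (c *: v) = c *: lin14 T v.
Proof. by apply: vec_inj; rewrite vecZ !vec_lin14 vecZ scalemxAl. Qed.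

Lemma lin14_mink T v v' : lorentz T -> minkowski (lin14 T v) (lin14 T v') = minkowski v v'.
Proof.
move=> LT; rewrite -!vec_minkE !vec_lin14 trmx_mul !mulmxA.
by rewrite -[vec v *m T *m Jmx]mulmxA -[vec v *m (T *m Jmx) *m T^T]mulmxA LT.
Qed.

Lemma lorentz_unit T : lorentz T -> T \in unitmx.
Proof.
move=> LT; have : T *m (Jmx *m T^T *m Jmx) = 1%:M by rewrite !mulmxA LT Jmx_sq.
by move=> /mulmx1_unit[].
Qed.

Lemma lorentz_inv T : lorentz T -> lorentz (invmx T).
Proof.
move=> LT; have UT := lorentz_unit LT; rewrite /lorentz -{1}LT !mulmxA mulVmx // mul1mx.
by rewrite -!mulmxA -trmx_mul mulVmx // trmx1 mulmx1.
Qed.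

Lemma lin14K T v : T \in unitmx -> lin14 (invmx T) (lin14 T v) = v.
Proof. by move=> UT; apply: vec_inj; rewrite !vec_lin14 mulmxK. Qed.

Lemma lin14_split T p : (lin14 T (1, p)).1 != 0 ->
  lin14 T (1, p) = (lin14 T (1, p)).1 *: (1, sphere_map T p).
Proof.
move=> t0; rewrite [LHS]surjective_pairing; congr (_, _).
  by rewrite /GRing.scale /= mulr1.
by rewrite /= scalerA mulfV // scale1r.
Qed.

Lemma sphere_mapE T p : (lin14 T (1, p)).1 != 0 ->
  (1, sphere_map T p) = (lin14 T (1, p)).1^-1 *: lin14 T (1, p).
Proof.
by move=> t0; rewrite {2}(lin14_split t0) scalerA mulVf // scale1r.
Qed.

Section Orthochronous.
Variables (T : 'M[R]_5) (x0 : R4).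
Hypotheses (LT : lorentz T) (x0S : S3 x0) (x0T : 0 < (lin14 T (1, x0)).1).

Lemma mink_S3 (p : R4) : S3 p -> minkowski (1, p) (1, p) = 0.
Proof. by rewrite /S3 /minkowski /= mulr1 => ->; rewrite addNr. Qed.

(** [T] preserves the product of (1, x0) and (1, p), which is negative unless p = x0; so the future
    direction of one image passes to all the others. *)
Lemma orthochronous (p : R4) : S3 p -> 0 < (lin14 T (1, p)).1.
Proof.
move=> pS.
have D : 0 <= 2 - 2 * dot x0 p.
  have := dot_ge0 (x0 - p); rewrite !(dotDl, dotDr, dotNl, dotNr) x0S pS (dotC p).
  by move: (dot x0 p) => t; lra.
(* The product vanishes in the case of equality, where the strict criterion for future null vectors
   says nothing; but then the two points coincide. *)
have [px|px] := eqVneq (dot x0 p) 1.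
  suff -> : p = x0 by [].
  apply/eqP; rewrite -subr_eq0; apply/eqP/dot_eq0.
  by rewrite !(dotDl, dotDr, dotNl, dotNr) x0S pS (dotC p) px; lra.
apply: (@null_future _ (lin14 T (1, x0))) => //; rewrite lin14_mink ?mink_S3 //.
rewrite /minkowski /= mulr1 addrC subr_lt0 lt_neqAle px /=; lra.
Qed.

Lemma sphere_map_S3 (p : R4) : S3 p -> S3 (sphere_map T p).
Proof.
move=> pS; have t0 := orthochronous pS.
have : minkowski (lin14 T (1, p)) (lin14 T (1, p)) = 0 by rewrite lin14_mink // mink_S3.
rewrite lin14_split ?gt_eqF // minkZl minkZr => /eqP.
rewrite !mulf_eq0 gt_eqF //= /minkowski /= mulr1 addrC subr_eq0 => /eqP H.
exact: H.
Qed.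

Lemma sphere_mapK (p : R4) : S3 p -> sphere_map (invmx T) (sphere_map T p) = p.
Proof.
move=> pS; have t0 := orthochronous pS; have UT := lorentz_unit LT.
have E : lin14 (invmx T) (1, sphere_map T p) = (lin14 T (1, p)).1^-1 *: (1, p).
  by rewrite sphere_mapE ?gt_eqF // lin14Z lin14K.
rewrite {1}/sphere_map E.
have -> : ((lin14 T (1, p)).1^-1 *: ((1, p) : R14)).1 = (lin14 T (1, p)).1^-1.
  by rewrite /= /GRing.scale /= mulr1.
by rewrite invrK /= scalerA mulfV ?gt_eqF // scale1r.
Qed.

Lemma orthochronous_inv : 0 < (lin14 (invmx T) (1, sphere_map T x0)).1.
Proof.
have UT := lorentz_unit LT.
have -> : (1, sphere_map T x0) = (lin14 T (1, x0)).1^-1 *: lin14 T (1, x0).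
  by rewrite sphere_mapE ?gt_eqF.
by rewrite lin14Z lin14K //= /GRing.scale /= mulr1 invr_gt0.
Qed.

End Orthochronous.

Lemma Ck_id (V : normedModType R) k (U : set V) : Ck k U (@id V).
Proof.
case: k => [|k]; first by move=> x _; exact: cvg_id.
split=> [x _|v]; first by have [] := is_diff_id x.
have -> : (fun x : V => 'D_v id x) = (fun=> v) by apply/funext => x; exact: derive_id.
exact: Ck_cst.
Qed.

Lemma smooth_vec (U : set R4) : open U -> smooth U (fun p : R4 => vec (1, p) : 'rV[R]_5).
Proof.
move=> oU k; apply/(Ck_mxP k _ oU) => i j; rewrite ord1.
have -> : (fun p : R4 => vec (1, p) 0 j) = (fun p => match fintype.split (j : 'I_(1 + 4)) with
   inl _ => 1 | inr l => p 0 l end) by apply/funext => p; exact: vecE.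
case: fintype.split => l; first exact: Ck_cst.
exact: (Ck_mxP k _ oU).1 (Ck_id k U) 0 l.
Qed.

Lemma smooth_lin14 T (U : set R4) : open U ->
  smooth U (fun p => (lin14 T (1, p)).1) /\ smooth U (fun p => (lin14 T (1, p)).2).
Proof.
move=> oU; have sm k := Ck_mulmx oU (smooth_vec oU k) (Ck_cst k U T); split=> k.
  apply: (Ck_ext oU _ ((Ck_mxP k _ oU).1 (sm k) 0 (lshift 4 (0 : 'I_1)))) => p _.
  by rewrite /lin14 /unvec /= !mxE.
apply/(Ck_mxP k _ oU) => a b; rewrite ord1.
apply: (Ck_ext oU _ ((Ck_mxP k _ oU).1 (sm k) 0 (rshift 1 b : 'I_5))) => p _.
by rewrite /lin14 /unvec /= !mxE.
Qed.

(** The open set where the normalization makes sense. For an orthochronous [T] it contains the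
    sphere, providing the neighbourhood that [smooth_S3_map] asks for. *)
Definition regular_set T : set R4 := [set p | (lin14 T (1, p)).1 != 0].

Lemma regular_set_open T : open (regular_set T).
Proof.
have [s1 _] := smooth_lin14 T (@openT R4).
have c : continuous (fun p : R4 => (lin14 T (1, p)).1) by move=> p; exact: (s1 0%N p).
rewrite openE => p /= p0.
have /cvgrPdist_lt/(_ `|(lin14 T (1, p)).1|) := c p; rewrite normr_gt0 => /(_ p0).
by apply: filterS => q; apply: contraPneq => ->; rewrite subr0 ltxx.
Qed.

Lemma sphere_map_smooth T : smooth (regular_set T) (sphere_map T).
Proof.
have oU := @regular_set_open T; have [s1 s2] := smooth_lin14 T oU.
move=> k; apply/(Ck_mxP k _ oU) => i j.
have s2ij := (Ck_mxP k _ oU).1 (s2 k) i j.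
apply: (Ck_ext oU _ (CkM oU (CkV oU _ (s1 k)) s2ij)) => [p _|//].
by rewrite [RHS]mxE.
Qed.

Lemma derive_affine (V W : normedModType R) (g : V -> W) (p v : V) (d : W) :
  (forall h : R, g (h *: v + p) - g p = h *: d) -> 'D_v g p = d.
Proof.
move=> H; apply: cvg_lim => //; apply: cvg_trans (_ : d @[_ --> (0 : R)^'] --> d); last exact: cvg_cst.
apply: near_eq_cvg; near=> h; rewrite /= H scalerA mulVf ?scale1r //.
near: h; exact: nbhs_dnbhs_neq.
Unshelve. all: by end_near. Qed.

(** [T] is an isometry on vectors (0, v), and T(0, v) differs from t times the lifted derivative of
    the sphere map by a multiple of the null vector (1, F p). That vector is orthogonal to the
    lifted derivatives in tangent directions, so only the factor t^2 remains. *)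
Lemma sphere_map_conformal T (p : R4) : lorentz T -> S3 p -> (lin14 T (1, p)).1 != 0 ->
  forall v v' : R4, dot p v = 0 -> dot p v' = 0 ->
    dot ('D_v (sphere_map T) p) ('D_v' (sphere_map T) p) =
    (lin14 T (1, p)).1 ^- 2 * dot v v'.
Proof.
move=> LT pS t0; set t := (lin14 T (1, p)).1.
have oU := @regular_set_open T; have Up : regular_set T p by [].
have [s1 s2] := smooth_lin14 T oU.
have d1 : differentiable (fun q : R4 => (lin14 T (1, q)).1) p := (s1 1%N).1 p Up.
have d2 : differentiable (fun q : R4 => (lin14 T (1, q)).2) p := (s2 1%N).1 p Up.
have dF : differentiable (sphere_map T) p := (sphere_map_smooth T 1%N).1 p Up.
have step (h : R) v : lin14 T (1, h *: v + p) - lin14 T (1, p) = h *: lin14 T (0, v).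
  have -> : ((1, h *: v + p) : R14) = h *: (0, v) + (1, p).
    by congr (_, _); rewrite /= /GRing.scale /= mulr0 add0r.
  by rewrite lin14D lin14Z addrK.
have D1 v : 'D_v (fun q : R4 => (lin14 T (1, q)).1) p = (lin14 T (0, v)).1.
  by apply: derive_affine => h; have := congr1 fst (step h v).
have D2 v : 'D_v (fun q : R4 => (lin14 T (1, q)).2) p = (lin14 T (0, v)).2.
  by apply: derive_affine => h; have := congr1 snd (step h v).
(* The product rule for T(1, q) = t(q) (1, F q), differentiated at p along v. *)
have DL v : lin14 T (0, v) = (lin14 T (0, v)).1 *: (1, sphere_map T p)
    + t *: (0, 'D_v (sphere_map T) p).
  rewrite [LHS]surjective_pairing; congr (_, _).
    by rewrite /= /GRing.scale /= mulr1 mulr0 addr0.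
  transitivity ((lin14 T (0, v)).1 *: sphere_map T p + t *: 'D_v (sphere_map T) p); last by [].
  rewrite -D2; apply/rowP => k.
  have dFk : differentiable (fun q => sphere_map T q 0 k) p.
    exact: (differentiable_mxP _ _).1 dF 0 k.
  rewrite derive_mxE; last exact: diff_derivable.
  have -> : 'D_v (fun q : R4 => (lin14 T (1, q)).2 0 k) p =
      'D_v (fun q : R4 => (lin14 T (1, q)).1 * sphere_map T q 0 k) p.
    apply: near_eq_derive; apply: (@filterS _ _ _ (regular_set T)); last exact: open_nbhs_nbhs.
    by move=> q q0; rewrite [in RHS]mxE mulrA mulfV // mul1r.
  rewrite (@deriveM _ _ (fun q : R4 => (lin14 T (1, q)).1) (fun q => sphere_map T q 0 k));
    [|exact: diff_derivable..].
  rewrite D1 [RHS]mxE [X in _ = X + _]mxE [X in _ = _ + X]mxE addrC.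
  have dv : derivable (sphere_map T) p v by exact: diff_derivable.
  rewrite (derive_mxE 0 k dv) -/t.
  by rewrite {1}/GRing.scale /= {1}/GRing.scale /= [_ * (lin14 T (0, v)).1]mulrC.
have FF : minkowski (1, sphere_map T p) (1, sphere_map T p) = 0.
  by rewrite sphere_mapE // minkZl minkZr lin14_mink // mink_S3 // !mulr0.
have FD v : dot p v = 0 -> minkowski (1, sphere_map T p) (0, 'D_v (sphere_map T) p) = 0.
  move=> pv; have : minkowski (lin14 T (1, p)) (lin14 T (0, v)) = 0.
    by rewrite lin14_mink // /minkowski /= mulr0 oppr0 add0r.
  rewrite DL lin14_split // !(minkZl, minkDr, minkZr) FF mulr0 add0r => /eqP.
  by rewrite !mulf_eq0 (negbTE t0) => /eqP.
move=> v v' pv pv'; have : minkowski (lin14 T (0, v)) (lin14 T (0, v')) = dot v v'.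
  by rewrite lin14_mink // /minkowski /= mulr0 oppr0 add0r.
rewrite (DL v) (DL v') !(minkDl, minkZl, minkDr, minkZr) FF FD // (minkC _ (1, sphere_map T p)) FD //.
rewrite /minkowski /= !mulr0 oppr0 !addr0 !mulr0 !add0r => <-.
have t1 : t != 0 := t0.
have C z : z = t ^- 2 * (t * (t * z)) by clear -t1; move: t t1 => c c0; field.
exact: C.
Qed.

Theorem lorentz_conformal T x0 : lorentz T -> S3 x0 -> 0 < (lin14 T (1, x0)).1 ->
  conformal_transformation (sphere_map T).
Proof.
move=> LT x0S x0T.
have LV := lorentz_inv LT; have oT := orthochronous_inv LT x0T.
have FS := sphere_map_S3 LT x0S x0T.
have smooth_map S y0 : lorentz S -> S3 y0 -> 0 < (lin14 S (1, y0)).1 -> smooth_S3_map (sphere_map S).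
  move=> LS yS yT; split; first by move=> p; exact: (sphere_map_S3 LS yS yT).
  exists (regular_set S); split; [exact: regular_set_open| |exact: sphere_map_smooth].
  by move=> p pS; rewrite /regular_set /= gt_eqF // (orthochronous LS yS yT).
split.
- exact: smooth_map LT x0S x0T.
- exists (sphere_map (invmx T)); split; first exact: smooth_map LV (FS _ x0S) oT.
  move=> p pS; split; first exact: sphere_mapK LT x0S x0T _ pS.
  by have := sphere_mapK LV (FS _ x0S) oT pS; rewrite invmxK.
move=> p pS; have t0 := orthochronous LT x0S x0T pS.
exists ((lin14 T (1, p)).1 ^- 2); first by rewrite invr_gt0 exprn_gt0.
by move=> v v'; apply: sphere_map_conformal => //; rewrite gt_eqF.
Qed.

End LorentzMaps.

(** * Congruence of two realizations *)

Section Rigidity.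
Context {R : realType}.
Local Notation pt := 'rV[R]_2.
Local Notation R4 := 'rV[R]_4.
Local Notation R14 := (R * 'rV[R]_4)%type.
Local Notation o k := (@Ordinal 5 k isT).

Lemma conn_flow_unique (A0 A1 : pt -> 'M[R]_5) (D U : set pt) (X : pt -> 'M[R]_5) p0 :
  open D -> smooth D A0 -> smooth D A1 -> open U -> connected U -> U `<=` D -> U p0 ->
  X p0 = 0 ->
  (forall u, U u -> [/\ differentiable X u, pd 0 X u = A0 u *m X u & pd 1 X u = A1 u *m X u]) ->
  forall u, U u -> X u = 0.
Proof.
move=> oD s0 s1 oU cU UD Up0 X0 dX.
apply: (@connected_unique _ _ _ X U p0 oU cU Up0 X0) => u Uu; first by have [] := dX _ Uu.
have [r [L [rp L0 bnd _]]] := connection_boundsP oD (UD _ Uu) (s0 2%N) (s1 2%N).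
exists r, (5%:R * L); split=> // [|v vr Uv h]; first by rewrite mulr_ge0.
have [d e0 e1] := dX _ Uv; have [_ _ b _ _] := bnd _ vr.
have -> : 'D_h X v = conn A0 A1 v h *m X v.
  by rewrite (derive_flow h d e0 e1) /conn mulmxDl -!scalemxAl.
have := mulmx_norm_le2 (b h) (lexx `|X v|).
by rewrite !mulrA.
Qed.

(** Right multiplication by a constant matrix commutes with the coefficients on the left, so [F]
    times [T] solves the same system as [F'] and agrees with it at [p0]. *)
Lemma flow_congruent (A0 A1 : pt -> 'M[R]_5) (D U : set pt) (F F' : pt -> 'M[R]_5) (T : 'M[R]_5) p0 :
  open D -> smooth D A0 -> smooth D A1 -> open U -> connected U -> U `<=` D -> U p0 ->
  (forall u, U u -> [/\ differentiable F u, pd 0 F u = A0 u *m F u & pd 1 F u = A1 u *m F u]) ->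
  (forall u, U u -> [/\ differentiable F' u, pd 0 F' u = A0 u *m F' u & pd 1 F' u = A1 u *m F' u]) ->
  F' p0 = F p0 *m T -> forall u, U u -> F' u = F u *m T.
Proof.
move=> oD s0 s1 oU cU UD Up0 dF dF' T0 u Uu; apply/eqP; rewrite -subr_eq0; apply/eqP.
apply: (@conn_flow_unique A0 A1 D U (fun v => F' v - F v *m T) p0 oD s0 s1 oU cU UD Up0 _ _ u Uu).
  by rewrite T0 subrr.
move=> {Uu} {}u Uu; have [d e0 e1] := dF _ Uu; have [d' e0' e1'] := dF' _ Uu.
have dT := @differentiable_cst _ _ _ T u.
have dFT : differentiable (fun v => F v *m T) u := differentiable_mulmx d dT.
have eT k (A : 'M[R]_5) : pd k F u = A *m F u -> pd k F' u = A *m F' u ->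
    pd k (fun v => F' v - F v *m T) u = A *m (F' u - F u *m T).
  move=> e e'; rewrite /pd (@deriveB _ _ _ F' (fun v => F v *m T)).
  - rewrite -/(pd k F' u) -/(pd k (fun v => F v *m T) u) e' (pd_mulmx k d dT) e.
    have -> : pd k (cst T) u = 0 by exact: derive_cst.
    by rewrite mulmx0 addr0 mulmxBr mulmxA.
  - exact: diff_derivable.
  - exact: diff_derivable.
by split; [exact: differentiableB | exact: eT | exact: eT].
Qed.

Lemma lin14_framemx (f g : 'I_5 -> R14) (T : 'M[R]_5) i :
  framemx g = framemx f *m T -> lin14 T (f i) = g i.
Proof.
move=> e; apply: vec_inj; rewrite vec_lin14 -!row_framemx e.
by rewrite row_mul.
Qed.

(** The matrix carrying one frame to another with the same Gram matrix preserves the Minkowski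
    form. *)
Lemma lorentz_of_gram (F F' G : 'M[R]_5) : F \in unitmx ->
  F *m Jmx *m F^T = G -> F' *m Jmx *m F'^T = G -> lorentz (invmx F *m F').
Proof.
move=> UF FG FG'; rewrite /lorentz trmx_mul.
rewrite !mulmxA -(mulmxA _ F') -(mulmxA _ (F' *m Jmx)) FG' -FG !mulmxA mulVmx // mul1mx.
by rewrite -mulmxA -trmx_mul mulVmx // trmx1 mulmx1.
Qed.

Variables (D D0 : set pt) (p0 : pt).
Variables (Om : pt -> 'M[R]_2) (m E : pt -> R) (w : pt -> 'rV[R]_2) (Oms : pt -> 'M[R]_2).
Hypotheses (D_open : open D) (D0_open : open D0) (D0_connected : connected D0)
  (D0p0 : D0 p0) (D0D : D0 `<=` D).
Hypotheses (Om_smooth : smooth D Om) (m_smooth : smooth D m)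
  (w_smooth : smooth D w) (Oms_smooth : smooth D Oms).
Hypothesis m_gt0 : forall u, D u -> 0 < m u.
Hypothesis E_gt0 : forall u, D u -> 0 < E u.
Hypothesis Om10 : forall u, D u -> Om u 1 0 = Om u 0 1.
Hypothesis Om11 : forall u, D u -> Om u 1 1 = - Om u 0 0.
Hypothesis Om_norm : forall u, D u -> Om u 0 0 ^+ 2 + Om u 0 1 ^+ 2 = m u * E u.
Hypothesis Oms10 : forall u, D u -> Oms u 1 0 = Oms u 0 1.

Local Notation FR x n lam := (movmx (surface_frame x n lam m)).

Lemma realizes_structure x n lam u : realizes p0 Om m w Oms D0 x n lam -> D0 u ->
  [/\ differentiable (FR x n lam) u,
      pd 0 (FR x n lam) u = structure0 Om m w Oms u *m FR x n lam u &
      pd 1 (FR x n lam) u = structure1 Om m w Oms u *m FR x n lam u].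
Proof.
move=> rz; have ms : smooth D0 m by move=> k; exact: Ck_sub (m_smooth k).
exact: (surface_structure D0_open ms (fun v Dv => m_gt0 (D0D Dv)) (fun v Dv => E_gt0 (D0D Dv))
  (fun v Dv => Om10 (D0D Dv)) (fun v Dv => Om11 (D0D Dv)) (fun v Dv => Om_norm (D0D Dv))
  (fun v Dv => Oms10 (D0D Dv)) rz).
Qed.

Lemma realizes_gram x n lam u : realizes p0 Om m w Oms D0 x n lam -> D0 u ->
  FR x n lam u *m Jmx *m (FR x n lam u)^T = gram (m u).
Proof.
move=> rz Du; apply/adaptedP.
exact: (surface_frame_adapted D0_open (fun v Dv => m_gt0 (D0D Dv)) rz Du).
Qed.

Lemma realizes_congruent x n lam x' n' lam' :
  realizes p0 Om m w Oms D0 x n lam -> realizes p0 Om m w Oms D0 x' n' lam' ->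
  exists T : 'M[R]_5, lorentz T /\ forall u, D0 u ->
    lin14 T (lam u *: (1, x u)) = lam' u *: (1, x' u).
Proof.
move=> rz rz'; have m0 u : D0 u -> m u != 0 by move=> /D0D/m_gt0; rewrite lt0r => /andP[].
have G := realizes_gram rz; have G' := realizes_gram rz'.
have UF u : D0 u -> FR x n lam u \in unitmx.
  by move=> Du; apply: (adapted_unit (m0 _ Du)); apply/adaptedP; exact: G.
pose T := invmx (FR x n lam p0) *m FR x' n' lam' p0.
have T0 : FR x' n' lam' p0 = FR x n lam p0 *m T by rewrite mulKVmx // UF.
have m_neq0 u : D u -> m u != 0 by move=> /m_gt0; rewrite lt0r => /andP[].
have XE := flow_congruent D_open
    (smooth_structure0 D_open Om_smooth m_smooth w_smooth Oms_smooth m_neq0)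
    (smooth_structure1 D_open Om_smooth m_smooth w_smooth Oms_smooth m_neq0)
    D0_open D0_connected D0D D0p0 (fun u => realizes_structure rz)
    (fun u => realizes_structure rz') T0.
exists T; split; first exact: lorentz_of_gram (UF _ D0p0) (G _ D0p0) (G' _ D0p0).
by move=> u Du; exact: (lin14_framemx (o 0) (XE _ Du)).
Qed.

End Rigidity.

Theorem theorem3p3p1 (R : realType) (D : set 'rV[R]_2)
  (Om : 'rV[R]_2 -> 'M[R]_2) (m E : 'rV[R]_2 -> R)
  (w : 'rV[R]_2 -> 'rV[R]_2) (Oms : 'rV[R]_2 -> 'M[R]_2)
  (D_open : open D) (D_connected : connected D)
  (Om_smooth : smooth D Om) (m_smooth : smooth D m) (E_smooth : smooth D E)
  (w_smooth : smooth D w) (Oms_smooth : smooth D Oms)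
  (Om_sym : forall u, D u -> (Om u)^T = Om u)
  (Om_traceless : forall u, D u -> Om u 0 0 + Om u 1 1 = 0)
  (m_gt0 : forall u, D u -> 0 < m u)
  (E_gt0 : forall u, D u -> 0 < E u)
  (m_def : forall u, D u -> m u = - \det (Om u) / E u)
  (Oms_sym : forall u, D u -> (Oms u)^T = Oms u)
  (codazzi1 : forall u, D u ->
    cov2 (conformal_metric E) Om 0 0 1 u - cov2 (conformal_metric E) Om 0 1 0 u
    = w u 0 0 * Om u 0 1 - w u 0 1 * Om u 0 0)
  (codazzi2 : forall u, D u ->
    cov2 (conformal_metric E) Om 0 1 1 u - cov2 (conformal_metric E) Om 1 1 0 u
    = w u 0 0 * Om u 1 1 - w u 0 1 * Om u 0 1)
  (dual_codazzi1 : forall u, D u ->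
    cov2 (conformal_metric E) Oms 0 0 1 u - cov2 (conformal_metric E) Oms 0 1 0 u
    = - (w u 0 0 * Oms u 0 1) + w u 0 1 * Oms u 0 0
      + 2^-1 * ((Oms u 0 0 + Oms u 1 1) / sqnorm E Om u) * pd 1 (sqnorm E Om) u)
  (dual_codazzi2 : forall u, D u ->
    cov2 (conformal_metric E) Oms 0 1 1 u - cov2 (conformal_metric E) Oms 1 1 0 u
    = - (w u 0 0 * Oms u 1 1) + w u 0 1 * Oms u 0 1
      - 2^-1 * ((Oms u 0 0 + Oms u 1 1) / sqnorm E Om u) * pd 0 (sqnorm E Om) u)
  (ricci : forall u, D u ->
    cov1 (conformal_metric E) w 0 1 u - cov1 (conformal_metric E) w 1 0 u
    = (m u)^-1 * ((Om u 0 0 - Om u 1 1) * Oms u 0 1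
                  - (Oms u 0 0 - Oms u 1 1) * Om u 0 1))
  (gauss : forall u, D u ->
    gauss_curvature (conformal_metric m) u - 1
    = (m u) ^- 2 * \tr (Om u *m Oms u))
  (p0 : 'rV[R]_2) (p0D : D p0) :
  (exists (D0 : set 'rV[R]_2) (x n : 'rV[R]_2 -> 'rV[R]_4) (lam : 'rV[R]_2 -> R),
     [/\ open D0, connected D0, D0 p0, D0 `<=` D
       & realizes p0 Om m w Oms D0 x n lam]) /\
  (forall (D0 : set 'rV[R]_2) (x n x' n' : 'rV[R]_2 -> 'rV[R]_4)
     (lam lam' : 'rV[R]_2 -> R),
     open D0 -> connected D0 -> D0 p0 -> D0 `<=` D ->
     realizes p0 Om m w Oms D0 x n lam ->
     realizes p0 Om m w Oms D0 x' n' lam' ->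
     exists F : 'rV[R]_4 -> 'rV[R]_4, conformal_transformation F /\
       forall u, D0 u -> x' u = F (x u)).
Proof.
have m_neq0 u : D u -> m u != 0 by move=> /m_gt0; rewrite lt0r => /andP[].
have E_neq0 u : D u -> E u != 0 by move=> /E_gt0; rewrite lt0r => /andP[].
have Om10 u : D u -> Om u 1 0 = Om u 0 1 by move=> /Om_sym/sym10.
have Oms10 u : D u -> Oms u 1 0 = Oms u 0 1 by move=> /Oms_sym/sym10.
have Om11 u : D u -> Om u 1 1 = - Om u 0 0.
  by move=> Du; apply/eqP; rewrite -addr_eq0 addrC Om_traceless.
have Omn u := @Om_norm R D Om m E Om_sym Om_traceless E_neq0 m_def u.
have fl := structure_flat D_open Om_smooth m_smooth E_smooth w_smooth Oms_smooth m_neq0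
  Om_sym Om_traceless E_neq0 m_def Oms_sym codazzi1 codazzi2 dual_codazzi1 dual_codazzi2 ricci gauss.
split; first exact: (exists_surface D_open Om_smooth m_smooth w_smooth Oms_smooth m_gt0 E_gt0
  Om10 Om11 Omn Oms10 fl p0D).
move=> D0 x n x' n' lam lam' oD0 cD0 D0p0 D0D rz rz'.
have [T [LT TP]] := realizes_congruent D_open oD0 cD0 D0p0 D0D Om_smooth m_smooth w_smooth
  Oms_smooth m_gt0 E_gt0 Om10 Om11 Omn Oms10 rz rz'.
have L1 u : D0 u -> lin14 T (1, x u) = (lam' u / lam u) *: (1, x' u).
  move=> Du; have l0 : lam u != 0 by rewrite gt_eqF // (rz_lam_gt0 rz).
  by rewrite mulrC -scalerA -TP // lin14Z scalerA mulVf // scale1r.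
have L1fst u : D0 u -> (lin14 T (1, x u)).1 = lam' u / lam u.
  by move=> Du; rewrite L1 //= /GRing.scale /= mulr1.
have L1_gt0 u : D0 u -> 0 < (lin14 T (1, x u)).1.
  by move=> Du; rewrite L1fst // divr_gt0 // ?(rz_lam_gt0 rz') // (rz_lam_gt0 rz).
(* The factor lam' / lam is positive, so [T] keeps the null vector at [p0] in the future cone, and
   one such vector makes [T] orthochronous. Normalizing the time component cancels the factor. *)
exists (sphere_map T); split.
  by apply: (lorentz_conformal LT (is_sphere (rz_surface rz) D0p0)); exact: L1_gt0.
move=> u Du; have t0 : (lin14 T (1, x u)).1 != 0 by rewrite gt_eqF // L1_gt0.
rewrite /sphere_map {2}L1 // L1fst //= scalerA mulVf ?scale1r //.
by rewrite -L1fst.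
Qed.
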